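(* Let $n\ge0$ be an integer and $x>0$. Then, for either choice of the sign $\pm$, $$\left.\frac{\partial \mathrm{W}_{\kappa,\mu}(x)}{\partial\kappa}\right|_{\kappa=n/2,\ \mu=\pm(n+1)/2}=x^{-n/2}e^{x/2}\,\Gamma(1+n,x)\left[\mathrm{E}_1(x)+\ln x\right]+n!\,x^{n/2}e^{-x/2}\sum_{k=0}^{n}\frac{x^{-k}}{(n-k)!}\left[(-1)^{k+1}\,\Gamma(-k,x)\,\gamma(k+1,-x)-H_k-\sum_{\ell=1}^{k}\binom{k}{\ell}(-x)^{-\ell}\gamma(\ell,x)\right].$$
   Context: For $x>0$, the Whittaker function is $\mathrm{W}_{\kappa,\mu}(x)=e^{-x/2}x^{\mu+1/2}\,\mathrm{U}\left(\frac12+\mu-\kappa,1+2\mu,x\right)$, where $\mathrm{U}$ is the Tricomi confluent hypergeometric function. $\gamma(\nu,z)=\int_0^z t^{\nu-1}e^{-t}\,dt$ ($\mathrm{Re}\,\nu>0$) and $\Gamma(\nu,z)=\int_z^\infty t^{\nu-1}e^{-t}\,dt$ are the lower and upper incomplete gamma functions. $\mathrm{E}_1(x)=\int_x^\infty\frac{e^{-t}}{t}\,dt$ is the exponential integral. $H_k=\sum_{j=1}^k\frac1j$ is the $k$-th harmonic number ($H_0=0$). *)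

(* Defs.v *)
(* Stdlib reals with Coquelicot. *)
From Stdlib Require Import Reals ZArith ClassicalEpsilon.
From Coquelicot Require Import Coquelicot.
Open Scope R_scope.

(* x^a = e^(a ln x) for x > 0 and complex a (principal value). *)
Definition Rcpow (x : R) (a : C) : C :=
  (RtoC (exp (Re a * ln x)) *
     (cos (Im a * ln x), sin (Im a * ln x)))%C.

(* The standard characterisation of Tricomi's function, on the positive real
   axis: u solves Kummer's equation x u'' + (b - x) u' - a u = 0 and
   u(x) ~ x^(-a) as x -> +oo.  Every solution of the equation that is not a
   multiple of U(a,b,.) behaves like a nonzero multiple of e^x x^(a-b), so these
   two conditions determine u on (0,+oo) for all complex a and b, including
   integral b and nonpositive integral a. *)
Definition is_tricomiU (a b : C) (u : R -> C) : Prop :=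
  (exists u' u'' : R -> C, forall x : R, 0 < x ->
     is_derive (V := C_R_NormedModule) u x (u' x) /\
     is_derive (V := C_R_NormedModule) u' x (u'' x) /\
     (RtoC x * u'' x + (b - RtoC x) * u' x - a * u x = 0)%C) /\
  filterlim (fun x : R => (Rcpow x a * u x)%C)
    (Rbar_locally p_infty) (locally (RtoC 1)).

(* Only the values at x > 0 are meaningful. *)
Definition tricomiU (a b : C) : R -> C :=
  epsilon (inhabits (fun _ : R => RtoC 0)) (is_tricomiU a b).

Definition whittakerW (kappa mu : C) (x : R) : C :=
  (RtoC (exp (- x / 2)) * Rcpow x (mu + / 2)
     * tricomiU (/ 2 + mu - kappa) (1 + 2 * mu) x)%C.

(* The incomplete gamma functions at integral order.  The lower one is used for
   order at least 1, where the integrand is a polynomial times an exponential;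
   its second argument may be negative, the integral being then oriented from 0
   down to z.  The upper one is used for z > 0 and an order of any sign. *)
Definition lower_gamma (nu : Z) (z : R) : R :=
  RInt (fun t => powerRZ t (nu - 1) * exp (- t)) 0 z.

Definition upper_gamma (nu : Z) (z : R) : R :=
  RInt_gen (fun t => powerRZ t (nu - 1) * exp (- t))
    (at_point z) (Rbar_locally p_infty).

Definition expint_E1 (x : R) : R :=
  RInt_gen (fun t => exp (- t) / t) (at_point x) (Rbar_locally p_infty).

Definition harmonic (k : nat) : R := sum_n_m (fun j => / INR j) 1 k.

(* Main.v *)
Require Import Defs.
From Stdlib Require Import Reals ZArith Lra Lia ClassicalEpsilon.
From Coquelicot Require Import Coquelicot.
Open Scope R_scope.

(* Write kappa = n/2 + e. For mu = (n+1)/2 the Tricomi function involved is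
   U(1-e, n+2, x) = I(e,x) / N(e), where I(e,x) is the integral over t > 0 of
   exp(-xt) (1+t)^n ((1+t)/t)^e and N(e) that of exp(-t) t^(-e), i.e. Gamma(1-e);
   the case mu = -(n+1)/2 follows from Kummer's transformation, which multiplies
   by x^(n+1).  This solution is the one selected by the definition of U: if f
   solves Kummer's equation and has polynomial growth, then so has f', hence the
   Wronskian of two such solutions, a constant times x^(-b) exp(x), vanishes.

   Expanding both integrals to first order in e, the derivative at e = 0 is
   I_1 - gamma I_0, where I_0, I_1 are the Laplace transforms of (1+t)^n and of
   (1+t)^n ln((1+t)/t), and gamma is Euler's constant.  The binomial formula
   reduces I_1 to the transforms of t^k ln t and t^k ln(1+t), which satisfy
   recursions in k obtained by integration by parts; the right-hand side of the
   theorem satisfies the same recursions. *)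

(** * Absolutely convergent integrals over the half-line *)

(** [tricomiU] is picked by a choice operator, so nothing is known about its dependence on kappa
    until it has been identified for every complex e near 0. Hence existence and uniqueness are both
    proved for complex a, although only the derivative at a real point is wanted. Every exchange of
    a limit with an integral is replaced by a Taylor estimate with explicit quadratic remainder,
    integrated against one fixed majorant. The delicate end is t = 0: for e of modulus at most 1/8,
    the singular power together with the two logarithms of the remainder stays below a multiple of
    (1+t)/sqrt t, which is still integrable there. Substitutions in improper integrals are avoided:
    an identity between functions of x is obtained by differentiating in x and fixing the constant
    at 1 or at infinity. Euler's constant is never evaluated. It enters once through N(e) and once
    through the transforms of t^k ln t, and the two contributions cancel. *)

Notation is_Iint f l := (is_RInt_gen f (at_right 0) (Rbar_locally p_infty) l).

Lemma at_right_pos : at_right 0 (fun t => 0 < t).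
Proof. exists (mkposreal 1 Rlt_0_1); intros y _ Hy; exact Hy. Qed.

Lemma p_infty_gt (M : R) : Rbar_locally p_infty (fun t => M < t).
Proof. exists M; intros y Hy; exact Hy. Qed.

Lemma prod_pos : filter_prod (at_right 0) (Rbar_locally p_infty)
  (fun ab : R * R => 0 < fst ab /\ fst ab <= snd ab).
Proof.
exists (fun a => 0 < a < 1) (fun b => 1 < b).
- exists (mkposreal 1 Rlt_0_1); intros y By Hy.
  assert (H := Rabs_def2 _ _ By); unfold minus, plus, opp in H; simpl in H; lra.
- apply p_infty_gt.
- simpl; intros; lra.
Qed.

Lemma is_RInt_pos_primitive (F f : R -> R) (a b : R) :
  0 < a -> 0 < b ->
  (forall t, 0 < t -> is_derive F t (f t)) ->
  (forall t, 0 < t -> continuous f t) ->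
  is_RInt f a b (F b - F a).
Proof.
intros Ha Hb HF Hf.
assert (Hm : forall t, Rmin a b <= t -> 0 < t).
{ intros t; apply Rlt_le_trans; apply Rmin_case; assumption. }
apply (is_RInt_derive (V := R_CompleteNormedModule)); intros t Ht.
- apply HF, Hm, Ht.
- apply Hf, Hm, Ht.
Qed.

(** The two filters are left arbitrary because the lemma serves both the half-line from 0 and, with
    [at_point x], the tails that define the upper incomplete gamma functions. *)
Lemma is_RInt_gen_primitive (Fa Fb : (R -> Prop) -> Prop) {FFa : Filter Fa}
  {FFb : Filter Fb} (F f : R -> R) (la lb : R) :
  Fa (fun t => 0 < t) -> Fb (fun t => 0 < t) ->
  (forall t, 0 < t -> is_derive F t (f t)) ->
  (forall t, 0 < t -> continuous f t) ->
  filterlim F Fa (locally la) -> filterlim F Fb (locally lb) ->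
  is_RInt_gen f Fa Fb (lb - la).
Proof.
intros Pa Pb HF Hf La Lb.
apply (filterlimi_lim_ext_loc (fun ab : R * R => F (snd ab) - F (fst ab))).
- exists (fun t => 0 < t) (fun t => 0 < t); try assumption.
  intros a b Ha Hb; apply is_RInt_pos_primitive; assumption.
- apply (filterlim_comp_2 (F := filter_prod Fa Fb) (fun ab : R * R => F (snd ab))
    (fun ab : R * R => - F (fst ab)) Rplus (G := locally lb) (H := locally (- la))).
  + apply filterlim_comp with (2 := Lb); apply filterlim_snd.
  + apply filterlim_comp with (f := fun ab : R * R => F (fst ab)) (G := locally la).
    * apply filterlim_comp with (2 := La); apply filterlim_fst.
    * apply (filterlim_opp (V := R_NormedModule) la).
  + apply (filterlim_plus (V := R_NormedModule) lb (- la)).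
Qed.

Lemma ex_RInt_pos (f : R -> R) (a b : R) :
  0 < a -> 0 < b -> (forall t, 0 < t -> continuous f t) -> ex_RInt f a b.
Proof.
intros Ha Hb Hf; apply (ex_RInt_continuous (V := R_CompleteNormedModule)).
intros t Ht; apply Hf; apply Rlt_le_trans with (2 := proj1 Ht).
apply Rmin_case; assumption.
Qed.

Lemma is_Iint_plus (f g : R -> R) (lf lg : R) :
  is_Iint f lf -> is_Iint g lg -> is_Iint (fun t => f t + g t) (lf + lg).
Proof. apply (is_RInt_gen_plus (V := R_NormedModule) f g). Qed.

Lemma is_Iint_scal (k : R) (f : R -> R) (l : R) :
  is_Iint f l -> is_Iint (fun t => k * f t) (k * l).
Proof. apply (is_RInt_gen_scal (V := R_NormedModule) f k l). Qed.

(* Dominates every integrand below; its integral over (0,+oo) is 1. *)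
Definition majorant (t : R) : R := / (2 * sqrt t * (1 + sqrt t) ^ 2).
Definition majorant_int (t : R) : R := 1 - / (1 + sqrt t).

Lemma majorant_pos (t : R) : 0 < t -> 0 < majorant t.
Proof.
intros Ht; unfold majorant; apply Rinv_0_lt_compat.
assert (0 < sqrt t) by (apply sqrt_lt_R0; assumption); nra.
Qed.

Lemma is_derive_majorant_int (t : R) : 0 < t -> is_derive majorant_int t (majorant t).
Proof.
intros Ht; assert (Hs : 0 < sqrt t) by (apply sqrt_lt_R0; assumption).
unfold majorant_int, majorant; auto_derive; [split; [lra | split; [lra | trivial]] |].
field; lra.
Qed.

Lemma continuous_majorant (t : R) : 0 < t -> continuous majorant t.
Proof.
intros Ht; assert (Hs : 0 < sqrt t) by (apply sqrt_lt_R0; assumption).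
apply (ex_derive_continuous (V := R_NormedModule)).
unfold majorant; auto_derive; repeat split; nra.
Qed.

Lemma filterlim_majorant_int_0 : filterlim majorant_int (at_right 0) (locally 0).
Proof.
apply (filterlim_filter_le_1 (F := locally 0) (G := at_right 0) majorant_int).
- apply filter_le_within.
- replace 0 with (majorant_int 0) at 2
    by (unfold majorant_int; rewrite sqrt_0, Rplus_0_r, Rinv_1; ring).
  assert (C : continuous sqrt 0) by (apply continuity_pt_filterlim, continuity_pt_sqrt; lra).
  apply (continuous_comp sqrt (fun s => 1 - / (1 + s))); [exact C |].
  apply (ex_derive_continuous (V := R_NormedModule)).
  rewrite sqrt_0; auto_derive; lra.
Qed.

Lemma filterlim_majorant_int_p : filterlim majorant_int (Rbar_locally p_infty) (locally 1).
Proof.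
apply filterlim_locally; intros eps.
assert (He := cond_pos eps).
exists ((/ eps) ^ 2); intros t Ht.
assert (Hi : 0 < / eps) by (apply Rinv_0_lt_compat; assumption).
assert (Hs : / eps < sqrt t).
{ rewrite <- (sqrt_pow2 (/ eps)) by lra; apply sqrt_lt_1; nra. }
change (Rabs (majorant_int t - 1) < eps); unfold majorant_int.
replace (1 - / (1 + sqrt t) - 1) with (- / (1 + sqrt t)) by ring.
rewrite Rabs_Ropp, Rabs_pos_eq by (apply Rlt_le, Rinv_0_lt_compat; lra).
rewrite <- (Rinv_inv eps); apply Rinv_lt_contravar; nra.
Qed.

Lemma is_Iint_majorant : is_Iint majorant 1.
Proof.
replace 1 with (1 - 0) by ring.
apply is_RInt_gen_primitive with (F := majorant_int); try typeclasses eauto.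
- apply at_right_pos.
- apply p_infty_gt.
- apply is_derive_majorant_int.
- apply continuous_majorant.
- apply filterlim_majorant_int_0.
- apply filterlim_majorant_int_p.
Qed.

Definition dominated (f : R -> R) : Prop :=
  (forall t, 0 < t -> continuous f t) /\
  exists K, forall t, 0 < t -> Rabs (f t) <= K * majorant t.

Lemma RInt_dominated_bound (f : R -> R) (K a b : R) :
  (forall t, 0 < t -> continuous f t) ->
  (forall t, 0 < t -> Rabs (f t) <= K * majorant t) ->
  0 < a -> a <= b -> Rabs (RInt f a b) <= K * (majorant_int b - majorant_int a).
Proof.
intros Cf Bf Ha Hab.
apply (norm_RInt_le (V := R_NormedModule) f (fun t => K * majorant t) a b); [exact Hab | | |].
- intros t Ht; apply Bf; lra.
- apply (RInt_correct (V := R_CompleteNormedModule)), ex_RInt_pos; try assumption; lra.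
- apply (is_RInt_scal (V := R_NormedModule) majorant a b K).
  apply is_RInt_pos_primitive; try lra; [apply is_derive_majorant_int | apply continuous_majorant].
Qed.

(** Endpoints in either order are needed for the Cauchy criterion, where two truncations of the
    half-line are compared and nothing is known about their relative position. *)
Lemma RInt_dominated_bound_abs (f : R -> R) (K a b : R) :
  (forall t, 0 < t -> continuous f t) ->
  (forall t, 0 < t -> Rabs (f t) <= K * majorant t) ->
  0 < a -> 0 < b -> Rabs (RInt f a b) <= K * Rabs (majorant_int b - majorant_int a).
Proof.
intros Cf Bf Ha Hb.
assert (HK : 0 <= K).
{ assert (H1 := Bf 1 Rlt_0_1); assert (H2 := majorant_pos 1 Rlt_0_1).
  assert (H3 := Rabs_pos (f 1)); nra. }
assert (Hw : forall u v, 0 < u -> u <= v ->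
  Rabs (RInt f u v) <= K * Rabs (majorant_int v - majorant_int u)).
{ intros u v Hu Huv; eapply Rle_trans; [apply RInt_dominated_bound; eassumption |].
  apply Rmult_le_compat_l; [exact HK | apply Rle_abs]. }
destruct (Rle_dec a b) as [Hab | Hab]; [apply Hw; assumption |].
assert (Hs : opp (RInt f b a) = RInt f a b).
{ apply (opp_RInt_swap f b a), ex_RInt_pos; assumption. }
rewrite <- Hs; change (opp (RInt f b a)) with (- RInt f b a).
rewrite Rabs_Ropp, Rabs_minus_sym; apply Hw; lra.
Qed.

Lemma ex_Iint_dominated (f : R -> R) : dominated f -> exists l, is_Iint f l.
Proof.
intros [Cf [K Bf]].
assert (HK : 0 <= K).
{ assert (H1 := Bf 1 Rlt_0_1); assert (H2 := majorant_pos 1 Rlt_0_1).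
  assert (H3 := Rabs_pos (f 1)); nra. }
assert (Hl : exists l : R, filterlim (fun ab : R * R => RInt f (fst ab) (snd ab))
  (filter_prod (at_right 0) (Rbar_locally p_infty)) (locally l)).
{ apply (filterlim_locally_cauchy (U := R_CompleteSpace)).
  intros eps.
  (* Two truncations differ by one integral near 0 and one near infinity, and in each of them
     [majorant_int] varies by at most twice this quantity; so the total is at most 4 K times it. The
     [K + 1] also keeps the denominator positive when K = 0. *)
  assert (Hd : 0 < eps / (4 * (K + 1))).
  { apply Rdiv_lt_0_compat; [apply cond_pos | lra]. }
  set (d := mkposreal _ Hd).
  exists (fun ab : R * R => (0 < fst ab /\ ball 0 d (majorant_int (fst ab))) /\
    (0 < snd ab /\ ball 1 d (majorant_int (snd ab)))).
  split.
  - exists (fun a => 0 < a /\ ball 0 d (majorant_int a)) (fun b => 0 < b /\ ball 1 d (majorant_int b)).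
    + apply filter_and; [apply at_right_pos |].
      apply filterlim_majorant_int_0, locally_ball.
    + apply filter_and; [apply p_infty_gt |].
      apply filterlim_majorant_int_p, locally_ball.
    + intros a b Ha Hb; split; assumption.
  - intros [a b] [a' b']; simpl; intros [[Ha Ba] [Hb Bb]] [[Ha' Ba'] [Hb' Bb']].
    change (Rabs (RInt f a' b' - RInt f a b) < eps).
    assert (E1 := RInt_Chasles f a a' b' (ex_RInt_pos f a a' Ha Ha' Cf)
      (ex_RInt_pos f a' b' Ha' Hb' Cf)).
    assert (E2 := RInt_Chasles f a b b' (ex_RInt_pos f a b Ha Hb Cf)
      (ex_RInt_pos f b b' Hb Hb' Cf)).
    change (RInt f a a' + RInt f a' b' = RInt f a b') in E1.
    change (RInt f a b + RInt f b b' = RInt f a b') in E2.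
    replace (RInt f a' b' - RInt f a b) with (RInt f b b' - RInt f a a') by lra.
    assert (B1 := RInt_dominated_bound_abs f K a a' Cf Bf Ha Ha').
    assert (B2 := RInt_dominated_bound_abs f K b b' Cf Bf Hb Hb').
    assert (D1 : Rabs (majorant_int a' - majorant_int a) <= 2 * d).
    { apply Rabs_def2 in Ba; apply Rabs_def2 in Ba'.
      unfold minus, plus, opp in Ba, Ba'; simpl in Ba, Ba'.
      apply Rabs_le; unfold d; simpl; lra. }
    assert (D2 : Rabs (majorant_int b' - majorant_int b) <= 2 * d).
    { apply Rabs_def2 in Bb; apply Rabs_def2 in Bb'.
      unfold minus, plus, opp in Bb, Bb'; simpl in Bb, Bb'.
      apply Rabs_le; unfold d; simpl; lra. }
    assert (Ed : (K + 1) * (4 * d) = eps) by (unfold d; simpl; field; lra).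
    assert (Hd' : 0 < d) by apply cond_pos.
    assert (T := Rabs_triang (RInt f b b') (- RInt f a a')).
    rewrite Rabs_Ropp in T; unfold Rminus; nra. }
destruct Hl as [l Hl]; exists l.
apply (filterlimi_lim_ext_loc (fun ab : R * R => RInt f (fst ab) (snd ab))); [| exact Hl].
apply filter_imp with (2 := prod_pos); intros [a b] [Ha Hab]; simpl in *.
apply (RInt_correct (V := R_CompleteNormedModule)), ex_RInt_pos; try assumption; lra.
Qed.

Lemma is_Iint_bound (f : R -> R) (K l : R) :
  (forall t, 0 < t -> Rabs (f t) <= K * majorant t) -> is_Iint f l -> Rabs l <= K.
Proof.
intros Bf Hf.
apply (RInt_gen_norm (V := R_CompleteNormedModule) (Fa := at_right 0)
  (Fb := Rbar_locally p_infty) f (fun t => K * majorant t)).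
- apply filter_imp with (2 := prod_pos); intros; tauto.
- apply filter_imp with (2 := prod_pos); intros ab Hab t Ht; apply Bf; lra.
- exact Hf.
- assert (H := is_Iint_scal K majorant 1 is_Iint_majorant); rewrite Rmult_1_r in H; exact H.
Qed.

Lemma is_Iint_ext (f g : R -> R) (l : R) :
  (forall t, 0 < t -> f t = g t) -> is_Iint f l -> is_Iint g l.
Proof.
intros E; apply is_RInt_gen_ext.
apply filter_imp with (2 := prod_pos); intros ab Hab t Ht; apply E.
rewrite Rmin_left in Ht; lra.
Qed.

Lemma is_Iint_unique (f : R -> R) (l1 l2 : R) :
  is_Iint f l1 -> is_Iint f l2 -> l1 = l2.
Proof.
intros H1 H2; rewrite <- (is_RInt_gen_unique (V := R_CompleteNormedModule) f l1 H1).
apply (is_RInt_gen_unique (V := R_CompleteNormedModule)), H2.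
Qed.

(** * Laplace transforms *)

Lemma exp_le (a b : R) : a <= b -> exp a <= exp b.
Proof. intros [H | ->]; [apply Rlt_le, exp_increasing, H | apply Rle_refl]. Qed.

(** Each factor 1 + t is absorbed by half of the decay rate, since 1 + u <= exp u bounds exp (-(x/2)
    t) (1 + t) by 1 + 2/x; the induction hypothesis is then applied at the rate x/2. *)
Lemma exp_poly_bound (m : nat) (x : R) :
  0 < x -> exists K, 0 < K /\ forall t, 0 <= t -> exp (- (x * t)) * (1 + t) ^ m <= K.
Proof.
revert x; induction m as [| m IH]; intros x Hx.
- exists 1; split; [lra |]; intros t Ht; rewrite Rmult_1_r, <- exp_0.
  apply exp_le; nra.
- destruct (IH (x / 2)) as [K [HK HB]]; [lra |].
  assert (Hi : 0 < 2 / x) by (apply Rdiv_lt_0_compat; lra).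
  exists (K * (1 + 2 / x)); split; [apply Rmult_lt_0_compat; lra |].
  intros t Ht.
  replace (exp (- (x * t)) * (1 + t) ^ S m)
    with ((exp (- (x / 2 * t)) * (1 + t) ^ m) * (exp (- (x / 2 * t)) * (1 + t))).
  2: { replace (- (x * t)) with (- (x / 2 * t) + - (x / 2 * t)) by field.
       rewrite exp_plus; simpl; ring. }
  apply Rmult_le_compat; [| | apply HB; exact Ht |].
  + apply Rmult_le_pos; [apply Rlt_le, exp_pos | apply pow_le; lra].
  + apply Rmult_le_pos; [apply Rlt_le, exp_pos | lra].
  + rewrite exp_Ropp; assert (Hp := exp_pos (x / 2 * t)).
    assert (H1 := exp_ineq1_le (x / 2 * t)).
    apply Rmult_le_reg_l with (exp (x / 2 * t)); [exact Hp |].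
    rewrite <- Rmult_assoc, Rinv_r, Rmult_1_l by lra.
    assert (2 / x * (x / 2 * t) = t) by (field; lra).
    assert (0 <= x / 2 * t) by nra.
    nra.
Qed.

(* The factor [/ sqrt t] leaves room for a power [t^(-e)] with [e] complex and small. *)
Definition tempered (f : R -> R) : Prop :=
  (forall t, 0 < t -> continuous f t) /\
  exists C m, 0 <= C /\ forall t, 0 < t -> Rabs (f t) <= C * (1 + t) ^ m / sqrt t.

(** This is (1 + sqrt t)^2 <= 2 (1 + t), that is, (1 - sqrt t)^2 >= 0. *)
Lemma majorant_lower (t : R) : 0 < t -> / (4 * sqrt t * (1 + t)) <= majorant t.
Proof.
intros Ht; unfold majorant; assert (Hs : 0 < sqrt t) by (apply sqrt_lt_R0; assumption).
assert (E := sqrt_sqrt t (Rlt_le _ _ Ht)).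
assert (H := pow2_ge_0 (1 - sqrt t)); assert (0 < (1 + sqrt t) ^ 2) by (apply pow_lt; lra).
apply Rinv_le_contravar; [apply Rmult_lt_0_compat; lra |].
replace (4 * sqrt t * (1 + t)) with (2 * sqrt t * (2 * (1 + t))) by ring.
apply Rmult_le_compat_l; nra.
Qed.

Lemma tempered_bound (C : R) (m : nat) (x : R) :
  0 <= C -> 0 < x -> exists K, 0 <= K /\
  forall t, 0 < t -> exp (- (x * t)) * (C * (1 + t) ^ m / sqrt t) <= K * majorant t.
Proof.
(* One power more than [m]: the extra factor 1 + t pays for the denominator in [majorant_lower]. *)
intros HC Hx; destruct (exp_poly_bound (S m) x Hx) as [K [HK HB]].
exists (C * K * 4); split; [nra |]; intros t Ht.
assert (Hs : 0 < sqrt t) by (apply sqrt_lt_R0; assumption).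
apply Rle_trans with (C * K * 4 * / (4 * sqrt t * (1 + t))).
2: { apply Rmult_le_compat_l; [nra | apply majorant_lower; exact Ht]. }
specialize (HB t (Rlt_le _ _ Ht)).
replace (exp (- (x * t)) * (C * (1 + t) ^ m / sqrt t))
  with ((exp (- (x * t)) * (1 + t) ^ S m) * (C / (sqrt t * (1 + t))))
  by (simpl; field; lra).
replace (C * K * 4 * / (4 * sqrt t * (1 + t))) with (K * (C / (sqrt t * (1 + t))))
  by (field; lra).
apply Rmult_le_compat_r; [| exact HB].
apply Rle_mult_inv_pos; [exact HC | nra].
Qed.

Lemma continuous_exp_lin (x t : R) : continuous (fun t => exp (- (x * t))) t.
Proof. apply (ex_derive_continuous (V := R_NormedModule)); auto_derive; trivial. Qed.

Lemma dominated_laplace (f : R -> R) (x : R) :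
  tempered f -> 0 < x -> dominated (fun t => exp (- (x * t)) * f t).
Proof.
intros [Cf [C [m [HC HB]]]] Hx; split.
- intros t Ht; apply (continuous_mult (K := R_AbsRing)); [apply continuous_exp_lin | apply Cf, Ht].
- destruct (tempered_bound C m x HC Hx) as [K [HK H]]; exists K; intros t Ht.
  rewrite Rabs_mult, (Rabs_pos_eq (exp _)) by apply Rlt_le, exp_pos.
  apply Rle_trans with (2 := H t Ht); apply Rmult_le_compat_l; [apply Rlt_le, exp_pos |].
  apply HB, Ht.
Qed.

Definition laplace (f : R -> R) (x : R) : R :=
  RInt_gen (fun t => exp (- (x * t)) * f t) (at_right 0) (Rbar_locally p_infty).

Lemma is_Iint_laplace (f : R -> R) (x : R) :
  tempered f -> 0 < x -> is_Iint (fun t => exp (- (x * t)) * f t) (laplace f x).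
Proof.
intros Hf Hx; apply (RInt_gen_correct (V := R_CompleteNormedModule)).
apply ex_Iint_dominated, dominated_laplace; assumption.
Qed.

Lemma laplace_unique (f : R -> R) (x l : R) :
  is_Iint (fun t => exp (- (x * t)) * f t) l -> laplace f x = l.
Proof. apply (is_RInt_gen_unique (V := R_CompleteNormedModule)). Qed.

Lemma laplace_ext (f g : R -> R) (x : R) :
  tempered f -> 0 < x -> (forall t, 0 < t -> f t = g t) -> laplace g x = laplace f x.
Proof.
intros Hf Hx E; apply laplace_unique.
apply is_Iint_ext with (2 := is_Iint_laplace f x Hf Hx).
intros t Ht; rewrite E; [reflexivity | exact Ht].
Qed.

Lemma laplace_plus (f g : R -> R) (x : R) :
  tempered f -> tempered g -> 0 < x ->
  laplace (fun t => f t + g t) x = laplace f x + laplace g x.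
Proof.
intros Hf Hg Hx; apply laplace_unique.
apply is_Iint_ext with (fun t => exp (- (x * t)) * f t + exp (- (x * t)) * g t).
- intros t _; ring.
- apply is_Iint_plus; apply is_Iint_laplace; assumption.
Qed.

Lemma laplace_scal (k : R) (f : R -> R) (x : R) :
  tempered f -> 0 < x -> laplace (fun t => k * f t) x = k * laplace f x.
Proof.
intros Hf Hx; apply laplace_unique.
apply is_Iint_ext with (fun t => k * (exp (- (x * t)) * f t)).
- intros t _; ring.
- apply is_Iint_scal, is_Iint_laplace; assumption.
Qed.

Lemma tempered_plus (f g : R -> R) :
  tempered f -> tempered g -> tempered (fun t => f t + g t).
Proof.
intros [Cf [C [m [HC HB]]]] [Cg [D [k [HD HE]]]]; split.
- intros t Ht; apply (continuous_plus (V := R_NormedModule)); auto.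
- exists (C + D), (m + k)%nat; split; [lra |]; intros t Ht.
  specialize (HB t Ht); specialize (HE t Ht).
  assert (Hs : 0 < sqrt t) by (apply sqrt_lt_R0; assumption).
  assert (Hi : 0 < / sqrt t) by (apply Rinv_0_lt_compat; assumption).
  assert (P1 : (1 + t) ^ m <= (1 + t) ^ (m + k)) by (apply Rle_pow; [lra | lia]).
  assert (P2 : (1 + t) ^ k <= (1 + t) ^ (m + k)) by (apply Rle_pow; [lra | lia]).
  assert (T := Rabs_triang (f t) (g t)).
  apply Rle_trans with (1 := T).
  apply Rle_trans with (C * (1 + t) ^ m / sqrt t + D * (1 + t) ^ k / sqrt t); [lra |].
  unfold Rdiv; rewrite <- Rmult_plus_distr_r; apply Rmult_le_compat_r; [lra |].
  nra.
Qed.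

Lemma tempered_mult (f g : R -> R) :
  (forall t, 0 < t -> continuous f t) ->
  (exists C m, 0 <= C /\ forall t, 0 < t -> Rabs (f t) <= C * (1 + t) ^ m) ->
  tempered g -> tempered (fun t => f t * g t).
Proof.
intros Cf [C [m [HC HB]]] [Cg [D [k [HD HE]]]]; split.
- intros t Ht; apply (continuous_mult (K := R_AbsRing)); auto.
- exists (C * D), (m + k)%nat; split; [nra |]; intros t Ht.
  rewrite Rabs_mult.
  replace (C * D * (1 + t) ^ (m + k) / sqrt t)
    with ((C * (1 + t) ^ m) * (D * (1 + t) ^ k / sqrt t))
    by (rewrite pow_add; field; apply Rgt_not_eq, sqrt_lt_R0; assumption).
  apply Rmult_le_compat; auto; apply Rabs_pos.
Qed.

Lemma tempered_scal (k : R) (f : R -> R) : tempered f -> tempered (fun t => k * f t).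
Proof.
apply tempered_mult.
- intros; apply continuous_const.
- exists (Rabs k), 0%nat; split; [apply Rabs_pos |]; intros; simpl; lra.
Qed.

Lemma tempered_id_mult (f : R -> R) : tempered f -> tempered (fun t => t * f t).
Proof.
apply tempered_mult.
- intros; apply continuous_id.
- exists 1, 1%nat; split; [lra |]; intros; rewrite Rabs_pos_eq; simpl; lra.
Qed.

(** The inequality 1 + u <= exp u, used at u and at -u, gives 0 <= exp u - 1 - u <= u (exp u - 1),
    and exp u - 1 lies between u and u exp u. *)
Lemma exp_taylor2 (u : R) : Rabs (exp u - 1 - u) <= u ^ 2 * exp (Rabs u).
Proof.
assert (H1 := exp_ineq1_le u); assert (H2 := exp_ineq1_le (- u)).
assert (H3 : exp u - 1 <= u * exp u).
{ assert (E : exp u * exp (- u) = 1) by (rewrite <- exp_plus, Rplus_opp_r; apply exp_0).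
  assert (H4 := exp_pos u); nra. }
rewrite Rabs_pos_eq by lra.
destruct (Rle_dec 0 u) as [Hu | Hu].
- rewrite Rabs_pos_eq by assumption; assert (H4 := exp_pos u); nra.
- assert (H5 : 1 <= exp (Rabs u)).
  { rewrite <- exp_0; apply exp_le, Rabs_pos. }
  nra.
Qed.

Lemma is_derive_quadratic (f : R -> R) (x l C d : R) :
  0 < d -> (forall h, Rabs h < d -> Rabs (f (x + h) - f x - h * l) <= C * h ^ 2) ->
  is_derive f x l.
Proof.
intros Hd H; apply is_derive_Reals; intros eps He.
assert (Hp : 0 < eps / (Rabs C + 1)).
{ apply Rdiv_lt_0_compat; [exact He |]; assert (HC := Rabs_pos C); lra. }
assert (Hm : 0 < Rmin d (eps / (Rabs C + 1))) by (apply Rmin_pos; assumption).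
exists (mkposreal _ Hm); intros h Hh Hlt; simpl in Hlt.
assert (L1 : Rabs h < d) by (apply Rlt_le_trans with (1 := Hlt), Rmin_l).
assert (L2 : Rabs h < eps / (Rabs C + 1)) by (apply Rlt_le_trans with (1 := Hlt), Rmin_r).
specialize (H h L1).
assert (Hah := Rabs_pos_lt h Hh).
replace ((f (x + h) - f x) / h - l) with ((f (x + h) - f x - h * l) / h) by (field; exact Hh).
unfold Rdiv; rewrite Rabs_mult, Rabs_inv.
apply Rmult_lt_reg_r with (Rabs h); [exact Hah |].
rewrite Rmult_assoc, Rinv_l, Rmult_1_r by lra.
apply Rle_lt_trans with (1 := H).
assert (HC := Rabs_pos C); assert (HC' := Rle_abs C).
rewrite <- pow2_abs.
apply Rle_lt_trans with ((Rabs C * Rabs h) * Rabs h); [nra |].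
apply Rmult_lt_compat_r; [exact Hah |].
apply (Rmult_lt_compat_l (Rabs C + 1)) in L2; [| lra].
replace ((Rabs C + 1) * (eps / (Rabs C + 1))) with eps in L2 by (field; lra).
nra.
Qed.

(** The Taylor remainder of exp (-h t) is at most (h t)^2 exp (|h| t). For |h| < x/2 this
    exponential uses up half of the decay rate, and what is left is h^2 times the integrable
    function exp (-(x/2) t) t^2 |f t|. *)
Lemma is_derive_laplace (f : R -> R) (x : R) :
  tempered f -> 0 < x ->
  is_derive (laplace f) x (- laplace (fun t => t * f t) x).
Proof.
intros Hf Hx.
assert (Htf := tempered_id_mult f Hf).
destruct (tempered_id_mult _ Htf) as [_ [C [m [HC HB]]]].
destruct (tempered_bound C m (x / 2) HC) as [K [HK Hdom]]; [lra |].
apply (is_derive_quadratic _ _ _ K (x / 2)); [lra |]; intros h Hh.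
assert (Hxh : 0 < x + h) by (apply Rabs_def2 in Hh; lra).
apply is_Iint_bound with (fun t => exp (- (x * t)) * ((exp (- (h * t)) - 1 - (- (h * t))) * f t)).
- intros t Ht.
  rewrite !Rabs_mult, (Rabs_pos_eq (exp _)) by apply Rlt_le, exp_pos.
  specialize (HB t Ht); specialize (Hdom t Ht).
  rewrite !Rabs_mult, (Rabs_pos_eq t) in HB by lra.
  assert (HE := exp_taylor2 (- (h * t))).
  assert (HF : exp (- (x * t)) * exp (Rabs (- (h * t))) <= exp (- (x / 2 * t))).
  { rewrite <- exp_plus; apply exp_le.
    rewrite Rabs_Ropp, Rabs_mult, (Rabs_pos_eq t) by lra; nra. }
  assert (Hp := exp_pos (- (x * t))); assert (Hp2 := exp_pos (- (x / 2 * t))).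
  assert (Hp3 := exp_pos (Rabs (- (h * t)))).
  assert (Hft := Rabs_pos (f t)).
  apply Rle_trans with (exp (- (x * t)) * ((h * t) ^ 2 * exp (Rabs (- (h * t))) * Rabs (f t))).
  { apply Rmult_le_compat_l; [lra |]; apply Rmult_le_compat_r; [exact Hft |].
    replace ((h * t) ^ 2) with ((- (h * t)) ^ 2) by ring; exact HE. }
  apply Rle_trans with (h ^ 2 * (exp (- (x / 2 * t)) * (t * (t * Rabs (f t))))).
  { replace (exp (- (x * t)) * ((h * t) ^ 2 * exp (Rabs (- (h * t))) * Rabs (f t)))
      with (exp (- (x * t)) * exp (Rabs (- (h * t))) * (h ^ 2 * (t * (t * Rabs (f t))))) by ring.
    replace (h ^ 2 * (exp (- (x / 2 * t)) * (t * (t * Rabs (f t)))))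
      with (exp (- (x / 2 * t)) * (h ^ 2 * (t * (t * Rabs (f t))))) by ring.
    apply Rmult_le_compat_r; [| exact HF].
    apply Rmult_le_pos; [apply pow2_ge_0 |]; repeat apply Rmult_le_pos; lra. }
  assert (Hh2 := pow2_ge_0 h).
  replace (K * h ^ 2 * majorant t) with (h ^ 2 * (K * majorant t)) by ring.
  apply Rmult_le_compat_l; [exact Hh2 |].
  apply Rle_trans with (2 := Hdom); apply Rmult_le_compat_l; lra.
- apply is_Iint_ext with (fun t => exp (- ((x + h) * t)) * f t + (-1 * (exp (- (x * t)) * f t)
      + h * (exp (- (x * t)) * (t * f t)))).
  { intros t _; replace (- ((x + h) * t)) with (- (x * t) + - (h * t)) by ring.
    rewrite exp_plus; ring. }
  replace (_ - _ - _) with (laplace f (x + h) + (-1 * laplace f x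
    + h * laplace (fun t => t * f t) x)) by ring.
  apply is_Iint_plus; [| apply is_Iint_plus; apply is_Iint_scal];
    apply is_Iint_laplace; assumption.
Qed.

Lemma Iint_le (f g : R -> R) (lf lg : R) :
  (forall t, 0 < t -> Rabs (f t) <= g t) -> is_Iint f lf -> is_Iint g lg -> Rabs lf <= lg.
Proof.
intros H; apply (RInt_gen_norm (V := R_CompleteNormedModule) (Fa := at_right 0)
  (Fb := Rbar_locally p_infty) f g).
- apply filter_imp with (2 := prod_pos); intros; tauto.
- apply filter_imp with (2 := prod_pos); intros ab Hab t Ht; apply H; lra.
Qed.

(** The integrand is below a multiple of [majorant], which is itself at most 1 / sqrt t. *)
Lemma filterlim_laplace_boundary (f : R -> R) (x : R) :
  tempered f -> 0 < x ->
  filterlim (fun t => exp (- (x * t)) * f t) (Rbar_locally p_infty) (locally 0).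
Proof.
intros Hf Hx; destruct (dominated_laplace f x Hf Hx) as [_ [K HK]].
apply filterlim_locally; intros eps; assert (He := cond_pos eps).
set (M := Rmax 1 ((Rabs K / eps) ^ 2)).
exists M; intros t Ht.
assert (M1 : 1 <= M) by apply Rmax_l.
assert (M2 : (Rabs K / eps) ^ 2 <= M) by apply Rmax_r.
assert (HKp := Rabs_pos K); assert (HKa := Rle_abs K).
assert (Hq : 0 <= Rabs K / eps) by (apply Rle_mult_inv_pos; assumption).
assert (Hs : Rabs K / eps < sqrt t).
{ rewrite <- (sqrt_pow2 (Rabs K / eps)) by exact Hq; apply sqrt_lt_1; nra. }
assert (Hs0 : 0 < sqrt t) by lra.
assert (Hd : majorant t <= / sqrt t).
{ unfold majorant; apply Rinv_le_contravar; [exact Hs0 |].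
  assert (1 <= (1 + sqrt t) ^ 2) by nra; nra. }
change (Rabs (exp (- (x * t)) * f t - 0) < eps).
rewrite Rminus_0_r; apply Rle_lt_trans with (K * majorant t); [apply HK; lra |].
assert (Hdp : 0 < majorant t) by (apply majorant_pos; lra).
apply Rle_lt_trans with (Rabs K * / sqrt t); [nra |].
apply Rmult_lt_reg_r with (sqrt t); [exact Hs0 |].
rewrite Rmult_assoc, Rinv_l, Rmult_1_r by lra.
apply (Rmult_lt_compat_l eps) in Hs; [| exact He].
replace (eps * (Rabs K / eps)) with (Rabs K) in Hs by (field; lra); exact Hs.
Qed.

(** Integration by parts. Only a one-sided limit of [P] at 0 is asked for, since the functions it is
    applied to may contain ln t or a complex power of t. *)
Lemma laplace_derivative (P p : R -> R) (p0 x : R) :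
  tempered P -> tempered p -> (forall t, 0 < t -> is_derive P t (p t)) ->
  filterlim P (at_right 0) (locally p0) -> 0 < x ->
  laplace p x = x * laplace P x - p0.
Proof.
intros HP Hp Hd H0 Hx.
assert (H : is_Iint (fun t => - x * (exp (- (x * t)) * P t) + exp (- (x * t)) * p t) (0 - p0)).
{ apply (is_RInt_gen_primitive (at_right 0) (Rbar_locally p_infty)
    (fun t => exp (- (x * t)) * P t)).
  - apply at_right_pos.
  - apply p_infty_gt.
  - intros t Ht.
    evar_last.
    + apply (is_derive_mult (K := R_AbsRing) (fun t => exp (- (x * t))) P t
        (- x * exp (- (x * t)))); [auto_derive; [trivial | ring] | apply Hd, Ht | apply Rmult_comm].
    + unfold plus, mult; simpl; ring.
  - intros t Ht; apply (continuous_plus (V := R_NormedModule));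
      [apply (continuous_scal_r (V := R_NormedModule) (- x)) |];
      apply (continuous_mult (K := R_AbsRing)); try apply continuous_exp_lin.
    + apply (proj1 HP), Ht.
    + apply (proj1 Hp), Ht.
  - replace p0 with (1 * p0) by ring.
    apply (filterlim_comp_2 (F := at_right 0) (G := locally 1) (H := locally p0)
      (fun t => exp (- (x * t))) P Rmult).
    + apply (filterlim_filter_le_1 (F := locally 0)); [apply filter_le_within |].
      assert (C := continuous_exp_lin x 0); unfold continuous in C.
      replace (- (x * 0)) with 0 in C by ring; rewrite exp_0 in C; exact C.
    + exact H0.
    + apply (filterlim_mult (K := R_AbsRing) 1 p0).
  - apply filterlim_laplace_boundary; assumption. }
assert (H' := is_Iint_plus _ _ _ _ (is_Iint_scal (- x) _ _ (is_Iint_laplace P x HP Hx))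
  (is_Iint_laplace p x Hp Hx)).
assert (E := is_Iint_unique _ _ _ H H'); lra.
Qed.

(* The exponent dominating both [|ln t|] and [ln ((1 + t) / t)];
   [exp (lam t / 2) = (1 + t) / sqrt t]. *)
Definition lam (t : R) : R := 2 * ln (1 + t) - ln t.

Lemma exp_half_lam (t : R) : 0 < t -> exp (lam t / 2) = (1 + t) / sqrt t.
Proof.
intros Ht; unfold lam.
replace ((2 * ln (1 + t) - ln t) / 2) with (ln (1 + t) + - ln (sqrt t)).
- rewrite exp_plus, exp_Ropp, !exp_ln; [reflexivity | apply sqrt_lt_R0, Ht | lra].
- assert (Hs : 0 < sqrt t) by (apply sqrt_lt_R0, Ht).
  assert (E := ln_mult _ _ Hs Hs); rewrite sqrt_sqrt in E by lra; rewrite E; field.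
Qed.

Lemma ln_1p_pos (t : R) : 0 < t -> 0 < ln (1 + t).
Proof. intros Ht; rewrite <- ln_1; apply ln_increasing; lra. Qed.

Lemma ln_1p_le (t : R) : 0 < t -> ln (1 + t) <= t.
Proof.
intros Ht; rewrite <- (ln_exp t) at 2; apply Rcomplements.ln_le; [lra | apply exp_ineq1_le].
Qed.

Lemma ln_le_ln_1p (t : R) : 0 < t -> ln t < ln (1 + t).
Proof. intros Ht; apply ln_increasing; lra. Qed.

Lemma lam_pos (t : R) : 0 < t -> 0 < lam t.
Proof. intros Ht; unfold lam; assert (H := ln_1p_pos t Ht); assert (H1 := ln_le_ln_1p t Ht); lra. Qed.

Lemma tempered_exp_lam (f : R -> R) (C : R) :
  (forall t, 0 < t -> continuous f t) -> 0 <= C ->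
  (forall t, 0 < t -> Rabs (f t) <= C * exp (lam t / 2)) -> tempered f.
Proof.
intros Cf HC HB; split; [exact Cf |]; exists C, 1%nat; split; [exact HC |].
intros t Ht; apply Rle_trans with (1 := HB t Ht); rewrite exp_half_lam by exact Ht.
unfold Rdiv; rewrite pow_1; lra.
Qed.

(** Square y / 16 <= exp (y / 16). This lets two logarithmic factors [lam t] be traded for exp (lam
    t / 8). *)
Lemma exp_square_bound (y : R) : 0 <= y -> y ^ 2 <= 256 * exp (y / 8).
Proof.
intros Hy; assert (H := exp_ineq1_le (y / 16)).
replace (y / 8) with (y / 16 + y / 16) by field; rewrite exp_plus; nra.
Qed.

Lemma Rabs_sin_le (v : R) : Rabs (sin v) <= Rabs v.
Proof.
destruct (MVT_gen sin 0 v cos) as [c [_ Hc]].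
- intros; apply is_derive_sin.
- intros; apply derivable_continuous_pt, derivable_pt_sin.
- rewrite sin_0, !Rminus_0_r in Hc; rewrite Hc, Rabs_mult.
  assert (H : Rabs (cos c) <= 1) by (apply Rabs_le, COS_bound).
  assert (H1 := Rabs_pos v); nra.
Qed.

Lemma one_minus_cos (v : R) : 1 - cos v = 2 * (sin (v / 2)) ^ 2.
Proof. replace v with (2 * (v / 2)) at 1 by field; rewrite cos_2a_sin; ring. Qed.

Lemma Rabs_1_cos_le_sq (v : R) : Rabs (cos v - 1) <= v ^ 2.
Proof.
rewrite Rabs_minus_sym, one_minus_cos, Rabs_pos_eq by (assert (H0 := pow2_ge_0 (sin (v / 2))); lra).
assert (H := Rabs_sin_le (v / 2)).
assert (H1 : sin (v / 2) ^ 2 <= (v / 2) ^ 2).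
{ rewrite <- (pow2_abs (sin _)), <- (pow2_abs (v / 2)).
  apply pow_incr; split; [apply Rabs_pos | exact H]. }
nra.
Qed.

Lemma Rabs_1_cos_le (v : R) : Rabs (cos v - 1) <= Rabs v.
Proof.
rewrite Rabs_minus_sym, one_minus_cos, Rabs_pos_eq by (assert (H0 := pow2_ge_0 (sin (v / 2))); lra).
assert (H := Rabs_sin_le (v / 2)).
assert (H1 : Rabs (sin (v / 2)) <= 1) by apply Rabs_le, SIN_bound.
replace (Rabs (v / 2)) with (Rabs v / 2) in H
  by (unfold Rdiv; rewrite Rabs_mult, (Rabs_pos_eq (/ 2)) by lra; reflexivity).
rewrite <- pow2_abs; assert (H2 := Rabs_pos (sin (v / 2))); nra.
Qed.

Lemma Rabs_sin_minus_le (v : R) : Rabs (sin v - v) <= v ^ 2.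
Proof.
destruct (MVT_gen (fun v => sin v - v) 0 v (fun v => cos v - 1)) as [c [Hc1 Hc]].
- intros; auto_derive; [trivial | ring].
- intros; apply derivable_continuous_pt, derivable_pt_minus;
    [apply derivable_pt_sin | apply derivable_pt_id].
- rewrite sin_0, !Rminus_0_r in Hc; rewrite Hc, Rabs_mult.
  assert (H := Rabs_1_cos_le c).
  assert (H1 : Rabs c <= Rabs v).
  { unfold Rmin, Rmax in Hc1; destruct (Rle_dec 0 v);
      [rewrite !Rabs_pos_eq by lra | rewrite !Rabs_left1 by lra]; lra. }
  rewrite <- pow2_abs; assert (H2 := Rabs_pos v); nra.
Qed.

Lemma exp_minus_1_le (u : R) : Rabs (exp u - 1) <= Rabs u * exp (Rabs u).
Proof.
assert (H1 := exp_ineq1_le u); assert (H2 := exp_ineq1_le (- u)).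
assert (E : exp u * exp (- u) = 1) by (rewrite <- exp_plus, Rplus_opp_r; apply exp_0).
assert (H3 := exp_pos u).
destruct (Rle_dec 0 u) as [Hu | Hu].
- rewrite !(Rabs_pos_eq u) by lra; rewrite Rabs_pos_eq by lra; nra.
- rewrite !(Rabs_left1 u) by lra.
  assert (exp u <= 1) by (rewrite <- exp_0; apply exp_le; lra).
  rewrite Rabs_left1 by lra; nra.
Qed.

(** Real part of exp z - 1 - z for z = u + i v; the imaginary part is [exp_sin_taylor2]. They are
    estimated separately so that only real integrals occur. *)
Lemma exp_cos_taylor2 (u v M : R) : Rabs u <= M -> Rabs v <= M ->
  Rabs (exp u * cos v - 1 - u) <= 2 * (M ^ 2 * exp M).
Proof.
intros Hu Hv.
replace (exp u * cos v - 1 - u) with ((exp u - 1 - u) + exp u * (cos v - 1)) by ring.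
apply Rle_trans with (1 := Rabs_triang _ _).
rewrite Rabs_mult, (Rabs_pos_eq (exp u)) by apply Rlt_le, exp_pos.
assert (H1 := exp_taylor2 u); assert (H2 := Rabs_1_cos_le_sq v).
assert (E1 : exp u <= exp M) by (apply exp_le; apply Rle_trans with (2 := Hu), Rle_abs).
assert (E2 : exp (Rabs u) <= exp M) by (apply exp_le; exact Hu).
rewrite <- pow2_abs in H1; rewrite <- pow2_abs in H2.
assert (P1 : Rabs u ^ 2 <= M ^ 2) by (apply pow_incr; split; [apply Rabs_pos | exact Hu]).
assert (P2 : Rabs v ^ 2 <= M ^ 2) by (apply pow_incr; split; [apply Rabs_pos | exact Hv]).
assert (Q1 := pow2_ge_0 (Rabs u)); assert (Q2 := pow2_ge_0 (Rabs v)).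
assert (X1 := exp_pos u); assert (X2 := exp_pos (Rabs u)).
assert (T1 : Rabs u ^ 2 * exp (Rabs u) <= M ^ 2 * exp M) by (apply Rmult_le_compat; lra).
assert (T2 : exp u * Rabs (cos v - 1) <= exp M * M ^ 2).
{ apply Rmult_le_compat; try lra; apply Rabs_pos. }
lra.
Qed.

Lemma exp_sin_taylor2 (u v M : R) : Rabs u <= M -> Rabs v <= M ->
  Rabs (exp u * sin v - v) <= 2 * (M ^ 2 * exp M).
Proof.
intros Hu Hv.
replace (exp u * sin v - v) with ((exp u - 1) * sin v + (sin v - v)) by ring.
apply Rle_trans with (1 := Rabs_triang _ _); rewrite Rabs_mult.
assert (H1 := exp_minus_1_le u); assert (H2 := Rabs_sin_minus_le v).
assert (H3 := Rabs_sin_le v).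
assert (E2 : exp (Rabs u) <= exp M) by (apply exp_le; exact Hu).
rewrite <- pow2_abs in H2.
assert (P2 : Rabs v ^ 2 <= M ^ 2) by (apply pow_incr; split; [apply Rabs_pos | exact Hv]).
assert (X2 := exp_pos (Rabs u)).
assert (A1 := Rabs_pos u); assert (A2 := Rabs_pos v).
assert (E1 : 1 <= exp M) by (rewrite <- exp_0; apply exp_le; lra).
assert (T1 : Rabs (exp u - 1) * Rabs (sin v) <= (M * exp M) * M).
{ apply Rmult_le_compat; try apply Rabs_pos; [| lra].
  apply Rle_trans with (1 := H1), Rmult_le_compat; lra. }
nra.
Qed.

(** * Expansion of Laplace transforms in a complex exponent *)

Definition poly_growth (w : R -> R) : Prop :=
  (forall t, 0 < t -> continuous w t) /\
  exists C m, 0 <= C /\ forall t, 0 < t -> Rabs (w t) <= C * (1 + t) ^ m.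

Definition subln (th : R -> R) : Prop :=
  (forall t, 0 < t -> continuous th t) /\ forall t, 0 < t -> Rabs (th t) <= lam t.

(** Real and imaginary parts of exp ((p + i q) th t). *)
Definition expcos (th : R -> R) (p q t : R) : R := exp (p * th t) * cos (q * th t).
Definition expsin (th : R -> R) (p q t : R) : R := exp (p * th t) * sin (q * th t).

Lemma lam_exp_bound (t : R) : 0 < t -> lam t <= 16 * exp (lam t / 2).
Proof.
intros Ht; assert (Hl := lam_pos t Ht); assert (H := exp_ineq1_le (lam t / 2)); lra.
Qed.

Lemma tempered_subln (th : R -> R) : subln th -> tempered th.
Proof.
intros [C B]; apply (tempered_exp_lam th 16); [exact C | lra |].
intros t Ht; apply Rle_trans with (1 := B t Ht), lam_exp_bound, Ht.
Qed.

Lemma tempered_1 : tempered (fun _ => 1).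
Proof.
apply (tempered_exp_lam _ 1); [intros; apply continuous_const | lra |].
intros t Ht; rewrite Rabs_R1, Rmult_1_l, <- exp_0; apply exp_le.
assert (H := lam_pos t Ht); lra.
Qed.

Lemma tempered_weight (w f : R -> R) :
  poly_growth w -> tempered f -> tempered (fun t => w t * f t).
Proof. intros [C B]; apply tempered_mult; assumption. Qed.

Lemma tempered_poly_growth (w : R -> R) : poly_growth w -> tempered w.
Proof.
intros Hw; assert (H := tempered_weight w _ Hw tempered_1).
destruct H as [C B]; split; [apply Hw |].
destruct B as [D [m [HD B]]]; exists D, m; split; [exact HD |].
intros t Ht; specialize (B t Ht); rewrite Rmult_1_r in B; exact B.
Qed.

Lemma continuous_scaled (th : R -> R) (p t : R) :
  continuous th t -> continuous (fun t => p * th t) t.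
Proof. apply (continuous_scal_r (V := R_NormedModule) p th). Qed.

Lemma tempered_expcs (th : R -> R) (p q : R) :
  subln th -> Rabs p <= / 8 -> tempered (expcos th p q) /\ tempered (expsin th p q).
Proof.
intros [C B] Hp.
assert (H : forall g : R -> R, (forall v, continuous g v) -> (forall v, Rabs (g v) <= 1) ->
  tempered (fun t => exp (p * th t) * g (q * th t))).
{ intros g Cg Bg; apply (tempered_exp_lam _ 1); [| lra |].
  - intros t Ht; apply (continuous_mult (K := R_AbsRing)).
    + apply (continuous_comp (fun t => p * th t) exp); [apply continuous_scaled, C, Ht |].
      apply (ex_derive_continuous (V := R_NormedModule)); auto_derive; trivial.
    + apply (continuous_comp (fun t => q * th t) g); [apply continuous_scaled, C, Ht | apply Cg].
  - intros t Ht; rewrite Rabs_mult, (Rabs_pos_eq (exp _)) by apply Rlt_le, exp_pos.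
    assert (Hl := lam_pos t Ht).
    assert (E : exp (p * th t) <= exp (lam t / 2)).
    { apply exp_le; apply Rle_trans with (1 := Rle_abs _); rewrite Rabs_mult.
      specialize (B t Ht); assert (H1 := Rabs_pos p); assert (H2 := Rabs_pos (th t)); nra. }
    assert (H1 := exp_pos (p * th t)); specialize (Bg (q * th t)).
    assert (H2 := Rabs_pos (g (q * th t))); nra. }
split; apply H.
- intros v; apply continuous_cos.
- intros; apply Rabs_le, COS_bound.
- intros v; apply continuous_sin.
- intros; apply Rabs_le, SIN_bound.
Qed.

(* Second-order expansion at [0] of the Laplace transform of [w exp (e th)],
   for the complex exponent [e = p + i q]. *)
Lemma laplace_expansion (w th : R -> R) (x : R) :
  poly_growth w -> subln th -> 0 < x ->
  exists C, 0 <= C /\ forall p q r, Rabs p <= r -> Rabs q <= r -> r <= / 8 ->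
    Rabs (laplace (fun t => w t * expcos th p q t) x - laplace w x
          - p * laplace (fun t => w t * th t) x) <= C * r ^ 2 /\
    Rabs (laplace (fun t => w t * expsin th p q t) x
          - q * laplace (fun t => w t * th t) x) <= C * r ^ 2.
Proof.
intros Hw Hth Hx.
destruct Hw as [Cw [D [m [HD HB]]]].
assert (Hw : poly_growth w) by (split; [exact Cw | exists D, m; split; assumption]).
(* 512 is the 2 of [exp_cos_taylor2] times the 256 of [exp_square_bound]; the exponent m + 1 makes
   room for the numerator of (1 + t) / sqrt t. *)
destruct (tempered_bound (512 * D) (m + 1) x) as [K [HK Kd]]; [lra | exact Hx |].
exists K; split; [exact HK |]; intros p q r Hp Hq Hr.
assert (Hr0 : 0 <= r) by (apply Rle_trans with (2 := Hp), Rabs_pos).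
destruct (tempered_expcs th p q Hth) as [Tc Ts]; [lra |].
assert (Twc := tempered_weight w _ Hw Tc).
assert (Tws := tempered_weight w _ Hw Ts).
assert (Twth := tempered_weight w _ Hw (tempered_subln th Hth)).
assert (Tw := tempered_poly_growth w Hw).
destruct Hth as [Cth Bth].
assert (Hmain : forall t y, 0 < t ->
  Rabs y <= 2 * ((r * lam t) ^ 2 * exp (r * lam t)) ->
  Rabs (exp (- (x * t)) * (w t * y)) <= K * r ^ 2 * majorant t).
{ intros t y Ht Hy; assert (Hl := lam_pos t Ht).
  rewrite !Rabs_mult, (Rabs_pos_eq (exp _)) by apply Rlt_le, exp_pos.
  (* Since r <= 1/8, the square of [lam t] and the exponential each cost exp (lam t / 8); together
     they stay below exp (lam t / 2), which is (1 + t) / sqrt t. *)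
  assert (E1 : (r * lam t) ^ 2 * exp (r * lam t) <= r ^ 2 * (256 * exp (lam t / 2))).
  { rewrite Rpow_mult_distr, Rmult_assoc.
    apply Rmult_le_compat_l; [apply pow2_ge_0 |].
    apply Rle_trans with ((256 * exp (lam t / 8)) * exp (lam t / 8)).
    - apply Rmult_le_compat; [apply pow2_ge_0 | apply Rlt_le, exp_pos | |].
      + apply exp_square_bound; lra.
      + apply exp_le; nra.
    - rewrite Rmult_assoc, <- exp_plus; apply Rmult_le_compat_l; [lra | apply exp_le; lra]. }
  rewrite exp_half_lam in E1 by exact Ht.
  specialize (HB t Ht); specialize (Kd t Ht).
  assert (Hs : 0 < sqrt t) by (apply sqrt_lt_R0; assumption).
  assert (Hpm : 0 < (1 + t) ^ m) by (apply pow_lt; lra).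
  apply Rle_trans with (exp (- (x * t)) *
    ((D * (1 + t) ^ m) * (2 * (r ^ 2 * (256 * ((1 + t) / sqrt t)))))).
  - apply Rmult_le_compat_l; [apply Rlt_le, exp_pos |].
    apply Rmult_le_compat; try apply Rabs_pos; lra.
  - replace (K * r ^ 2 * majorant t) with (r ^ 2 * (K * majorant t)) by ring.
    replace (exp (- (x * t)) * ((D * (1 + t) ^ m) * (2 * (r ^ 2 * (256 * ((1 + t) / sqrt t))))))
      with (r ^ 2 * (exp (- (x * t)) * (512 * D * (1 + t) ^ (m + 1) / sqrt t))).
    + apply Rmult_le_compat_l; [apply pow2_ge_0 | exact Kd].
    + rewrite pow_add, pow_1; field; lra. }
assert (Hu : forall t, 0 < t -> Rabs (p * th t) <= r * lam t /\ Rabs (q * th t) <= r * lam t).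
{ intros t Ht; rewrite !Rabs_mult; specialize (Bth t Ht).
  split; apply Rmult_le_compat; try apply Rabs_pos; assumption. }
split.
- apply is_Iint_bound with
    (fun t => exp (- (x * t)) * (w t * (expcos th p q t - 1 - p * th t))).
  + intros t Ht; apply Hmain; [exact Ht |]; apply exp_cos_taylor2; apply Hu, Ht.
  + apply is_Iint_ext with (fun t => exp (- (x * t)) * (w t * expcos th p q t)
      + (-1 * (exp (- (x * t)) * w t) + - p * (exp (- (x * t)) * (w t * th t)))).
    { intros; ring. }
    match goal with |- is_RInt_gen _ _ _ (?a - ?b - ?c * ?d) =>
      replace (a - b - c * d) with (a + (-1 * b + - c * d)) by ring end.
    apply is_Iint_plus; [| apply is_Iint_plus; apply is_Iint_scal];
      apply is_Iint_laplace; assumption.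
- apply is_Iint_bound with (fun t => exp (- (x * t)) * (w t * (expsin th p q t - q * th t))).
  + intros t Ht; apply Hmain; [exact Ht |]; apply exp_sin_taylor2; apply Hu, Ht.
  + apply is_Iint_ext with (fun t => exp (- (x * t)) * (w t * expsin th p q t)
      + - q * (exp (- (x * t)) * (w t * th t))).
    { intros; ring. }
    match goal with |- is_RInt_gen _ _ _ (?a - ?c * ?d) =>
      replace (a - c * d) with (a + - c * d) by ring end.
    apply is_Iint_plus; [| apply is_Iint_scal]; apply is_Iint_laplace; assumption.
Qed.

(** * Uniqueness of Tricomi's function *)

Notation is_Cderive f x l := (is_derive (V := C_R_NormedModule) f x l).

Lemma is_Cderive_pair (f g : R -> R) (x l m : R) :
  is_derive f x l -> is_derive g x m ->
  is_Cderive (fun t => (f t, g t)) x (l, m).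
Proof.
intros Hf Hg.
apply (filterdiff_comp'_2 (K := R_AbsRing) (T := R_NormedModule) (U := R_NormedModule)
  (V := R_NormedModule) (W := C_R_NormedModule) f g (fun u v => (u, v)) x
  (fun y => scal y l) (fun y => scal y m) (fun u v => (u, v)) Hf Hg).
apply (filterdiff_linear (K := R_AbsRing) (V := C_R_NormedModule)).
apply (is_linear_prod (K := R_AbsRing)).
- apply is_linear_fst.
- apply is_linear_snd.
Qed.

Lemma is_derive_Re (f : R -> C) (x : R) (l : C) :
  is_Cderive f x l -> is_derive (fun t => Re (f t)) x (Re l).
Proof.
intros Hf.
apply (filterdiff_comp' (K := R_AbsRing) (U := R_NormedModule) (V := C_R_NormedModule)
  (W := R_NormedModule) f Re x (fun y => scal y l) Re Hf).
apply (filterdiff_linear (K := R_AbsRing) (U := C_R_NormedModule) (V := R_NormedModule)).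
apply (is_linear_fst (K := R_AbsRing) (U := R_NormedModule) (V := R_NormedModule)).
Qed.

Lemma is_derive_Im (f : R -> C) (x : R) (l : C) :
  is_Cderive f x l -> is_derive (fun t => Im (f t)) x (Im l).
Proof.
intros Hf.
apply (filterdiff_comp' (K := R_AbsRing) (U := R_NormedModule) (V := C_R_NormedModule)
  (W := R_NormedModule) f Im x (fun y => scal y l) Im Hf).
apply (filterdiff_linear (K := R_AbsRing) (U := C_R_NormedModule) (V := R_NormedModule)).
apply (is_linear_snd (K := R_AbsRing) (U := R_NormedModule) (V := R_NormedModule)).
Qed.

Lemma is_Cderive_ext (f g : R -> C) (x : R) (l m : C) :
  (forall t, f t = g t) -> l = m -> is_Cderive f x l -> is_Cderive g x m.
Proof. intros E <-; apply is_derive_ext, E. Qed.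

Lemma is_Cderive_mult (f g : R -> C) (x : R) (l m : C) :
  is_Cderive f x l -> is_Cderive g x m ->
  is_Cderive (fun t => f t * g t)%C x (l * g x + f x * m)%C.
Proof.
intros Hf Hg.
assert (F1 := is_derive_Re _ _ _ Hf); assert (F2 := is_derive_Im _ _ _ Hf).
assert (G1 := is_derive_Re _ _ _ Hg); assert (G2 := is_derive_Im _ _ _ Hg).
apply (is_Cderive_ext (fun t => (Re (f t) * Re (g t) - Im (f t) * Im (g t),
    Re (f t) * Im (g t) + Im (f t) * Re (g t)))
  _ x (Re l * Re (g x) + Re (f x) * Re m - (Im l * Im (g x) + Im (f x) * Im m),
    Re l * Im (g x) + Re (f x) * Im m + (Im l * Re (g x) + Im (f x) * Re m))).
- reflexivity.
- unfold Cplus, Cmult, Re, Im; simpl; f_equal; ring.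
- apply is_Cderive_pair.
  + apply (is_derive_minus (V := R_NormedModule));
      apply (is_derive_mult (K := R_AbsRing)); try assumption; apply Rmult_comm.
  + apply (is_derive_plus (V := R_NormedModule));
      apply (is_derive_mult (K := R_AbsRing)); try assumption; apply Rmult_comm.
Qed.

Lemma is_Cderive_plus (f g : R -> C) (x : R) (l m : C) :
  is_Cderive f x l -> is_Cderive g x m -> is_Cderive (fun t => f t + g t)%C x (l + m)%C.
Proof. apply (is_derive_plus (V := C_R_NormedModule)). Qed.

Lemma is_Cderive_minus (f g : R -> C) (x : R) (l m : C) :
  is_Cderive f x l -> is_Cderive g x m -> is_Cderive (fun t => f t - g t)%C x (l - m)%C.
Proof. apply (is_derive_minus (V := C_R_NormedModule)). Qed.

Lemma is_Cderive_RtoC (f : R -> R) (x l : R) :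
  is_derive f x l -> is_Cderive (fun t => RtoC (f t)) x (RtoC l).
Proof.
intros Hf; apply (is_Cderive_pair f (fun _ => 0)); [exact Hf |].
apply (is_derive_const (V := R_NormedModule)).
Qed.

Lemma is_Cderive_const_mult (c : C) (f : R -> C) (x : R) (l : C) :
  is_Cderive f x l -> is_Cderive (fun t => c * f t)%C x (c * l)%C.
Proof.
intros Hf.
assert (Hc : is_Cderive (fun _ => c) x (RtoC 0)) by apply (is_derive_const (V := C_R_NormedModule)).
apply (is_Cderive_ext _ _ _ _ _ (fun t => eq_refl)) with (2 := is_Cderive_mult _ _ _ _ _ Hc Hf).
ring.
Qed.

(** * Modulus and polynomial growth of complex-valued functions *)

Lemma Cmod_le_sum (z : C) : Cmod z <= Rabs (Re z) + Rabs (Im z).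
Proof.
replace z with (RtoC (Re z) + Ci * RtoC (Im z))%C at 1.
- apply Rle_trans with (1 := Cmod_triangle _ _).
  rewrite Cmod_mult, Cmod_Ci, !Cmod_R; lra.
- destruct z as [p q]; unfold RtoC, Ci, Cplus, Cmult; simpl; f_equal; ring.
Qed.

Lemma im_le_Cmod (z : C) : Rabs (Im z) <= Cmod z.
Proof. apply Rle_trans with (2 := Rmax_Cmod z), Rmax_r. Qed.

Lemma filterlim_C_p_infty (f : R -> C) (l : C) :
  filterlim f (Rbar_locally p_infty) (locally l) <->
  forall eps, 0 < eps -> exists M, forall x, M < x -> Cmod (f x - l) < eps.
Proof.
split.
- intros H eps He.
  assert (He2 : 0 < eps / 2) by lra.
  destruct (proj1 (filterlim_locally f l) H (mkposreal _ He2)) as [M HM].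
  exists M; intros x Hx; destruct (HM x Hx) as [H1 H2].
  change (Rabs (fst (f x) - fst l) < eps / 2) in H1.
  change (Rabs (snd (f x) - snd l) < eps / 2) in H2.
  apply Rle_lt_trans with (1 := Cmod_le_sum _).
  change (Re (f x - l)) with (fst (f x) - fst l).
  change (Im (f x - l)) with (snd (f x) - snd l); lra.
- intros H; apply filterlim_locally; intros eps.
  destruct (H eps (cond_pos eps)) as [M HM]; exists M; intros x Hx.
  specialize (HM x Hx); split.
  + change (Rabs (Re (f x - l)) < eps).
    apply Rle_lt_trans with (2 := HM), re_le_Cmod.
  + change (Rabs (Im (f x - l)) < eps).
    apply Rle_lt_trans with (2 := HM), im_le_Cmod.
Qed.

Lemma Cmod_Rcpow (x : R) (a : C) : Cmod (Rcpow x a) = exp (Re a * ln x).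
Proof.
unfold Rcpow; rewrite Cmod_mult, Cmod_R, Rabs_pos_eq by apply Rlt_le, exp_pos.
replace (Cmod (_, _)) with 1; [ring |].
unfold Cmod; simpl.
set (t := Im a * ln x); assert (H := sin2_cos2 t); unfold Rsqr in H.
replace (_ + _) with 1 by lra; symmetry; apply sqrt_1.
Qed.

(** The bound is asked only from some [X] on, because solutions of Kummer's equation may be singular
    at 0; [1 <= X] makes x^N increase with N. *)
Definition poly_bounded (f : R -> C) : Prop :=
  exists C N X, 1 <= X /\ 0 <= C /\ forall x, X <= x -> Cmod (f x) <= C * x ^ N.

Lemma poly_bounded_mult (f g : R -> C) :
  poly_bounded f -> poly_bounded g -> poly_bounded (fun x => f x * g x)%C.
Proof.
intros [C [N [X [HX [HC Hf]]]]] [D [M [Y [HY [HD Hg]]]]].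
exists (C * D), (N + M)%nat, (Rmax X Y); split; [apply Rle_trans with (2 := Rmax_l X Y), HX |].
split; [nra |]; intros x Hx.
rewrite Cmod_mult, pow_add; replace (C * D * (x ^ N * x ^ M)) with ((C * x ^ N) * (D * x ^ M)) by ring.
apply Rmult_le_compat; try apply Cmod_ge_0; [apply Hf | apply Hg].
- apply Rle_trans with (2 := Hx), Rmax_l.
- apply Rle_trans with (2 := Hx), Rmax_r.
Qed.

Lemma poly_bounded_plus (f g : R -> C) :
  poly_bounded f -> poly_bounded g -> poly_bounded (fun x => f x + g x)%C.
Proof.
intros [C [N [X [HX [HC Hf]]]]] [D [M [Y [HY [HD Hg]]]]].
exists (C + D), (N + M)%nat, (Rmax X Y); split; [apply Rle_trans with (2 := Rmax_l X Y), HX |].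
split; [lra |]; intros x Hx.
assert (Hx1 : X <= x) by (apply Rle_trans with (2 := Hx), Rmax_l).
assert (Hx2 : Y <= x) by (apply Rle_trans with (2 := Hx), Rmax_r).
apply Rle_trans with (1 := Cmod_triangle _ _).
specialize (Hf x Hx1); specialize (Hg x Hx2).
assert (P1 : x ^ N <= x ^ (N + M)) by (apply Rle_pow; [lra | lia]).
assert (P2 : x ^ M <= x ^ (N + M)) by (apply Rle_pow; [lra | lia]).
nra.
Qed.

Lemma poly_bounded_opp (f : R -> C) : poly_bounded f -> poly_bounded (fun x => - f x)%C.
Proof.
intros [C [N [X [HX [HC Hf]]]]]; exists C, N, X; repeat split; try assumption.
intros x Hx; rewrite Cmod_opp; apply Hf, Hx.
Qed.

Lemma poly_bounded_const (c : C) : poly_bounded (fun _ => c).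
Proof.
exists (Cmod c), 0%nat, 1; split; [lra |]; split; [apply Cmod_ge_0 |].
intros; simpl; lra.
Qed.

Lemma poly_bounded_power (p : R) : poly_bounded (fun x => RtoC (exp (p * ln x))).
Proof.
destruct (INR_unbounded p) as [N HN]; exists 1, N, 1; split; [lra |]; split; [lra |].
intros x Hx; rewrite Cmod_R, Rabs_pos_eq, Rmult_1_l by apply Rlt_le, exp_pos.
rewrite <- (exp_ln (x ^ N)) by (apply pow_lt; lra).
rewrite ln_pow by lra; apply exp_le.
assert (0 <= ln x) by (rewrite <- ln_1; apply Rcomplements.ln_le; lra); nra.
Qed.

(** The mean value theorem is applied to the real and the imaginary part separately, hence the
    factor 2. *)
Lemma Cderive_bound (h h' : R -> C) (a b D : R) :
  a <= b -> (forall t, a <= t <= b -> is_Cderive h t (h' t)) ->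
  (forall t, a <= t <= b -> Cmod (h' t) <= D) ->
  Cmod (h b - h a) <= 2 * (D * (b - a)).
Proof.
intros Hab Hd HD.
assert (H : forall g g' : R -> R, (forall t, a <= t <= b -> is_derive g t (g' t)) ->
  (forall t, a <= t <= b -> Rabs (g' t) <= D) -> Rabs (g b - g a) <= D * (b - a)).
{ intros g g' Hg HgD.
  destruct (MVT_gen g a b g') as [c [Hc E]];
    [rewrite Rmin_left, Rmax_right by exact Hab .. |].
  - intros t Ht; apply Hg; lra.
  - intros t Ht; apply continuity_pt_filterlim, (ex_derive_continuous (V := R_NormedModule)).
    exists (g' t); apply Hg; lra.
  - rewrite Rmin_left, Rmax_right in Hc by exact Hab.
    rewrite E, Rabs_mult, (Rabs_pos_eq (b - a)) by lra.
    apply Rmult_le_compat_r; [lra | apply HgD, Hc]. }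
apply Rle_trans with (1 := Cmod_le_sum _).
change (Re (h b - h a)) with (Re (h b) - Re (h a)).
change (Im (h b - h a)) with (Im (h b) - Im (h a)).
assert (H1 : Rabs (Re (h b) - Re (h a)) <= D * (b - a)).
{ apply (H (fun t => Re (h t)) (fun t => Re (h' t))); intros t Ht.
  - apply is_derive_Re, Hd, Ht.
  - apply Rle_trans with (2 := HD t Ht), re_le_Cmod. }
assert (H2 : Rabs (Im (h b) - Im (h a)) <= D * (b - a)).
{ apply (H (fun t => Im (h t)) (fun t => Im (h' t))); intros t Ht.
  - apply is_derive_Im, Hd, Ht.
  - apply Rle_trans with (2 := HD t Ht), im_le_Cmod. }
lra.
Qed.

Lemma poly_bounded_primitive (h h' : R -> C) :
  (forall x, 0 < x -> is_Cderive h x (h' x)) -> poly_bounded h' -> poly_bounded h.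
Proof.
intros Hd [C [N [X [HX [HC HB]]]]].
exists (Cmod (h X) + 2 * C), (S N), X; split; [exact HX |].
split; [assert (H := Cmod_ge_0 (h X)); lra |]; intros x Hx.
replace (h x) with (h X + (h x - h X))%C by ring.
apply Rle_trans with (1 := Cmod_triangle _ _).
assert (Hb : Cmod (h x - h X) <= 2 * (C * x ^ N * (x - X))).
{ apply (Cderive_bound h h'); [exact Hx | intros; apply Hd; lra |].
  intros t Ht; apply Rle_trans with (1 := HB t (proj1 Ht)).
  apply Rmult_le_compat_l; [exact HC | apply pow_incr; lra]. }
assert (P1 : 1 <= x ^ S N) by (apply pow_R1_Rle; lra).
assert (P0 : 0 < x ^ N) by (apply pow_lt; lra).
assert (P2 : C * x ^ N * (x - X) <= C * x ^ S N).
{ simpl; replace (C * (x * x ^ N)) with (C * x ^ N * x) by ring.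
  apply Rmult_le_compat_l; nra. }
assert (H := Cmod_ge_0 (h X)); nra.
Qed.

(** * Solutions of Kummer's equation with polynomial growth *)

Definition kummer (a : C) (b : R) (f f1 f2 : R -> C) : Prop :=
  forall x, 0 < x -> is_Cderive f x (f1 x) /\ is_Cderive f1 x (f2 x) /\
    (RtoC x * f2 x + (RtoC b - RtoC x) * f1 x - a * f x = 0)%C.

Lemma RtoC_neq_0 (x : R) : 0 < x -> RtoC x <> 0%C.
Proof. intros Hx E; apply RtoC_inj in E; lra. Qed.

Lemma kummer_second (a : C) (b : R) (f f1 f2 : R -> C) (x : R) :
  kummer a b f f1 f2 -> 0 < x ->
  f2 x = (((RtoC x - RtoC b) * f1 x + a * f x) / RtoC x)%C.
Proof.
intros H Hx; destruct (H x Hx) as [_ [_ E]].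
assert (Hn := RtoC_neq_0 x Hx).
replace ((RtoC x - RtoC b) * f1 x + a * f x)%C with (RtoC x * f2 x)%C.
- field; exact Hn.
- apply Ceq_minus; rewrite <- E; ring.
Qed.

Lemma is_derive_power (p x : R) : 0 < x ->
  is_derive (fun t => exp (p * ln t)) x (p / x * exp (p * ln x)).
Proof. intros Hx; auto_derive; [exact Hx | field; lra]. Qed.

(* The difference [f' - f] satisfies a first-order equation without exponential
   growth, driven by [f]. *)
Lemma kummer_poly_bounded_derive (a : C) (b : R) (f f1 f2 : R -> C) :
  kummer a b f f1 f2 -> poly_bounded f -> poly_bounded f1.
Proof.
intros Hk Hf.
(* x^b is the integrating factor: d = f' - f satisfies x d' + b d = (a - b) f, so (x^b d)' = (a - b)
   x^(b-1) f has polynomial growth. *)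
set (h := fun x => (RtoC (exp (b * ln x)) * (f1 x - f x))%C).
set (h' := fun x => (RtoC (exp (b * ln x)) * (RtoC (exp (-1 * ln x)) * ((a - RtoC b) * f x)))%C).
assert (Hh : poly_bounded h).
{ apply (poly_bounded_primitive h h').
  - intros x Hx; destruct (Hk x Hx) as [D1 [D2 _]].
    assert (E := kummer_second _ _ _ _ _ x Hk Hx).
    assert (Dp := is_Cderive_RtoC _ _ _ (is_derive_power b x Hx)).
    apply (is_Cderive_ext _ _ _ _ _ (fun t => eq_refl))
      with (2 := is_Cderive_mult _ _ _ _ _ Dp (is_Cderive_minus _ _ _ _ _ D2 D1)).
    unfold h'; rewrite E.
    replace (exp (-1 * ln x)) with (/ x)
      by (replace (-1 * ln x) with (- ln x) by ring; rewrite exp_Ropp, exp_ln by exact Hx; reflexivity).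
    rewrite RtoC_mult, RtoC_div, RtoC_inv by lra.
    field; apply RtoC_neq_0, Hx.
  - apply poly_bounded_mult; [apply poly_bounded_power |].
    apply poly_bounded_mult; [apply poly_bounded_power |].
    apply poly_bounded_mult; [apply poly_bounded_const | exact Hf]. }
assert (H := poly_bounded_plus _ _ (poly_bounded_mult _ _ (poly_bounded_power (- b)) Hh) Hf).
destruct H as [C [N [X [HX [HC HB]]]]]; exists C, N, X; repeat split; try assumption.
intros x Hx; specialize (HB x Hx).
replace (f1 x) with (RtoC (exp (- b * ln x)) * h x + f x)%C; [exact HB |].
unfold h; rewrite Cmult_assoc, <- RtoC_mult, <- exp_plus.
replace (- b * ln x + b * ln x) with 0 by ring; rewrite exp_0; ring.
Qed.

Lemma small_exp_poly (y C : R) (N : nat) (X : R) :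
  0 <= C -> 1 <= X -> (forall x, X <= x -> y <= exp (- x) * (C * x ^ N)) -> y <= 0.
Proof.
intros HC HX H.
destruct (exp_poly_bound (S N) 1 Rlt_0_1) as [K [HK HB]].
apply Rnot_lt_le; intros Hy.
set (x := Rmax X (C * K / y + 1)).
assert (H1 : X <= x) by apply Rmax_l.
assert (H2 : C * K / y + 1 <= x) by apply Rmax_r.
specialize (H x H1); assert (Hx : 0 <= x) by lra; specialize (HB x Hx).
rewrite Rmult_1_l in HB.
assert (E : exp (- x) * x ^ S N <= K).
{ apply Rle_trans with (2 := HB), Rmult_le_compat_l; [apply Rlt_le, exp_pos |].
  apply pow_incr; lra. }
assert (H3 : y * x <= C * K).
{ apply Rle_trans with (exp (- x) * (C * x ^ N) * x); [apply Rmult_le_compat_r; lra |].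
  replace (exp (- x) * (C * x ^ N) * x) with (C * (exp (- x) * x ^ S N)) by (simpl; ring).
  apply Rmult_le_compat_l; assumption. }
apply (Rmult_le_compat_l y) in H2; [| lra].
replace (y * (C * K / y + 1)) with (C * K + y) in H2 by (field; lra); lra.
Qed.

Lemma is_Cderive_0_const (f : R -> C) (x y : R) :
  0 < x -> 0 < y -> (forall t, 0 < t -> is_Cderive f t (RtoC 0)) -> f x = f y.
Proof.
intros Hx Hy Hd.
destruct (Rtotal_order x y) as [H | [-> | H]]; [| reflexivity | symmetry];
  apply (eq_is_derive (V := C_R_NormedModule)); try assumption; intros t Ht; apply Hd; lra.
Qed.

Lemma kummer_wronskian (a : C) (b : R) (u u1 u2 d d1 d2 : R -> C) (x : R) :
  kummer a b u u1 u2 -> kummer a b d d1 d2 -> poly_bounded u -> poly_bounded d ->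
  0 < x -> (u x * d1 x - u1 x * d x = 0)%C.
Proof.
intros Hu Hd Bu Bd Hx.
set (w := fun x => (u x * d1 x - u1 x * d x)%C).
set (P := fun x => exp (b * ln x) * exp (- x)).
assert (HP : forall t, 0 < t -> is_derive P t ((b / t - 1) * P t)).
{ intros t Ht; unfold P; auto_derive; [exact Ht |]; field; lra. }
assert (Hw : forall t, 0 < t -> is_Cderive (fun t => RtoC (P t) * w t)%C t (RtoC 0)).
{ intros t Ht; destruct (Hu t Ht) as [U1 [U2 _]]; destruct (Hd t Ht) as [D1 [D2 _]].
  assert (EU := kummer_second _ _ _ _ _ t Hu Ht).
  assert (ED := kummer_second _ _ _ _ _ t Hd Ht).
  assert (Dp := is_Cderive_RtoC _ _ _ (HP t Ht)).
  assert (Dw := is_Cderive_minus _ _ _ _ _ (is_Cderive_mult _ _ _ _ _ U1 D2)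
    (is_Cderive_mult _ _ _ _ _ U2 D1)).
  apply (is_Cderive_ext _ _ _ _ _ (fun t => eq_refl)) with (2 := is_Cderive_mult _ _ _ _ _ Dp Dw).
  rewrite EU, ED, RtoC_mult, RtoC_minus, RtoC_div by lra.
  field; apply RtoC_neq_0, Ht. }
assert (Bw : poly_bounded (fun x => RtoC (exp (b * ln x)) * w x)%C).
{ apply poly_bounded_mult; [apply poly_bounded_power |].
  apply poly_bounded_plus; [| apply poly_bounded_opp]; apply poly_bounded_mult; try assumption.
  - apply (kummer_poly_bounded_derive a b d d1 d2 Hd Bd).
  - apply (kummer_poly_bounded_derive a b u u1 u2 Hu Bu). }
(* The constant P w is compared with its value at arbitrarily large points, where the factor exp
   (-y) of P defeats the polynomial growth of y^b w. *)
destruct Bw as [C [N [X [HX [HC HB]]]]].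
assert (H0 : Cmod (RtoC (P x) * w x)%C <= 0).
{ apply (small_exp_poly _ C N X HC HX); intros y Hy.
  rewrite (is_Cderive_0_const (fun t => RtoC (P t) * w t)%C x y Hx) by (try lra; exact Hw).
  unfold P; rewrite RtoC_mult.
  replace (RtoC (exp (b * ln y)) * RtoC (exp (- y)) * w y)%C
    with (RtoC (exp (- y)) * (RtoC (exp (b * ln y)) * w y))%C by ring.
  rewrite Cmod_mult, Cmod_R, Rabs_pos_eq by apply Rlt_le, exp_pos.
  apply Rmult_le_compat_l; [apply Rlt_le, exp_pos | apply HB, Hy]. }
assert (H1 : (RtoC (P x) * w x)%C = 0%C).
{ apply Cmod_eq_0, Rle_antisym; [exact H0 | apply Cmod_ge_0]. }
assert (Px : 0 < P x) by (apply Rmult_lt_0_compat; apply exp_pos).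
change (w x = 0%C).
replace (w x) with (/ RtoC (P x) * (RtoC (P x) * w x))%C by (field; apply RtoC_neq_0, Px).
rewrite H1; ring.
Qed.

(** To the right of X the product E exp (-K t) does not increase, to the left E exp (K t) does not
    decrease. Both cases come from one mean value statement with a sign s. *)
Lemma gronwall_0 (E E' : R -> R) (X x K : R) :
  (forall t, Rmin X x <= t <= Rmax X x -> is_derive E t (E' t)) ->
  (forall t, Rmin X x <= t <= Rmax X x -> Rabs (E' t) <= K * E t) ->
  E X = 0 -> E x <= 0.
Proof.
intros Hd HB H0.
assert (H : forall s, exists c, Rmin X x <= c <= Rmax X x /\
  E x * exp (s * K * x) = (E' c + s * K * E c) * exp (s * K * c) * (x - X)).
{ intros s.
  destruct (MVT_gen (fun t => E t * exp (s * K * t)) X x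
    (fun t => (E' t + s * K * E t) * exp (s * K * t))) as [c [Hc Ec]].
  - intros t Ht.
    evar_last.
    + apply (is_derive_mult (K := R_AbsRing) E (fun t => exp (s * K * t)) t (E' t)
        (s * K * exp (s * K * t))); [apply Hd; lra | auto_derive; [trivial | ring] | apply Rmult_comm].
    + unfold plus, mult; simpl; ring.
  - intros t Ht; apply continuity_pt_filterlim,
      (continuous_mult (K := R_AbsRing) E (fun t => exp (s * K * t))).
    + apply (ex_derive_continuous (V := R_NormedModule)); exists (E' t); apply Hd, Ht.
    + apply (ex_derive_continuous (V := R_NormedModule)); auto_derive; trivial.
  - exists c; split; [exact Hc |]; rewrite H0 in Ec; lra. }
destruct (Rle_dec X x) as [Hx | Hx].
- destruct (H (-1)) as [c [Hc Ec]].
  specialize (HB c Hc); apply Rcomplements.Rabs_le_between in HB.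
  assert (X1 := exp_pos (-1 * K * x)); assert (X2 := exp_pos (-1 * K * c)).
  assert (E x * exp (-1 * K * x) <= 0); [rewrite Ec | nra].
  assert (0 <= exp (-1 * K * c) * (x - X)) by nra.
  replace (_ * _ * _) with ((E' c + -1 * K * E c) * (exp (-1 * K * c) * (x - X))) by ring; nra.
- destruct (H 1) as [c [Hc Ec]].
  specialize (HB c Hc); apply Rcomplements.Rabs_le_between in HB.
  assert (X1 := exp_pos (1 * K * x)); assert (X2 := exp_pos (1 * K * c)).
  assert (E x * exp (1 * K * x) <= 0); [rewrite Ec | nra].
  assert (0 <= exp (1 * K * c) * (X - x)) by nra.
  replace (_ * _ * _) with (- ((E' c + 1 * K * E c) * (exp (1 * K * c) * (X - x)))) by ring; nra.
Qed.

Lemma Re_conj_bound (z w : C) : Rabs (Re z * Re w + Im z * Im w) <= Cmod z * Cmod w.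
Proof.
rewrite <- (Cmod_conj z), <- Cmod_mult.
replace (Re z * Re w + Im z * Im w) with (Re (Cconj z * w)%C).
- apply re_le_Cmod.
- unfold Cconj, Cmult, Re, Im; simpl; ring.
Qed.

(** Uniqueness for the Cauchy problem, by Gronwall's inequality for the energy |e|^2 + |e1|^2. The
    equation is regular between X and x because that interval stays at distance m > 0 from the
    singular point 0. *)
Lemma kummer_zero (a : C) (b : R) (e e1 e2 : R -> C) (X x : R) :
  kummer a b e e1 e2 -> 0 < X -> 0 < x -> e X = 0%C -> e1 X = 0%C -> e x = 0%C.
Proof.
intros He HX Hx E0 E1.
set (m := Rmin X x).
assert (Hm : 0 < m) by (apply Rmin_case; assumption).
set (En := fun t => (Re (e t) ^ 2 + Im (e t) ^ 2) + (Re (e1 t) ^ 2 + Im (e1 t) ^ 2)).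
set (En' := fun t => 2 * (Re (e t) * Re (e1 t) + Im (e t) * Im (e1 t))
  + 2 * (Re (e1 t) * Re (e2 t) + Im (e1 t) * Im (e2 t))).
assert (HE : forall t, En t = Cmod (e t) ^ 2 + Cmod (e1 t) ^ 2)
  by (intros t; rewrite !Cmod2_alt; reflexivity).
set (A := 1 + Rabs b / m); set (B := Cmod a / m).
assert (HB : 0 <= B) by (apply Rle_mult_inv_pos; [apply Cmod_ge_0 | exact Hm]).
assert (HA : 0 <= A).
{ assert (H := Rle_mult_inv_pos _ _ (Rabs_pos b) Hm); unfold A, Rdiv; lra. }
assert (Hle : En x <= 0).
(* With y = |e| and z = |e1|, the derivative of the energy is at most 2 y z + 2 z (A z + B y), and 2
   y z <= y^2 + z^2 turns this into (1 + 2 A + B) (y^2 + z^2). *)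
{ apply (gronwall_0 En En' X x (1 + 2 * A + B)); fold m.
  - intros t Ht; assert (Ht0 : 0 < t) by lra; destruct (He t Ht0) as [D1 [D2 _]].
    assert (R0 := is_derive_Re _ _ _ D1); assert (I0 := is_derive_Im _ _ _ D1).
    assert (R1 := is_derive_Re _ _ _ D2); assert (I1 := is_derive_Im _ _ _ D2).
    assert (Sq : forall f l, is_derive f t l -> is_derive (fun t => f t ^ 2) t (2 * (f t * l))).
    { intros f l Hf; evar_last; [apply (is_derive_pow f 2 t l Hf) | simpl; ring]. }
    unfold En, En'.
    evar_last.
    + apply (is_derive_plus (V := R_NormedModule)); apply (is_derive_plus (V := R_NormedModule));
        apply Sq; eassumption.
    + unfold plus; simpl; ring.
  - intros t Ht; assert (Ht0 : 0 < t) by lra.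
    rewrite HE; unfold En'.
    assert (E := kummer_second _ _ _ _ _ t He Ht0).
    assert (B2 : Cmod (e2 t) <= A * Cmod (e1 t) + B * Cmod (e t)).
    { replace (e2 t) with ((1 - RtoC b / RtoC t) * e1 t + a / RtoC t * e t)%C
        by (rewrite E; field; apply RtoC_neq_0, Ht0).
      apply Rle_trans with (1 := Cmod_triangle _ _); rewrite !Cmod_mult.
      assert (Hi : / t <= / m) by (apply Rinv_le_contravar; lra).
      assert (Hit : 0 < / t) by (apply Rinv_0_lt_compat; lra).
      apply Rplus_le_compat; apply Rmult_le_compat_r; try apply Cmod_ge_0.
      - apply Rle_trans with (1 := Cmod_triangle _ _).
        rewrite Cmod_opp, Cmod_div, !Cmod_R, Rabs_R1, (Rabs_pos_eq t) by
          (try lra; apply RtoC_neq_0, Ht0).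
        unfold A, Rdiv; assert (H := Rabs_pos b); nra.
      - rewrite Cmod_div, Cmod_R, (Rabs_pos_eq t) by (try lra; apply RtoC_neq_0, Ht0).
        unfold B, Rdiv; assert (H := Cmod_ge_0 a); nra. }
    assert (C1 := Re_conj_bound (e t) (e1 t)); assert (C2 := Re_conj_bound (e1 t) (e2 t)).
    assert (M0 := Cmod_ge_0 (e t)); assert (M1 := Cmod_ge_0 (e1 t)).
    apply Rle_trans with (1 := Rabs_triang _ _).
    rewrite !Rabs_mult, (Rabs_pos_eq 2) by lra.
    assert (C3 : Cmod (e1 t) * Cmod (e2 t)
      <= Cmod (e1 t) * (A * Cmod (e1 t) + B * Cmod (e t))) by (apply Rmult_le_compat_l; assumption).
    assert (S := pow2_ge_0 (Cmod (e t) - Cmod (e1 t))).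
    assert (S1 := pow2_ge_0 (Cmod (e t))); assert (S2 := pow2_ge_0 (Cmod (e1 t))).
    set (y := Cmod (e t)) in *; set (z := Cmod (e1 t)) in *.
    assert (2 * (y * z) <= y ^ 2 + z ^ 2) by nra.
    nra.
  - unfold En; rewrite E0, E1; simpl; ring. }
rewrite HE in Hle; apply Cmod_eq_0.
assert (S2 := pow2_ge_0 (Cmod (e1 x))); assert (M0 := Cmod_ge_0 (e x)); nra.
Qed.

Lemma poly_bounded_asymptotic (a l : C) (f : R -> C) :
  filterlim (fun x => (Rcpow x a * f x)%C) (Rbar_locally p_infty) (locally l) ->
  poly_bounded f.
Proof.
intros H; destruct (proj1 (filterlim_C_p_infty _ _) H 1 Rlt_0_1) as [M HM].
assert (Hg : poly_bounded (fun x => Rcpow x a * f x)%C).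
{ exists (Cmod l + 1), 0%nat, (Rmax 1 (M + 1)); split; [apply Rmax_l |].
  split; [assert (H0 := Cmod_ge_0 l); lra |]; intros x Hx.
  assert (HMx : M < x) by (assert (H1 := Rmax_r 1 (M + 1)); lra).
  specialize (HM x HMx).
  replace (Rcpow x a * f x)%C with (l + (Rcpow x a * f x - l))%C by ring.
  assert (H1 := Cmod_triangle l (Rcpow x a * f x - l)); simpl; lra. }
destruct (poly_bounded_mult _ _ (poly_bounded_power (- Re a)) Hg) as [C [N [X [HX [HC HB]]]]].
exists C, N, X; repeat split; try assumption; intros x Hx.
specialize (HB x Hx); rewrite !Cmod_mult, Cmod_Rcpow, Cmod_R, Rabs_pos_eq in HB
  by apply Rlt_le, exp_pos.
rewrite <- Rmult_assoc, <- exp_plus in HB.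
replace (- Re a * ln x + Re a * ln x) with 0 in HB by ring.
rewrite exp_0, Rmult_1_l in HB; exact HB.
Qed.

(** The asymptotics provide a point X with u X nonzero. For k = v X / u X, the solution v - k u
    vanishes at X by construction, and so does its derivative because the Wronskian is 0; hence v =
    k u everywhere. The common normalisation at infinity then forces k = 1. *)
Lemma tricomi_unique (a : C) (b : R) (u v : R -> C) (x : R) :
  is_tricomiU a (RtoC b) u -> is_tricomiU a (RtoC b) v -> 0 < x -> u x = v x.
Proof.
intros [[u1 [u2 Hu]] Lu] [[v1 [v2 Hv]] Lv] Hx.
assert (Ku : kummer a b u u1 u2) by exact Hu.
assert (Kv : kummer a b v v1 v2) by exact Hv.
assert (Bu := poly_bounded_asymptotic _ _ _ Lu).
assert (Bv := poly_bounded_asymptotic _ _ _ Lv).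
assert (Au := proj1 (filterlim_C_p_infty _ _) Lu).
assert (Av := proj1 (filterlim_C_p_infty _ _) Lv).
assert (HX : exists X, 0 < X /\ u X <> 0%C).
{ destruct (Au 1 Rlt_0_1) as [M HM].
  exists (Rmax 1 (M + 1)); assert (H1 := Rmax_l 1 (M + 1)); assert (H2 := Rmax_r 1 (M + 1)).
  split; [lra |]; intros E; specialize (HM (Rmax 1 (M + 1))); rewrite E in HM.
  replace (Rcpow (Rmax 1 (M + 1)) a * 0 - 1)%C with (- (1))%C in HM by ring.
  rewrite Cmod_m1 in HM; lra. }
destruct HX as [X [HX Hn]].
set (k := (v X / u X)%C).
assert (Hk : forall y, 0 < y -> v y = (k * u y)%C).
{ intros y Hy.
  assert (Ke : kummer a b (fun t => v t - k * u t)%C (fun t => v1 t - k * u1 t)%C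
    (fun t => v2 t - k * u2 t)%C).
  { intros t Ht; destruct (Hu t Ht) as [U1 [U2 U3]]; destruct (Hv t Ht) as [V1 [V2 V3]].
    split; [| split].
    - apply is_Cderive_minus; [exact V1 | apply is_Cderive_const_mult, U1].
    - apply is_Cderive_minus; [exact V2 | apply is_Cderive_const_mult, U2].
    - transitivity ((RtoC t * v2 t + (RtoC b - RtoC t) * v1 t - a * v t)
        - k * (RtoC t * u2 t + (RtoC b - RtoC t) * u1 t - a * u t))%C; [ring |].
      rewrite U3, V3; ring. }
  assert (W := kummer_wronskian a b u u1 u2 v v1 v2 X Ku Kv Bu Bv HX).
  apply Ceq_minus.
  apply (kummer_zero a b _ _ _ X y Ke HX Hy); unfold k.
  - field; exact Hn.
  - transitivity ((u X * v1 X - u1 X * v X) / u X)%C; [field; exact Hn |].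
    rewrite W; field; exact Hn. }
assert (Hk1 : k = 1%C).
{ apply Ceq_minus, Cmod_eq_0, Rle_antisym; [| apply Cmod_ge_0].
  apply Rnot_lt_le; intros Hlt.
  (* With both normalised functions within [eps] of 1, k - 1 has modulus less than eps (1 + |k|),
     which is half of itself. *)
  set (eps := Cmod (k - 1) / (2 * (Cmod k + 1))).
  assert (HCk := Cmod_ge_0 k).
  assert (He : 0 < eps) by (apply Rdiv_lt_0_compat; lra).
  destruct (Au eps He) as [M1 H1]; destruct (Av eps He) as [M2 H2].
  set (y := Rmax 1 (Rmax M1 M2) + 1).
  assert (Y1 : M1 < y) by (assert (T := Rmax_l M1 M2); assert (T' := Rmax_r 1 (Rmax M1 M2)); unfold y; lra).
  assert (Y2 : M2 < y) by (assert (T := Rmax_r M1 M2); assert (T' := Rmax_r 1 (Rmax M1 M2)); unfold y; lra).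
  assert (Y0 : 0 < y) by (assert (T := Rmax_l 1 (Rmax M1 M2)); unfold y; lra).
  specialize (H1 y Y1); specialize (H2 y Y2); rewrite (Hk y Y0) in H2.
  assert (T := Cmod_triangle (Rcpow y a * (k * u y) - 1) (- (k * (Rcpow y a * u y - 1)))).
  replace (Rcpow y a * (k * u y) - 1 + - (k * (Rcpow y a * u y - 1)))%C with (k - 1)%C in T by ring.
  rewrite Cmod_opp, Cmod_mult in T.
  assert (E : eps * (2 * (Cmod k + 1)) = Cmod (k - 1)) by (unfold eps; field; lra).
  nra. }
rewrite (Hk x Hx), Hk1; ring.
Qed.

(** * Tricomi's function with first parameter near 1 *)

(** Logarithms of the bases whose e-th powers occur in the integrals: exp (e rho t) is ((1+t)/t)^e
    and exp (e nlog t) is t^(-e). *)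
Definition rho (t : R) : R := ln (1 + t) - ln t.
Definition nlog (t : R) : R := - ln t.

Lemma continuous_ln (t : R) : 0 < t -> continuous ln t.
Proof.
intros Ht; apply (ex_derive_continuous (V := R_NormedModule)); auto_derive; exact Ht.
Qed.

Lemma continuous_ln_1p (t : R) : 0 < t -> continuous (fun t => ln (1 + t)) t.
Proof.
intros Ht; apply (ex_derive_continuous (V := R_NormedModule)); auto_derive; lra.
Qed.

Lemma subln_rho : subln rho.
Proof.
split; intros t Ht.
- apply (continuous_minus (V := R_NormedModule)); [apply continuous_ln_1p | apply continuous_ln]; exact Ht.
- assert (H := ln_le_ln_1p t Ht); assert (H1 := ln_1p_pos t Ht).
  unfold rho, lam; rewrite Rabs_pos_eq; lra.
Qed.

Lemma subln_nlog : subln nlog.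
Proof.
split; intros t Ht.
- apply (continuous_opp (V := R_NormedModule)), continuous_ln, Ht.
- assert (H := ln_le_ln_1p t Ht); assert (H1 := ln_1p_pos t Ht).
  unfold nlog, lam; rewrite Rabs_Ropp; apply Rabs_le; lra.
Qed.

Lemma poly_growth_1 : poly_growth (fun _ => 1).
Proof.
split; [intros; apply continuous_const |].
exists 1, 0%nat; split; [lra |]; intros; rewrite Rabs_R1; simpl; lra.
Qed.

Lemma poly_growth_1p_pow (n : nat) : poly_growth (fun t => (1 + t) ^ n).
Proof.
split.
- intros t Ht; apply (ex_derive_continuous (V := R_NormedModule)); auto_derive; trivial.
- exists 1, n; split; [lra |]; intros t Ht; rewrite Rabs_pos_eq; [lra | apply pow_le; lra].
Qed.

Lemma filterlim_at_right_0_bound (f : R -> R) (C : R) :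
  0 <= C -> (forall t, 0 < t -> t < 1 -> Rabs (f t) <= C * sqrt t) ->
  filterlim f (at_right 0) (locally 0).
Proof.
intros HC H; apply filterlim_locally; intros eps; assert (He := cond_pos eps).
set (d := Rmin 1 ((eps / (C + 1)) ^ 2)).
assert (Hq : 0 < eps / (C + 1)) by (apply Rdiv_lt_0_compat; lra).
assert (Hd : 0 < d) by (apply Rmin_pos; [lra | apply pow_lt, Hq]).
exists (mkposreal d Hd); intros t Bt Ht; simpl in Bt.
change (Rabs (t - 0) < d) in Bt; rewrite Rminus_0_r, Rabs_pos_eq in Bt by lra.
assert (D1 : d <= 1) by apply Rmin_l.
assert (D2 : d <= (eps / (C + 1)) ^ 2) by apply Rmin_r.
change (Rabs (f t - 0) < eps); rewrite Rminus_0_r.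
apply Rle_lt_trans with (C * sqrt t); [apply H; lra |].
assert (Hs : sqrt t < eps / (C + 1)).
{ rewrite <- (sqrt_pow2 (eps / (C + 1))) by lra; apply sqrt_lt_1; lra. }
assert (Hs0 := sqrt_pos t).
apply Rle_lt_trans with ((C + 1) * sqrt t); [nra |].
apply (Rmult_lt_compat_l (C + 1)) in Hs; [| lra].
replace ((C + 1) * (eps / (C + 1))) with (pos eps) in Hs by (field; lra); exact Hs.
Qed.

Lemma filterlim_id_mult_tempered (f : R -> R) :
  tempered f -> filterlim (fun t => t * f t) (at_right 0) (locally 0).
Proof.
intros [_ [C [m [HC HB]]]]; apply (filterlim_at_right_0_bound _ (C * 2 ^ m)).
- apply Rmult_le_pos; [exact HC | apply pow_le; lra].
- intros t Ht Ht1; rewrite Rabs_mult, (Rabs_pos_eq t) by lra.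
  assert (Hs : 0 < sqrt t) by (apply sqrt_lt_R0, Ht).
  replace (C * 2 ^ m * sqrt t) with (t * (C * 2 ^ m / sqrt t)).
  2: { rewrite <- (sqrt_sqrt t) at 1 by lra; field; lra. }
  apply Rmult_le_compat_l; [lra |]; apply Rle_trans with (1 := HB t Ht).
  apply Rmult_le_compat_r; [apply Rlt_le, Rinv_0_lt_compat, Hs |].
  apply Rmult_le_compat_l; [exact HC | apply pow_incr; lra].
Qed.

(** The factor t removes the boundary term at 0 even where f is unbounded, since a tempered f grows
    at most like 1 / sqrt t there. *)
Lemma laplace_derivative_id_mult (f p : R -> R) (x : R) :
  tempered f -> tempered p -> (forall t, 0 < t -> is_derive (fun t => t * f t) t (p t)) ->
  0 < x -> laplace p x = x * laplace (fun t => t * f t) x.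
Proof.
intros Hf Hp Hd Hx.
rewrite (laplace_derivative (fun t => t * f t) p 0 x); try assumption.
- ring.
- apply tempered_id_mult, Hf.
- apply filterlim_id_mult_tempered, Hf.
Qed.

Lemma is_derive_expcos (th : R -> R) (p q t l : R) :
  is_derive th t l ->
  is_derive (expcos th p q) t (l * (p * expcos th p q t - q * expsin th p q t)).
Proof.
intros Hl.
assert (D : forall k, is_derive (fun t => k * th t) t (k * l)).
{ intros k; apply (is_derive_scal th t k l Hl). }
unfold expcos, expsin; evar_last.
- apply (is_derive_mult (K := R_AbsRing) (fun t => exp (p * th t)) (fun t => cos (q * th t))).
  + apply (is_derive_comp exp (fun t => p * th t)); [apply is_derive_exp | apply D].
  + apply (is_derive_comp cos (fun t => q * th t)); [apply is_derive_cos | apply D].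
  + apply Rmult_comm.
- unfold plus, mult, scal; simpl; unfold mult; simpl; ring.
Qed.

Lemma is_derive_expsin (th : R -> R) (p q t l : R) :
  is_derive th t l ->
  is_derive (expsin th p q) t (l * (p * expsin th p q t + q * expcos th p q t)).
Proof.
intros Hl.
assert (D : forall k, is_derive (fun t => k * th t) t (k * l)).
{ intros k; apply (is_derive_scal th t k l Hl). }
unfold expcos, expsin; evar_last.
- apply (is_derive_mult (K := R_AbsRing) (fun t => exp (p * th t)) (fun t => sin (q * th t))).
  + apply (is_derive_comp exp (fun t => p * th t)); [apply is_derive_exp | apply D].
  + apply (is_derive_comp sin (fun t => q * th t)); [apply is_derive_sin | apply D].
  + apply Rmult_comm.
- unfold plus, mult, scal; simpl; unfold mult; simpl; ring.
Qed.

(* The derivative of [exp (- (x * t)) * t * (1 + t)^(n+1) * f t] has integral 0.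
   For [f] the real or imaginary part of [exp (e rho)] this is Kummer's equation. *)
Lemma laplace_rho_parts (n : nat) (f g : R -> R) (x : R) :
  tempered f -> tempered g ->
  (forall t, 0 < t -> is_derive f t (- / (t * (1 + t)) * g t)) -> 0 < x ->
  laplace (fun t => (1 + t) ^ n * f t) x
    + (INR n + 2) * laplace (fun t => t * ((1 + t) ^ n * f t)) x
    - laplace (fun t => (1 + t) ^ n * g t) x
  = x * (laplace (fun t => t * ((1 + t) ^ n * f t)) x
         + laplace (fun t => t * (t * ((1 + t) ^ n * f t))) x).
Proof.
intros Hf Hg Hd Hx.
set (w := fun h t => (1 + t) ^ n * h t : R).
assert (Twf : tempered (w f)) by apply (tempered_weight _ _ (poly_growth_1p_pow n) Hf).
assert (Twg : tempered (w g)) by apply (tempered_weight _ _ (poly_growth_1p_pow n) Hg).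
assert (T1 := tempered_id_mult _ Twf).
assert (T2 := tempered_id_mult _ T1).
(* [t * P t] is t (1+t)^(n+1) f t, and [p] is its derivative arranged so that each term is one of
   the transforms in the statement. *)
set (P := fun t => w f t + t * w f t).
set (p := fun t => w f t + ((INR n + 2) * (t * w f t) + -1 * w g t)).
assert (TP : tempered P) by (apply tempered_plus; assumption).
assert (Ta : tempered (fun t => (INR n + 2) * (t * w f t))) by apply tempered_scal, T1.
assert (Tb : tempered (fun t => -1 * w g t)) by apply tempered_scal, Twg.
assert (Tab : tempered (fun t => (INR n + 2) * (t * w f t) + -1 * w g t))
  by (apply tempered_plus; assumption).
assert (Tp : tempered p) by (apply tempered_plus; assumption).
assert (E := laplace_derivative_id_mult P p x TP Tp).
assert (E1 : laplace (fun t => t * P t) x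
  = laplace (fun t => t * w f t) x + laplace (fun t => t * (t * w f t)) x).
{ rewrite <- laplace_plus by assumption.
  apply laplace_ext; [apply tempered_plus; assumption | exact Hx |].
  intros t Ht; unfold P; ring. }
assert (E2 : laplace p x = laplace (w f) x + ((INR n + 2) * laplace (fun t => t * w f t) x
  + -1 * laplace (w g) x)).
{ unfold p; rewrite (laplace_plus (w f)), laplace_plus, !laplace_scal by assumption; reflexivity. }
assert (E3 : laplace p x = x * laplace (fun t => t * P t) x).
{ apply E; [| exact Hx].
  intros t Ht.
  apply (is_derive_ext (fun t => t * (1 + t) ^ (n + 1) * f t)).
  { intros s; unfold P, w; rewrite pow_add; simpl; ring. }
  evar_last.
  - apply (is_derive_mult (K := R_AbsRing) (fun t => t * (1 + t) ^ (n + 1)) f); [| apply Hd, Ht |].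
    2: apply Rmult_comm.
    auto_derive; [trivial | reflexivity].
  - unfold plus, mult, p, w; simpl; rewrite Nat.add_1_r; simpl pred.
    rewrite S_INR; simpl pow; field; lra. }
change (laplace (w f) x + (INR n + 2) * laplace (fun t => t * w f t) x - laplace (w g) x
  = x * (laplace (fun t => t * w f t) x + laplace (fun t => t * (t * w f t)) x)).
rewrite <- E1, <- E3, E2; ring.
Qed.

Definition Claplace (w th : R -> R) (e : C) (x : R) : C :=
  (laplace (fun t => w t * expcos th (Re e) (Im e) t) x,
   laplace (fun t => w t * expsin th (Re e) (Im e) t) x).

Lemma poly_growth_id_mult (w : R -> R) : poly_growth w -> poly_growth (fun t => t * w t).
Proof.
intros [Cw [D [m [HD HB]]]]; split.
- intros t Ht; apply (continuous_mult (K := R_AbsRing)); [apply continuous_id | apply Cw, Ht].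
- exists D, (S m); split; [exact HD |]; intros t Ht; rewrite Rabs_mult, (Rabs_pos_eq t) by lra.
  specialize (HB t Ht); simpl.
  replace (D * ((1 + t) * (1 + t) ^ m)) with ((1 + t) * (D * (1 + t) ^ m)) by ring.
  apply Rmult_le_compat; try lra; apply Rabs_pos.
Qed.

Lemma Claplace_id_mult (w th : R -> R) (e : C) (x : R) :
  poly_growth w -> subln th -> Rabs (Re e) <= / 8 -> 0 < x ->
  Claplace (fun t => t * w t)%R th e x =
  (laplace (fun t => t * (w t * expcos th (Re e) (Im e) t)) x,
   laplace (fun t => t * (w t * expsin th (Re e) (Im e) t)) x).
Proof.
intros Hw Hth He Hx.
destruct (tempered_expcs th (Re e) (Im e) Hth He) as [Tc Ts].
assert (Twc := tempered_weight w _ Hw Tc); assert (Tws := tempered_weight w _ Hw Ts).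
unfold Claplace; f_equal; apply laplace_ext; try exact Hx; try (intros; ring);
  apply tempered_id_mult; assumption.
Qed.

Lemma is_Cderive_Claplace (w th : R -> R) (e : C) (x : R) :
  poly_growth w -> subln th -> Rabs (Re e) <= / 8 -> 0 < x ->
  is_Cderive (Claplace w th e) x (- Claplace (fun t => t * w t)%R th e x)%C.
Proof.
intros Hw Hth He Hx; rewrite Claplace_id_mult by assumption.
destruct (tempered_expcs th (Re e) (Im e) Hth He) as [Tc Ts].
assert (Twc := tempered_weight w _ Hw Tc); assert (Tws := tempered_weight w _ Hw Ts).
exact (is_Cderive_pair _ _ _ _ _ (is_derive_laplace _ x Twc Hx) (is_derive_laplace _ x Tws Hx)).
Qed.

Lemma is_derive_rho (t : R) : 0 < t -> is_derive rho t (- / (t * (1 + t))).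
Proof. intros Ht; unfold rho; auto_derive; [lra | field; lra]. Qed.

(** Differentiating the real or the imaginary part of exp (e rho) yields a combination of both
    parts; the lemma is applied once with coefficients p, -q and once with p, q. *)
Lemma laplace_rho_parts_comb (n : nat) (f g : R -> R) (p q x : R) :
  tempered f -> tempered g ->
  (forall t, 0 < t -> is_derive f t (- / (t * (1 + t)) * (p * f t + q * g t))) -> 0 < x ->
  laplace (fun t => (1 + t) ^ n * f t) x
    + (INR n + 2) * laplace (fun t => t * ((1 + t) ^ n * f t)) x
    - (p * laplace (fun t => (1 + t) ^ n * f t) x + q * laplace (fun t => (1 + t) ^ n * g t) x)
  = x * (laplace (fun t => t * ((1 + t) ^ n * f t)) x
         + laplace (fun t => t * (t * ((1 + t) ^ n * f t))) x).
Proof.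
intros Hf Hg Hd Hx.
assert (Twf := tempered_weight _ _ (poly_growth_1p_pow n) Hf).
assert (Twg := tempered_weight _ _ (poly_growth_1p_pow n) Hg).
assert (T1 := tempered_scal p _ Twf); assert (T2 := tempered_scal q _ Twg).
rewrite <- (laplace_rho_parts n f (fun t => p * f t + q * g t) x Hf); try assumption.
- rewrite (laplace_ext (fun t => p * ((1 + t) ^ n * f t) + q * ((1 + t) ^ n * g t))
    (fun t => (1 + t) ^ n * (p * f t + q * g t)) x); [| | exact Hx | intros; ring].
  + rewrite laplace_plus, !laplace_scal by assumption; reflexivity.
  + apply tempered_plus; assumption.
- apply tempered_plus; apply tempered_scal; assumption.
Qed.

(** Differentiation in x multiplies the weight by -t, so the equation is a linear relation between
    the transforms with weights 1, t and t^2 times (1+t)^n: the one given by integration by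
    parts. *)
Lemma kummer_Claplace (n : nat) (e : C) :
  Rabs (Re e) <= / 8 ->
  kummer (1 - e)%C (INR n + 2) (Claplace (fun t => (1 + t) ^ n) rho e)
    (fun x => - Claplace (fun t => t * (1 + t) ^ n)%R rho e x)%C
    (fun x => Claplace (fun t => t * (t * (1 + t) ^ n))%R rho e x).
Proof.
intros He x Hx.
assert (Hw := poly_growth_1p_pow n).
assert (Hw1 := poly_growth_id_mult _ Hw).
split; [| split].
- apply is_Cderive_Claplace; try assumption; apply subln_rho.
- apply (is_Cderive_ext (fun x => - (1) * Claplace (fun t => t * (1 + t) ^ n)%R rho e x)%C _ x
    (- (1) * - Claplace (fun t => t * (t * (1 + t) ^ n))%R rho e x)%C).
  + intros; ring.
  + ring.
  + apply is_Cderive_const_mult, is_Cderive_Claplace; try assumption; apply subln_rho.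
- destruct (tempered_expcs rho (Re e) (Im e) subln_rho He) as [Tc Ts].
  rewrite (Claplace_id_mult (fun t => t * (1 + t) ^ n)) by (try assumption; apply subln_rho).
  rewrite (Claplace_id_mult (fun t => (1 + t) ^ n)) by (try assumption; apply subln_rho).
  unfold Claplace.
  set (p := Re e) in *; set (q := Im e) in *.
  assert (EC := laplace_rho_parts_comb n (expcos rho p q) (expsin rho p q) p (- q) x Tc Ts).
  assert (ES := laplace_rho_parts_comb n (expsin rho p q) (expcos rho p q) p q x Ts Tc).
  assert (Twc := tempered_weight _ _ Hw Tc); assert (Tws := tempered_weight _ _ Hw Ts).
  assert (T1c := tempered_id_mult _ Twc); assert (T1s := tempered_id_mult _ Tws).
  assert (T2c := tempered_id_mult _ T1c); assert (T2s := tempered_id_mult _ T1s).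
  rewrite (laplace_ext (fun t => t * (t * ((1 + t) ^ n * expcos rho p q t)))
    (fun t => t * (t * (1 + t) ^ n * expcos rho p q t)) x) by (try assumption; intros; ring).
  rewrite (laplace_ext (fun t => t * (t * ((1 + t) ^ n * expsin rho p q t)))
    (fun t => t * (t * (1 + t) ^ n * expsin rho p q t)) x) by (try assumption; intros; ring).
  assert (EC' : forall t, 0 < t -> is_derive (expcos rho p q) t
    (- / (t * (1 + t)) * (p * expcos rho p q t + - q * expsin rho p q t))).
  { intros t Ht; evar_last; [apply is_derive_expcos, is_derive_rho, Ht | ring]. }
  assert (ES' : forall t, 0 < t -> is_derive (expsin rho p q) t
    (- / (t * (1 + t)) * (p * expsin rho p q t + q * expcos rho p q t))).
  { intros t Ht; apply is_derive_expsin, is_derive_rho, Ht. }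
  specialize (EC EC' Hx); specialize (ES ES' Hx); clear EC' ES'.
  replace e with (p, q) by (destruct e; reflexivity).
  unfold RtoC, Cplus, Cminus, Copp, Cmult, Cplus; simpl; f_equal; lra.
Qed.

(** * The Gamma integral and its scaling in x *)

Lemma is_derive_nlog (t : R) : 0 < t -> is_derive nlog t (- / t).
Proof. intros Ht; unfold nlog; auto_derive; [lra | field; lra]. Qed.

Lemma laplace_nlog_parts (f g : R -> R) (p q x : R) :
  tempered f -> tempered g ->
  (forall t, 0 < t -> is_derive f t (- / t * (p * f t + q * g t))) -> 0 < x ->
  laplace f x - (p * laplace f x + q * laplace g x) = x * laplace (fun t => t * f t) x.
Proof.
intros Hf Hg Hd Hx.
assert (T1 := tempered_scal (1 - p) _ Hf); assert (T2 := tempered_scal (- q) _ Hg).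
rewrite <- (laplace_derivative_id_mult f (fun t => (1 - p) * f t + - q * g t) x Hf).
- rewrite laplace_plus, !laplace_scal by assumption; ring.
- apply tempered_plus; assumption.
- intros t Ht; evar_last.
  + apply (is_derive_mult (K := R_AbsRing) (fun t => t) f); [apply is_derive_id | apply Hd, Ht |].
    apply Rmult_comm.
  + unfold plus, mult, one; simpl; field; lra.
- exact Hx.
Qed.

(* [Cgamma e x] is [Gamma (1 - e) x^(e-1)]. *)
Definition Cgamma (e : C) (x : R) : C := Claplace (fun _ => 1) nlog e x.

Lemma is_Cderive_Cgamma (e : C) (x : R) :
  Rabs (Re e) <= / 8 -> 0 < x ->
  is_Cderive (Cgamma e) x (- ((1 - e) * Cgamma e x) / RtoC x)%C.
Proof.
intros He Hx.
assert (D := is_Cderive_Claplace _ _ e x poly_growth_1 subln_nlog He Hx).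
assert (E := Claplace_id_mult _ _ e x poly_growth_1 subln_nlog He Hx).
cbv beta in D, E; rewrite E in D; clear E.
apply (is_Cderive_ext _ _ _ _ _ (fun t => eq_refl)) with (2 := D).
destruct (tempered_expcs nlog (Re e) (Im e) subln_nlog He) as [Tc Ts].
unfold Cgamma, Claplace.
set (p := Re e) in *; set (q := Im e) in *.
assert (Tc1 := tempered_weight _ _ poly_growth_1 Tc); assert (Ts1 := tempered_weight _ _ poly_growth_1 Ts).
assert (EC := laplace_nlog_parts (fun t => 1 * expcos nlog p q t) (fun t => 1 * expsin nlog p q t)
  p (- q) x Tc1 Ts1).
assert (ES := laplace_nlog_parts (fun t => 1 * expsin nlog p q t) (fun t => 1 * expcos nlog p q t)
  p q x Ts1 Tc1).
assert (EC' : forall t, 0 < t -> is_derive (fun t => 1 * expcos nlog p q t) t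
  (- / t * (p * (1 * expcos nlog p q t) + - q * (1 * expsin nlog p q t)))).
{ intros t Ht; evar_last; [apply (is_derive_scal (expcos nlog p q)), is_derive_expcos,
    is_derive_nlog, Ht | ring]. }
assert (ES' : forall t, 0 < t -> is_derive (fun t => 1 * expsin nlog p q t) t
  (- / t * (p * (1 * expsin nlog p q t) + q * (1 * expcos nlog p q t)))).
{ intros t Ht; evar_last; [apply (is_derive_scal (expsin nlog p q)), is_derive_expsin,
    is_derive_nlog, Ht | ring]. }
specialize (EC EC' Hx); specialize (ES ES' Hx); clear EC' ES'.
replace e with (p, q) by (destruct e; reflexivity).
unfold Cdiv; rewrite <- RtoC_inv by lra.
set (A := laplace (fun t => 1 * expcos nlog p q t) x) in *.
set (B := laplace (fun t => 1 * expsin nlog p q t) x) in *.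
set (A1 := laplace (fun t => t * (1 * expcos nlog p q t)) x) in *.
set (B1 := laplace (fun t => t * (1 * expsin nlog p q t)) x) in *.
assert (EA : A1 = (A - (p * A + - q * B)) / x) by (rewrite EC; field; lra).
assert (EB : B1 = (B - (p * B + q * A)) / x) by (rewrite ES; field; lra).
rewrite EA, EB.
unfold RtoC, Cplus, Cminus, Copp, Cmult, Cplus; simpl; f_equal; field; lra.
Qed.

Lemma is_Cderive_Rcpow (a : C) (x : R) :
  0 < x -> is_Cderive (fun x => Rcpow x a) x (a / RtoC x * Rcpow x a)%C.
Proof.
intros Hx.
assert (D1 := is_Cderive_RtoC _ _ _ (is_derive_power (Re a) x Hx)).
assert (D2 : is_Cderive (fun x => (cos (Im a * ln x), sin (Im a * ln x))) x
  (- (Im a / x * sin (Im a * ln x)), Im a / x * cos (Im a * ln x))).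
{ apply is_Cderive_pair; auto_derive; try exact Hx; field; lra. }
apply (is_Cderive_ext _ _ _ _ _ (fun t => eq_refl)) with (2 := is_Cderive_mult _ _ _ _ _ D1 D2).
unfold Rcpow, Cdiv; rewrite <- RtoC_inv by lra.
destruct a as [p q]; unfold Re, Im, RtoC, Cplus, Cmult; simpl; f_equal; field; lra.
Qed.

Lemma Rcpow_1 (a : C) : Rcpow 1 a = 1%C.
Proof.
unfold Rcpow; rewrite ln_1, !Rmult_0_r, exp_0, cos_0, sin_0.
unfold RtoC, Cmult; simpl; f_equal; ring.
Qed.

(** The first-order equation x g' = -(1 - e) g for g = [Cgamma e] says that the product is constant;
    this replaces the substitution of t / x for t in the integral. *)
Lemma Rcpow_Cgamma (e : C) (x : R) :
  Rabs (Re e) <= / 8 -> 0 < x -> (Rcpow x (1 - e) * Cgamma e x = Cgamma e 1)%C.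
Proof.
intros He Hx.
transitivity (Rcpow 1 (1 - e) * Cgamma e 1)%C; [| rewrite Rcpow_1; ring].
apply (is_Cderive_0_const (fun x => Rcpow x (1 - e) * Cgamma e x)%C); try lra.
intros t Ht.
apply (is_Cderive_ext _ _ _ _ _ (fun t => eq_refl))
  with (2 := is_Cderive_mult _ _ _ _ _ (is_Cderive_Rcpow _ t Ht) (is_Cderive_Cgamma e t He Ht)).
field; apply RtoC_neq_0, Ht.
Qed.

Lemma Rcpow_real (x p : R) : Rcpow x (RtoC p) = RtoC (exp (p * ln x)).
Proof.
unfold Rcpow; simpl; rewrite Rmult_0_l, cos_0, sin_0.
unfold RtoC, Cmult; simpl; f_equal; ring.
Qed.

Lemma laplace_power_scaling (p x : R) :
  Rabs p <= / 8 -> 0 < x ->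
  exp ((1 - p) * ln x) * laplace (fun t => 1 * expcos nlog p 0 t) x
  = laplace (fun t => 1 * expcos nlog p 0 t) 1.
Proof.
intros Hp Hx; assert (E := Rcpow_Cgamma (RtoC p) x Hp Hx).
rewrite <- RtoC_minus, Rcpow_real in E.
apply (f_equal fst) in E; simpl in E; rewrite <- E; ring.
Qed.

Lemma laplace_id_power (p x : R) :
  Rabs p <= / 8 -> 0 < x ->
  x * laplace (fun t => t * (1 * expcos nlog p 0 t)) x
  = (1 - p) * laplace (fun t => 1 * expcos nlog p 0 t) x.
Proof.
intros Hp Hx.
destruct (tempered_expcs nlog p 0 subln_nlog Hp) as [Tc Ts].
assert (Tc1 := tempered_weight _ _ poly_growth_1 Tc); assert (Ts1 := tempered_weight _ _ poly_growth_1 Ts).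
rewrite <- (laplace_nlog_parts (fun t => 1 * expcos nlog p 0 t) (fun t => 1 * expsin nlog p 0 t)
  p 0 x Tc1 Ts1).
- ring.
- intros t Ht; evar_last; [apply (is_derive_scal (expcos nlog p 0)), is_derive_expcos,
    is_derive_nlog, Ht | ring].
- exact Hx.
Qed.

(** * Asymptotics at infinity and existence *)

Lemma exp_cos_minus_1_bound (n : nat) (p q t : R) :
  0 < t -> Rabs p <= / 8 -> Rabs q <= / 8 ->
  Rabs ((1 + t) ^ n * (exp (p * ln (1 + t)) * cos (q * ln (1 + t))) - 1)
    <= (INR n + 2) * (t * (1 + t) ^ (n + 1)) /\
  Rabs ((1 + t) ^ n * (exp (p * ln (1 + t)) * sin (q * ln (1 + t))))
    <= t * (1 + t) ^ (n + 1).
Proof.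
intros Ht Hp Hq; set (l := ln (1 + t)).
assert (Hl : 0 < l) by apply ln_1p_pos, Ht.
assert (Hlt : l <= t) by apply ln_1p_le, Ht.
assert (En : (1 + t) ^ n = exp (INR n * l)).
{ unfold l; rewrite <- ln_pow by lra; rewrite exp_ln; [reflexivity | apply pow_lt; lra]. }
assert (En1 : (1 + t) ^ (n + 1) = exp ((INR n + 1) * l)).
{ rewrite <- (exp_ln ((1 + t) ^ (n + 1))) by (apply pow_lt; lra).
  rewrite ln_pow, plus_INR by lra; reflexivity. }
assert (Hn := pos_INR n).
apply Rcomplements.Rabs_le_between in Hp.
(* The modulus of (1+t)^(n+e) is exp u, with |u| <= (n+1) ln (1+t). So exp |u| <= (1+t)^(n+1), and
   ln (1+t) <= t supplies the factor t. In the first bound, n + 1 comes from exp u - 1 and the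
   remaining 1 from the cosine. *)
set (u := (INR n + p) * l).
assert (Hprod : exp (INR n * l) * exp (p * l) = exp u).
{ rewrite <- exp_plus; f_equal; unfold u; ring. }
assert (Hu : exp u <= exp ((INR n + 1) * l)) by (apply exp_le; unfold u; nra).
assert (Hau : Rabs u <= (INR n + 1) * l).
{ unfold u; rewrite Rabs_mult, (Rabs_pos_eq l) by lra; apply Rmult_le_compat_r; [lra |].
  apply Rabs_le; lra. }
assert (Hv : Rabs (q * l) <= t).
{ rewrite Rabs_mult, (Rabs_pos_eq l) by lra; assert (H := Rabs_pos q); nra. }
assert (X1 := exp_pos u); rewrite En, En1; set (Y := exp ((INR n + 1) * l)) in *.
split.
- replace (exp (INR n * l) * (exp (p * l) * cos (q * l)) - 1)
    with (exp u * (cos (q * l) - 1) + (exp u - 1)) by (rewrite <- Hprod; ring).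
  apply Rle_trans with (1 := Rabs_triang _ _).
  rewrite Rabs_mult, (Rabs_pos_eq (exp u)) by lra.
  assert (H1 := Rabs_1_cos_le (q * l)); assert (H2 := exp_minus_1_le u).
  assert (H3 : exp (Rabs u) <= Y) by (apply exp_le; exact Hau).
  assert (H4 := Rabs_pos u); assert (H5 := exp_pos (Rabs u)).
  assert (H6 : Rabs u * exp (Rabs u) <= ((INR n + 1) * t) * Y).
  { apply Rmult_le_compat; try lra; nra. }
  assert (H7 : exp u * Rabs (cos (q * l) - 1) <= Y * t).
  { apply Rmult_le_compat; try lra; apply Rabs_pos. }
  nra.
- replace (exp (INR n * l) * (exp (p * l) * sin (q * l))) with (exp u * sin (q * l))
    by (rewrite <- Hprod; ring).
  rewrite Rabs_mult, (Rabs_pos_eq (exp u)) by lra.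
  assert (H1 := Rabs_sin_le (q * l)).
  rewrite (Rmult_comm t); apply Rmult_le_compat; try lra; apply Rabs_pos.
Qed.

(** Since rho = ln (1+t) + nlog, the difference is t^(-e) ((1+t)^(n+e) - 1), and the second factor
    is of order t. [expcos nlog p 0 t] is t^(-p), the modulus of t^(-e); n + 3 adds the constants n
    + 2 and 1 of the two preceding bounds. *)
Lemma expcs_rho_nlog_bound (n : nat) (p q t : R) :
  0 < t -> Rabs p <= / 8 -> Rabs q <= / 8 ->
  Rabs ((1 + t) ^ n * expcos rho p q t - 1 * expcos nlog p q t)
    <= (INR n + 3) * (1 + t) ^ (n + 1) * (t * (1 * expcos nlog p 0 t)) /\
  Rabs ((1 + t) ^ n * expsin rho p q t - 1 * expsin nlog p q t)
    <= (INR n + 3) * (1 + t) ^ (n + 1) * (t * (1 * expcos nlog p 0 t)).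
Proof.
intros Ht Hp Hq.
destruct (exp_cos_minus_1_bound n p q t Ht Hp Hq) as [H1 H2].
set (l := ln (1 + t)) in *.
assert (Er : rho t = l + nlog t) by (unfold rho, nlog, l; ring).
unfold expcos, expsin; rewrite Er, Rmult_0_l, cos_0.
replace (p * (l + nlog t)) with (p * l + p * nlog t) by ring.
replace (q * (l + nlog t)) with (q * l + q * nlog t) by ring.
rewrite cos_plus, sin_plus, exp_plus.
assert (X := exp_pos (p * nlog t)).
set (c := cos (q * nlog t)); set (s := sin (q * nlog t)).
assert (Hc : Rabs c <= 1) by apply Rabs_le, COS_bound.
assert (Hs : Rabs s <= 1) by apply Rabs_le, SIN_bound.
set (T := t * (1 + t) ^ (n + 1)) in *.
assert (HT : 0 < T) by (apply Rmult_lt_0_compat; [exact Ht | apply pow_lt; lra]).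
set (A := (1 + t) ^ n * (exp (p * l) * cos (q * l)) - 1) in *.
set (B := (1 + t) ^ n * (exp (p * l) * sin (q * l))) in *.
assert (HB : forall c s, Rabs c <= 1 -> Rabs s <= 1 -> Rabs (A * c + B * s) <= (INR n + 3) * T).
{ clear - H1 H2; intros c s Hc Hs; apply Rle_trans with (1 := Rabs_triang _ _).
  rewrite !Rabs_mult.
  assert (Rabs A * Rabs c <= Rabs A * 1) by (apply Rmult_le_compat_l; [apply Rabs_pos | exact Hc]).
  assert (Rabs B * Rabs s <= Rabs B * 1) by (apply Rmult_le_compat_l; [apply Rabs_pos | exact Hs]).
  lra. }
split.
- replace (_ - _) with (exp (p * nlog t) * (A * c + B * - s)) by (unfold A, B, c, s; ring).
  rewrite Rabs_mult, (Rabs_pos_eq (exp _)) by lra.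
  replace (_ * _ * _) with (exp (p * nlog t) * ((INR n + 3) * T)) by (unfold T; ring).
  apply Rmult_le_compat_l; [lra |]; apply HB; [exact Hc | rewrite Rabs_Ropp; exact Hs].
- replace (_ - _) with (exp (p * nlog t) * (A * s + B * c)) by (unfold A, B, c, s; ring).
  rewrite Rabs_mult, (Rabs_pos_eq (exp _)) by lra.
  replace (_ * _ * _) with (exp (p * nlog t) * ((INR n + 3) * T)) by (unfold T; ring).
  apply Rmult_le_compat_l; [lra |]; apply HB; assumption.
Qed.

Lemma pow_1p_le_exp (n : nat) (t : R) : 0 <= t -> (1 + t) ^ n <= exp (INR n * t).
Proof.
intros Ht; rewrite <- (exp_ln ((1 + t) ^ n)) by (apply pow_lt; lra).
rewrite ln_pow by lra; apply exp_le, Rmult_le_compat_l; [apply pos_INR |].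
rewrite <- (ln_exp t) at 2; apply Rcomplements.ln_le; [lra | apply exp_ineq1_le].
Qed.

(* The difference is controlled by the same integral with one more factor [t]
   and half the rate, which scales exactly. *)
Lemma Claplace_rho_nlog_diff (n : nat) (e : C) :
  Cmod e <= / 8 -> exists K, 0 <= K /\ forall x, 2 * INR (n + 1) <= x -> 0 < x ->
  Cmod (Rcpow x (1 - e) * (Claplace (fun t => (1 + t) ^ n)%R rho e x - Cgamma e x)) <= K / x.
Proof.
intros He; set (p := Re e); set (q := Im e).
assert (Hp : Rabs p <= / 8) by (apply Rle_trans with (2 := He), re_le_Cmod).
assert (Hq : Rabs q <= / 8) by (apply Rle_trans with (2 := He), im_le_Cmod).
destruct (tempered_expcs nlog p q subln_nlog Hp) as [Gc Gs].
destruct (tempered_expcs rho p q subln_rho Hp) as [Rc Rs].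
destruct (tempered_expcs nlog p 0 subln_nlog Hp) as [Tc Ts].
assert (Tc1 := tempered_weight _ _ poly_growth_1 Tc).
assert (Tt := tempered_id_mult _ Tc1).
set (g := laplace (fun t => 1 * expcos nlog p 0 t)).
assert (Hg : 0 <= g 1).
{ apply Rle_trans with (1 := Rabs_pos (laplace (fun _ => 0) 1)).
  assert (T0 : tempered (fun _ => 0)).
  { apply (tempered_exp_lam _ 0); [intros; apply continuous_const | lra |].
    intros; rewrite Rabs_R0; lra. }
  apply (Iint_le (fun t => exp (- (1 * t)) * 0)
    (fun t => exp (- (1 * t)) * (1 * expcos nlog p 0 t))).
  - intros t Ht; rewrite Rmult_0_r, Rabs_R0; unfold expcos; rewrite Rmult_0_l, cos_0.
    assert (H1 := exp_pos (- (1 * t))); assert (H2 := exp_pos (p * nlog t)); nra.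
  - apply is_Iint_laplace; [exact T0 | lra].
  - apply is_Iint_laplace; [exact Tc1 | lra]. }
(* 1 - p comes from [laplace_id_power], and 2 and 2^(1-p) from evaluating at x / 2 instead of x;
   [g 1] is Gamma (1 - p). *)
set (D := (INR n + 3) * ((1 - p) * (2 * (exp ((1 - p) * ln 2) * g 1)))).
assert (Hpb := proj1 (Rcomplements.Rabs_le_between _ _) Hp).
assert (Hn := pos_INR n).
assert (HD : 0 <= D).
{ unfold D; assert (X := exp_pos ((1 - p) * ln 2)).
  repeat apply Rmult_le_pos; lra. }
exists (2 * D); split; [lra |]; intros x Hxn Hx.
assert (Hx2 : 0 < x / 2) by lra.
assert (HL : (INR n + 3) * laplace (fun t => t * (1 * expcos nlog p 0 t)) (x / 2)
  = exp (- ((1 - p) * ln x)) * (D / x)).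
{ assert (E1 := laplace_id_power p (x / 2) Hp Hx2).
  assert (E2 := laplace_power_scaling p (x / 2) Hp Hx2); fold g in E1, E2.
  assert (E3 : laplace (fun t => t * (1 * expcos nlog p 0 t)) (x / 2)
    = (1 - p) * g (x / 2) * (2 / x)) by (rewrite <- E1; field; lra).
  assert (E4 : g (x / 2) = exp (- ((1 - p) * ln (x / 2))) * g 1).
  { rewrite <- E2, <- Rmult_assoc, <- exp_plus, Rplus_opp_l, exp_0; ring. }
  rewrite E3, E4, ln_div by lra.
  replace (- ((1 - p) * (ln x - ln 2))) with (- ((1 - p) * ln x) + (1 - p) * ln 2) by ring.
  rewrite exp_plus; unfold D; field; lra. }
assert (Hcomp : forall f f', tempered f -> tempered f' ->
  (forall t, 0 < t -> Rabs (f t - f' t)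
    <= (INR n + 3) * (1 + t) ^ (n + 1) * (t * (1 * expcos nlog p 0 t))) ->
  Rabs (laplace f x - laplace f' x) <= exp (- ((1 - p) * ln x)) * (D / x)).
{ intros f f' Hf Hf' HB; rewrite <- HL.
  apply (Iint_le (fun t => exp (- (x * t)) * f t + -1 * (exp (- (x * t)) * f' t))
    (fun t => (INR n + 3) * (exp (- (x / 2 * t)) * (t * (1 * expcos nlog p 0 t))))).
  - intros t Ht; specialize (HB t Ht).
    replace (_ + _) with (exp (- (x * t)) * (f t - f' t)) by ring.
    rewrite Rabs_mult, (Rabs_pos_eq (exp _)) by apply Rlt_le, exp_pos.
    assert (X := exp_pos (- (x * t))).
    apply Rle_trans with (exp (- (x * t)) * (1 + t) ^ (n + 1)
      * ((INR n + 3) * (t * (1 * expcos nlog p 0 t)))).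
    + replace (_ * _ * (_ * (t * _))) with (exp (- (x * t)) *
        ((INR n + 3) * (1 + t) ^ (n + 1) * (t * (1 * expcos nlog p 0 t)))) by ring.
      apply Rmult_le_compat_l; lra.
    + replace ((INR n + 3) * (exp (- (x / 2 * t)) * (t * (1 * expcos nlog p 0 t))))
        with (exp (- (x / 2 * t)) * ((INR n + 3) * (t * (1 * expcos nlog p 0 t)))) by ring.
      apply Rmult_le_compat_r.
      * unfold expcos; rewrite Rmult_0_l, cos_0; assert (X2 := exp_pos (p * nlog t)).
        repeat apply Rmult_le_pos; lra.
      (* Here x >= 2 (n+1) enters: (1+t)^(n+1) <= exp ((n+1) t) uses up at most half of the rate
         x. *)
      * apply Rle_trans with (exp (- (x * t)) * exp (INR (n + 1) * t)).
        { apply Rmult_le_compat_l; [lra | apply pow_1p_le_exp; lra]. }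
        rewrite <- exp_plus; apply exp_le; nra.
  - replace (laplace f x - laplace f' x) with (laplace f x + -1 * laplace f' x) by ring.
    apply is_Iint_plus; [| apply is_Iint_scal]; apply is_Iint_laplace; assumption.
  - apply is_Iint_scal, is_Iint_laplace; assumption. }
assert (Hw := poly_growth_1p_pow n).
assert (H1 := Hcomp _ _ (tempered_weight _ _ Hw Rc) (tempered_weight _ _ poly_growth_1 Gc)
  (fun t Ht => proj1 (expcs_rho_nlog_bound n p q t Ht Hp Hq))).
assert (H2 := Hcomp _ _ (tempered_weight _ _ Hw Rs) (tempered_weight _ _ poly_growth_1 Gs)
  (fun t Ht => proj2 (expcs_rho_nlog_bound n p q t Ht Hp Hq))).
rewrite Cmod_mult, Cmod_Rcpow.
replace (Re (1 - e)) with (1 - p) by reflexivity.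
assert (HS := Cmod_le_sum (Claplace (fun t => (1 + t) ^ n)%R rho e x - Cgamma e x)).
apply Rle_trans with (exp ((1 - p) * ln x) * (2 * (exp (- ((1 - p) * ln x)) * (D / x)))).
- apply Rmult_le_compat_l; [apply Rlt_le, exp_pos |].
  apply Rle_trans with (1 := HS).
  rewrite <- (Rplus_diag (exp _ * _)); apply Rplus_le_compat; [exact H1 | exact H2].
- rewrite exp_Ropp; apply Req_le; field; split; [lra | apply Rgt_not_eq, exp_pos].
Qed.

(** For the asymptotics, x^(1-e) [Cgamma e x] is exactly the normalising constant, so the quotient
    differs from 1 only by the O(1/x) of [Claplace_rho_nlog_diff]. *)
Lemma is_tricomiU_Claplace (n : nat) (e : C) :
  Cmod e <= / 8 -> Cgamma e 1 <> 0%C ->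
  is_tricomiU (1 - e)%C (RtoC (INR n + 2))
    (fun x => Claplace (fun t => (1 + t) ^ n)%R rho e x / Cgamma e 1)%C.
Proof.
intros He Hg.
assert (Hp : Rabs (Re e) <= / 8) by (apply Rle_trans with (2 := He), re_le_Cmod).
assert (K := kummer_Claplace n e Hp).
set (N := Cgamma e 1) in *; set (I0 := Claplace (fun t => (1 + t) ^ n)%R rho e) in *.
split.
- eexists (fun x => / N * _)%C, (fun x => / N * _)%C; intros x Hx.
  destruct (K x Hx) as [K1 [K2 K3]]; split; [| split].
  + apply (is_Cderive_ext (fun x => / N * I0 x)%C _ x _ _) with (3 := is_Cderive_const_mult (/ N) _ _ _ K1).
    * intros; unfold Cdiv; ring.
    * reflexivity.
  + apply is_Cderive_const_mult, K2.
  + simpl; transitivity (/ N * 0)%C; [rewrite <- K3 | ring].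
    unfold Cdiv; ring.
- apply filterlim_C_p_infty; intros eps Heps.
  destruct (Claplace_rho_nlog_diff n e He) as [B [HB HD]].
  assert (HN : 0 < Cmod N) by (apply Cmod_gt_0, Hg).
  exists (Rmax (Rmax 0 (2 * INR (n + 1))) (B / (Cmod N * eps))); intros x Hx.
  assert (X1 := Rmax_l (Rmax 0 (2 * INR (n + 1))) (B / (Cmod N * eps))).
  assert (X2 := Rmax_r (Rmax 0 (2 * INR (n + 1))) (B / (Cmod N * eps))).
  assert (X3 := Rmax_l 0 (2 * INR (n + 1))); assert (X4 := Rmax_r 0 (2 * INR (n + 1))).
  assert (Hx0 : 0 < x) by lra; assert (Hxn : 2 * INR (n + 1) <= x) by lra.
  specialize (HD x Hxn Hx0); fold I0 in HD.
  replace (Rcpow x (1 - e) * (I0 x / N) - 1)%C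
    with (Rcpow x (1 - e) * (I0 x - Cgamma e x) / N)%C.
  + rewrite Cmod_div by exact Hg.
    apply Rle_lt_trans with (B / x / Cmod N).
    { apply Rmult_le_compat_r; [apply Rlt_le, Rinv_0_lt_compat, HN | exact HD]. }
    assert (Hlt : B / (Cmod N * eps) < x) by lra.
    apply (Rmult_lt_compat_l (Cmod N * eps)) in Hlt; [| nra].
    replace (Cmod N * eps * (B / (Cmod N * eps))) with B in Hlt by (field; lra).
    apply (Rmult_lt_reg_r (x * Cmod N)); [nra |].
    replace (B / x / Cmod N * (x * Cmod N)) with B by (field; lra); lra.
  + assert (E := Rcpow_Cgamma e x Hp Hx0); fold N in E.
    transitivity ((Rcpow x (1 - e) * I0 x - Rcpow x (1 - e) * Cgamma e x) / N)%C.
    * field; exact Hg.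
    * rewrite E; field; exact Hg.
Qed.

(** Kummer's transformation U(a-b+1, 2-b, x) = x^(b-1) U(a, b, x) for b = m + 1, verified on the two
    characterising properties. *)
Lemma is_tricomiU_kummer_transform (a : C) (m : nat) (u : R -> C) :
  is_tricomiU a (RtoC (INR m + 1)) u ->
  is_tricomiU (a - RtoC (INR m))%C (RtoC (1 - INR m)) (fun x => RtoC (x ^ m) * u x)%C.
Proof.
intros [[u1 [u2 Hu]] L].
set (M := RtoC (INR m)).
assert (Dm : forall x, 0 < x -> is_Cderive (fun t => RtoC (t ^ m)) x (M / RtoC x * RtoC (x ^ m))%C).
{ intros x Hx; unfold M; rewrite <- RtoC_div by lra; rewrite <- RtoC_mult; apply is_Cderive_RtoC.
  auto_derive; [trivial |]; destruct m as [| m]; [simpl; field; lra |].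
  simpl pred; simpl (x ^ S m); field; lra. }
split.
- exists (fun x => RtoC (x ^ m) * (u1 x + M * / RtoC x * u x))%C,
    (fun x => RtoC (x ^ m) * (u2 x + 2 * M / RtoC x * u1 x + M * (M - 1) / (RtoC x * RtoC x) * u x))%C.
  intros x Hx; destruct (Hu x Hx) as [U1 [U2 U3]]; assert (Hn := RtoC_neq_0 x Hx).
  assert (Di : is_Cderive (fun t => M * / RtoC t)%C x (M * - / (RtoC x * RtoC x))%C).
  { apply is_Cderive_const_mult.
    apply (is_derive_ext_loc (V := C_R_NormedModule) (fun t => RtoC (/ t))).
    - exists (mkposreal x Hx); intros t Ht; change (Rabs (t - x) < x) in Ht.
      apply Rabs_def2 in Ht; apply RtoC_inv; lra.
    - replace (- / (RtoC x * RtoC x))%C with (RtoC (- / (x * x))).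
      + apply is_Cderive_RtoC; auto_derive; [lra | field; lra].
      + rewrite RtoC_opp, RtoC_inv, RtoC_mult by nra; reflexivity. }
  split; [| split].
  + apply (is_Cderive_ext _ _ _ _ _ (fun t => eq_refl)) with (2 := is_Cderive_mult _ _ _ _ _ (Dm x Hx) U1).
    field; exact Hn.
  + apply (is_Cderive_ext _ _ _ _ _ (fun t => eq_refl)) with (2 := is_Cderive_mult _ _ _ _ _ (Dm x Hx)
      (is_Cderive_plus _ _ _ _ _ U2 (is_Cderive_mult _ _ _ _ _ Di U1))).
    field; exact Hn.
  + transitivity (RtoC (x ^ m) * (RtoC x * u2 x + (RtoC (INR m + 1) - RtoC x) * u1 x - a * u x))%C.
    * rewrite RtoC_minus, RtoC_plus; fold M; field; exact Hn.
    * rewrite U3; ring.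
- apply (filterlim_ext_loc (fun x => Rcpow x a * u x)%C); [| exact L].
  exists 0; intros x Hx; rewrite Cmult_assoc; f_equal.
  unfold Rcpow, M.
  replace (Im (a - RtoC (INR m))%C) with (Im a) by (unfold Im; simpl; ring).
  change (Re (a - RtoC (INR m))%C) with (Re a - INR m).
  replace (exp ((Re a - INR m) * ln x)) with (exp (Re a * ln x) / x ^ m).
  2: { replace ((Re a - INR m) * ln x) with (Re a * ln x + - (INR m * ln x)) by ring.
       rewrite exp_plus, exp_Ropp, <- ln_pow, exp_ln by (try lra; apply pow_lt; lra); reflexivity. }
  assert (Hxm : 0 < x ^ m) by (apply pow_lt; lra).
  unfold RtoC, Cmult; simpl; f_equal; field; lra.
Qed.

(** [epsilon] returns some function with the required properties: existence makes its specification
    available, and uniqueness identifies its values. *)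
Lemma tricomiU_eq (a : C) (b : R) (u : R -> C) (x : R) :
  is_tricomiU a (RtoC b) u -> 0 < x -> tricomiU a (RtoC b) x = u x.
Proof.
intros Hu Hx; apply (tricomi_unique a b); [| exact Hu | exact Hx].
unfold tricomiU; apply epsilon_spec; exists u; exact Hu.
Qed.

Lemma whittakerW_Claplace (n : nat) (x s : R) (e : C) :
  0 < x -> s = 1 \/ s = -1 -> Cmod e <= / 8 -> Cgamma e 1 <> 0%C ->
  whittakerW (RtoC (INR n / 2) + e)%C (RtoC (s * (INR n + 1) / 2)) x
  = (RtoC (exp (- x / 2) * exp ((INR n / 2 + 1) * ln x))
     * (Claplace (fun t => (1 + t) ^ n)%R rho e x / Cgamma e 1))%C.
Proof.
intros Hx Hs He Hg; unfold whittakerW.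
assert (HU := is_tricomiU_Claplace n e He Hg).
set (I := Claplace (fun t => (1 + t) ^ n)%R rho e) in *; set (N := Cgamma e 1) in *.
set (m := RtoC (s * (INR n + 1) / 2)).
assert (Em : (m + / 2)%C = RtoC (s * (INR n + 1) / 2 + / 2)).
{ unfold m; rewrite RtoC_plus, RtoC_inv by lra; reflexivity. }
rewrite Em, Rcpow_real.
destruct Hs as [-> | ->].
- replace (/ 2 + m - (RtoC (INR n / 2) + e))%C with (1 - e)%C.
  2: { unfold m; rewrite <- RtoC_inv by lra; destruct e as [p q].
       unfold RtoC, Cminus, Cplus, Copp; simpl; f_equal; field. }
  replace (1 + 2 * m)%C with (RtoC (INR n + 2)).
  2: { unfold m; rewrite <- RtoC_mult, <- RtoC_plus; f_equal; field. }
  rewrite (tricomiU_eq _ _ _ x HU Hx), <- RtoC_mult.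
  do 3 f_equal; f_equal; field.
(* For the minus sign the parameters are a = -n - e and b = -n. The factor x^(n+1) of Kummer's
   transformation compensates the prefactor x^(-n/2), and x^(n/2+1) results as for the plus sign. *)
- assert (HU' : is_tricomiU (1 - e - RtoC (INR (n + 1)))%C (RtoC (1 - INR (n + 1)))
    (fun x => RtoC (x ^ (n + 1)) * (I x / N))%C).
  { apply is_tricomiU_kummer_transform; rewrite plus_INR; simpl INR.
    replace (INR n + 1 + 1) with (INR n + 2) by ring; exact HU. }
  replace (/ 2 + m - (RtoC (INR n / 2) + e))%C with (1 - e - RtoC (INR (n + 1)))%C.
  2: { unfold m; rewrite <- RtoC_inv by lra; rewrite plus_INR; destruct e as [p q].
       unfold RtoC, Cminus, Cplus, Copp; simpl; f_equal; field. }
  replace (1 + 2 * m)%C with (RtoC (1 - INR (n + 1))).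
  2: { unfold m; rewrite <- RtoC_mult, <- RtoC_plus; f_equal; rewrite plus_INR; simpl INR; field. }
  rewrite (tricomiU_eq _ _ _ x HU' Hx), Cmult_assoc, <- !RtoC_mult, Rmult_assoc.
  do 3 f_equal.
  rewrite <- (exp_ln (x ^ (n + 1))) by (apply pow_lt; exact Hx).
  rewrite ln_pow by exact Hx; rewrite <- exp_plus, plus_INR; simpl INR; f_equal; field.
Qed.

(** * The derivative with respect to kappa *)

Lemma is_derive_C_quadratic (f : C -> C) (z l : C) (K d : R) :
  0 < d -> 0 <= K ->
  (forall e, Cmod e < d -> Cmod (f (z + e)%C - f z - e * l) <= K * Cmod e ^ 2) ->
  is_derive (K := C_AbsRing) (V := C_NormedModule) f z l.
Proof.
intros Hd HK H; split.
- apply (is_linear_scal_l (K := C_AbsRing) (V := C_NormedModule)).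
- intros y Hy eps.
  assert (Hy' : y = z).
  { symmetry.
    apply (is_filter_lim_locally_unique (K := C_AbsRing) (V := AbsRing_NormedModule C_AbsRing)), Hy. }
  subst y; clear Hy.
  assert (He := cond_pos eps).
  assert (Hr : 0 < Rmin d (eps / (K + 1))) by (apply Rmin_pos; [exact Hd | apply Rdiv_lt_0_compat; lra]).
  exists (mkposreal _ Hr); refine (fun (y : C) Hy => _).
  change (Cmod (y - z) < Rmin d (eps / (K + 1))) in Hy.
  change (Cmod (f y - f z - (y - z) * l) <= eps * Cmod (y - z)).
  assert (H1 : Cmod (y - z) < d) by (apply Rlt_le_trans with (1 := Hy), Rmin_l).
  assert (H2 : Cmod (y - z) < eps / (K + 1)) by (apply Rlt_le_trans with (1 := Hy), Rmin_r).
  specialize (H (y - z)%C H1); replace (z + (y - z))%C with y in H by ring.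
  apply Rle_trans with (1 := H).
  assert (M := Cmod_ge_0 (y - z)).
  apply (Rmult_lt_compat_l (K + 1)) in H2; [| lra].
  replace ((K + 1) * (eps / (K + 1))) with (pos eps) in H2 by (field; lra).
  simpl; nra.
Qed.

(** The quotient rule at a point where the denominator is 1, in a quantitative form that also
    supplies a disc on which the denominator does not vanish. *)
Lemma quotient_expansion (I N : C -> C) (I0 I1 g : C) (K1 K2 d : R) :
  0 < d -> 0 <= K1 -> 0 <= K2 ->
  (forall e, Cmod e <= d -> Cmod (I e - I0 - e * I1) <= K1 * Cmod e ^ 2) ->
  (forall e, Cmod e <= d -> Cmod (N e - 1 - e * g) <= K2 * Cmod e ^ 2) ->
  exists K d', 0 <= K /\ 0 < d' /\ d' <= d /\ forall e, Cmod e < d' -> N e <> 0%C /\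
    Cmod (I e / N e - I0 - e * (I1 - g * I0)) <= K * Cmod e ^ 2.
Proof.
intros Hd HK1 HK2 HI HN.
set (D := (I1 - g * I0)%C).
set (K := 2 * (K1 + K2 * (Cmod I0 + Cmod D) + Cmod g * Cmod D)).
assert (M0 := Cmod_ge_0 I0); assert (MD := Cmod_ge_0 D); assert (Mg := Cmod_ge_0 g).
(* This radius, with |e| <= 1, gives |N e - 1| <= |e| (|g| + K2) < 1/2. Hence |N e| >= 1/2, which
   accounts for the factor 2 in [K]. *)
assert (Hq : 0 < / (2 * (Cmod g + K2 + 1))) by (apply Rinv_0_lt_compat; lra).
exists K, (Rmin d (Rmin 1 (/ (2 * (Cmod g + K2 + 1))))); split; [| split; [| split]].
- unfold K; assert (0 <= K2 * (Cmod I0 + Cmod D)) by nra; assert (0 <= Cmod g * Cmod D) by nra; lra.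
- repeat apply Rmin_pos; lra.
- apply Rmin_l.
- intros e He.
  assert (T1 := Rmin_l d (Rmin 1 (/ (2 * (Cmod g + K2 + 1))))).
  assert (T2 := Rmin_r d (Rmin 1 (/ (2 * (Cmod g + K2 + 1))))).
  assert (T3 := Rmin_l 1 (/ (2 * (Cmod g + K2 + 1)))).
  assert (T4 := Rmin_r 1 (/ (2 * (Cmod g + K2 + 1)))).
  assert (Hed : Cmod e <= d) by lra; assert (He1 : Cmod e <= 1) by lra.
  assert (He2 : Cmod e < / (2 * (Cmod g + K2 + 1))) by lra.
  specialize (HI e Hed); specialize (HN e Hed).
  assert (Me := Cmod_ge_0 e).
  set (R1 := (I e - I0 - e * I1)%C) in *; set (R2 := (N e - 1 - e * g)%C) in *.
  assert (HN2 : / 2 <= Cmod (N e)).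
  { assert (T := Cmod_triangle (N e) (- (R2 + e * g))).
    replace (N e + - (R2 + e * g))%C with (RtoC 1) in T by (unfold R2; ring).
    rewrite Cmod_opp, Cmod_1 in T.
    assert (T' := Cmod_triangle R2 (e * g)); rewrite Cmod_mult in T'.
    apply (Rmult_lt_compat_l (2 * (Cmod g + K2 + 1))) in He2; [| lra].
    rewrite Rinv_r in He2 by lra.
    assert (K2 * Cmod e ^ 2 <= K2 * Cmod e) by (apply Rmult_le_compat_l; nra).
    nra. }
  assert (HN0 : N e <> 0%C) by (intros E; rewrite E, Cmod_0 in HN2; lra).
  split; [exact HN0 |].
  (* By the choice of [D], the terms of order 0 and 1 in I e - (I0 + e D) N e cancel; the two
     remainders and e^2 g D are what is left. *)
  replace (I e / N e - I0 - e * D)%C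
    with ((R1 + - (R2 * (I0 + e * D)) + - (e * e * (g * D))) / N e)%C
    by (unfold R1, R2, D; field; exact HN0).
  rewrite Cmod_div by exact HN0.
  assert (HNp : 0 < Cmod (N e)) by lra.
  apply Rle_div_l; [exact HNp |].
  apply Rle_trans with (1 := Cmod_triangle _ _).
  assert (A1 := Cmod_triangle R1 (- (R2 * (I0 + e * D)))).
  assert (A2 := Cmod_triangle I0 (e * D)).
  rewrite !Cmod_opp, !Cmod_mult in *.
  assert (A3 : Cmod R2 * Cmod (I0 + e * D) <= K2 * Cmod e ^ 2 * (Cmod I0 + Cmod D)).
  { apply Rmult_le_compat; try apply Cmod_ge_0; [exact HN | nra]. }
  apply Rle_trans with (K / 2 * Cmod e ^ 2).
  + unfold K; nra.
  + assert (HKe : 0 <= K * Cmod e ^ 2).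
    { unfold K; apply Rmult_le_pos; [| nra].
      assert (0 <= K2 * (Cmod I0 + Cmod D)) by nra; assert (0 <= Cmod g * Cmod D) by nra; lra. }
    nra.
Qed.

Lemma Claplace_expansion (w th : R -> R) (x : R) :
  poly_growth w -> subln th -> 0 < x ->
  exists K, 0 <= K /\ forall e, Cmod e <= / 8 ->
    Cmod (Claplace w th e x - RtoC (laplace w x) - e * RtoC (laplace (fun t => w t * th t)%R x))
    <= K * Cmod e ^ 2.
Proof.
intros Hw Hth Hx; destruct (laplace_expansion w th x Hw Hth Hx) as [K [HK H]].
exists (2 * K); split; [lra |]; intros e He.
destruct (H (Re e) (Im e) (Cmod e) (re_le_Cmod e) (im_le_Cmod e) He) as [H1 H2].
apply Rle_trans with (1 := Cmod_le_sum _).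
set (L := laplace (fun t => w t * th t)%R x) in *.
replace (Re (Claplace w th e x - RtoC (laplace w x) - e * RtoC L)) with
  (laplace (fun t => w t * expcos th (Re e) (Im e) t) x - laplace w x - Re e * L)
  by (unfold Claplace, Re, Im; simpl; ring).
replace (Im (Claplace w th e x - RtoC (laplace w x) - e * RtoC L)) with
  (laplace (fun t => w t * expsin th (Re e) (Im e) t) x - Im e * L)
  by (unfold Claplace, Re, Im; simpl; ring).
lra.
Qed.

Lemma laplace_1 (x : R) : 0 < x -> laplace (fun _ => 1) x = / x.
Proof.
intros Hx.
assert (T0 : tempered (fun _ => 0)).
{ apply (tempered_exp_lam _ 0); [intros; apply continuous_const | lra |].
  intros; rewrite Rabs_R0; lra. }
assert (E := laplace_derivative (fun _ => 1) (fun _ => 0) 1 x tempered_1 T0).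
assert (E0 : laplace (fun _ => 0) x = 0).
{ transitivity (0 * laplace (fun _ => 1) x); [| ring].
  rewrite <- laplace_scal by (try assumption; apply tempered_1).
  apply laplace_ext; try assumption; [apply tempered_scal, tempered_1 | intros; ring]. }
rewrite E0 in E.
assert (E' : 0 = x * laplace (fun _ => 1) x - 1).
{ apply E; [| apply filterlim_const | exact Hx].
  intros t Ht; apply (is_derive_const (V := R_NormedModule)). }
apply (Rmult_eq_reg_l x); [rewrite Rinv_r by lra; lra | lra].
Qed.

(* [laplace (fun t => - ln t) 1] is Euler's constant. *)
Lemma is_derive_whittakerW (n : nat) (x s : R) :
  0 < x -> s = 1 \/ s = -1 ->
  is_derive (K := C_AbsRing) (V := C_NormedModule)
    (fun kappa : C => whittakerW kappa (RtoC (s * (INR n + 1) / 2)) x)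
    (RtoC (INR n / 2))
    (RtoC (exp (- x / 2) * exp ((INR n / 2 + 1) * ln x) *
      (laplace (fun t => (1 + t) ^ n * rho t) x
       - laplace (fun t => 1 * nlog t) 1 * laplace (fun t => (1 + t) ^ n) x))).
Proof.
intros Hx Hs.
destruct (Claplace_expansion _ _ x (poly_growth_1p_pow n) subln_rho Hx) as [K1 [HK1 H1]].
destruct (Claplace_expansion _ _ 1 poly_growth_1 subln_nlog Rlt_0_1) as [K2 [HK2 H2]].
cbv beta in H2; rewrite (laplace_1 1 Rlt_0_1), Rinv_1 in H2.
destruct (quotient_expansion (fun e => Claplace (fun t => (1 + t) ^ n)%R rho e x)
  (fun e => Cgamma e 1) (RtoC (laplace (fun t => (1 + t) ^ n) x))
  (RtoC (laplace (fun t => (1 + t) ^ n * rho t) x)) (RtoC (laplace (fun t => 1 * nlog t) 1))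
  K1 K2 (/ 8) ltac:(lra) HK1 HK2 H1 H2)
  as [K [d [HK [Hd [Hd8 H]]]]].
set (c := exp (- x / 2) * exp ((INR n / 2 + 1) * ln x)).
assert (Hc : 0 < c) by (apply Rmult_lt_0_compat; apply exp_pos).
set (I0 := laplace (fun t => (1 + t) ^ n) x) in *.
set (I1 := laplace (fun t => (1 + t) ^ n * rho t) x) in *.
set (g := laplace (fun t => 1 * nlog t) 1) in *.
set (W := fun kappa : C => whittakerW kappa (RtoC (s * (INR n + 1) / 2)) x).
assert (HW : forall e, Cmod e < d -> W (RtoC (INR n / 2) + e)%C
  = (RtoC c * (Claplace (fun t => (1 + t) ^ n)%R rho e x / Cgamma e 1))%C).
{ intros e He; apply whittakerW_Claplace; try assumption; [lra | apply (H e He)]. }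
(* The quadratic bound at e = 0 already contains the value at the centre. *)
assert (H0 : (Claplace (fun t => (1 + t) ^ n)%R rho 0%C x / Cgamma 0 1 = RtoC I0)%C).
{ assert (Z : Cmod 0 < d) by (rewrite Cmod_0; exact Hd).
  destruct (H 0%C Z) as [_ H3]; rewrite Cmod_0 in H3.
  apply Ceq_minus, Cmod_eq_0, Rle_antisym; [| apply Cmod_ge_0].
  match type of H3 with Cmod ?a <= _ => match goal with |- Cmod ?b <= _ => replace b with a by ring end end.
  apply Rle_trans with (1 := H3); simpl; lra. }
assert (HW0 : W (RtoC (INR n / 2)) = (RtoC c * RtoC I0)%C).
{ rewrite <- H0, <- HW by (rewrite Cmod_0; exact Hd); f_equal; ring. }
apply (is_derive_C_quadratic W _ _ (c * K) d Hd); [nra |].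
intros e He; rewrite HW, HW0 by exact He; destruct (H e He) as [_ H3].
rewrite RtoC_mult, RtoC_minus, RtoC_mult.
replace (_ - _ - _)%C with (RtoC c * (Claplace (fun t => (1 + t) ^ n)%R rho e x / Cgamma e 1
  - RtoC I0 - e * (RtoC I1 - RtoC g * RtoC I0)))%C by ring.
rewrite Cmod_mult, Cmod_R, Rabs_pos_eq, Rmult_assoc by lra.
apply Rmult_le_compat_l; [lra | exact H3].
Qed.

(** * Evaluation of the Laplace transforms *)

Lemma poly_growth_pow (k : nat) : poly_growth (fun t => t ^ k).
Proof.
split.
- intros t Ht; apply (ex_derive_continuous (V := R_NormedModule)); auto_derive; trivial.
- exists 1, k; split; [lra |]; intros t Ht; rewrite Rabs_pos_eq by (apply pow_le; lra).
  rewrite Rmult_1_l; apply pow_incr; lra.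
Qed.

Lemma tempered_pow_mult (k : nat) (h : R -> R) :
  tempered h -> tempered (fun t => t ^ k * h t).
Proof. apply tempered_weight, poly_growth_pow. Qed.

Lemma tempered_ln_1p : tempered (fun t => ln (1 + t)).
Proof.
apply tempered_subln; split; intros t Ht; [apply continuous_ln_1p, Ht |].
assert (H := ln_le_ln_1p t Ht); assert (H1 := ln_1p_pos t Ht).
unfold lam; rewrite Rabs_pos_eq; lra.
Qed.

Lemma tempered_inv_1p : tempered (fun t => / (1 + t)).
Proof.
apply (tempered_exp_lam _ 1).
- intros t Ht; apply (ex_derive_continuous (V := R_NormedModule)); auto_derive; lra.
- lra.
- intros t Ht; assert (H := lam_pos t Ht).
  assert (H1 : / (1 + t) <= 1) by (rewrite <- Rinv_1; apply Rinv_le_contravar; lra).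
  assert (H2 : 0 < / (1 + t)) by (apply Rinv_0_lt_compat; lra).
  assert (H3 : 1 <= exp (lam t / 2)) by (rewrite <- exp_0; apply exp_le; lra).
  rewrite Rabs_pos_eq; lra.
Qed.

(** Integrates the derivative of t^(k+1) h. Writing h' as h1 / t keeps the power t^k in front of
    both terms; the lemma is used for h = 1, ln t and ln (1+t). *)
Lemma laplace_pow_rec (k : nat) (h h1 : R -> R) (x : R) :
  tempered h -> tempered h1 -> (forall t, 0 < t -> is_derive h t (h1 t / t)) -> 0 < x ->
  INR (S k) * laplace (fun t => t ^ k * h t) x + laplace (fun t => t ^ k * h1 t) x
  = x * laplace (fun t => t ^ S k * h t) x.
Proof.
intros Hh Hh1 Hd Hx.
assert (T := tempered_pow_mult k h Hh); assert (T1 := tempered_pow_mult k h1 Hh1).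
assert (Ts := tempered_scal (INR (S k)) _ T).
rewrite <- laplace_scal, <- laplace_plus by assumption.
rewrite (laplace_derivative_id_mult (fun t => t ^ k * h t)); try assumption.
- f_equal; symmetry; apply laplace_ext; [apply tempered_id_mult, T | exact Hx |].
  intros t Ht; simpl; ring.
- apply tempered_plus; assumption.
- intros t Ht; apply (is_derive_ext (fun t => t ^ S k * h t)); [intros; simpl; ring |].
  evar_last.
  + apply (is_derive_mult (K := R_AbsRing) (fun t => t ^ S k) h); [| apply Hd, Ht | apply Rmult_comm].
    auto_derive; [trivial | reflexivity].
  + unfold plus, mult; simpl pred; simpl pow; cbn [AbsRing.Ring Ring.AbelianMonoid]; simpl; field; lra.
Qed.

Lemma laplace_pow (k : nat) (x : R) :
  0 < x -> laplace (fun t => t ^ k * 1) x = INR (fact k) / x ^ S k.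
Proof.
intros Hx; induction k as [| k IH].
- rewrite (laplace_ext (fun _ => 1)); [| apply tempered_1 | exact Hx | intros; simpl; ring].
  rewrite laplace_1 by exact Hx; simpl; field; lra.
- assert (E := laplace_pow_rec k (fun _ => 1) (fun _ => 0 * 1) x tempered_1
    (tempered_scal 0 _ tempered_1)). cbv beta in E.
  rewrite IH in E.
  rewrite (laplace_ext (fun t => 0 * (t ^ k * 1)) (fun t => t ^ k * (0 * 1))) in E;
    [| apply tempered_scal, tempered_pow_mult, tempered_1 | exact Hx | intros; ring].
  rewrite (laplace_scal 0 (fun t => t ^ k * 1)) in E by (try assumption; apply tempered_pow_mult, tempered_1).
  assert (E' : INR (S k) * (INR (fact k) / x ^ S k) + 0 * laplace (fun t => t ^ k * 1) x
    = x * laplace (fun t => t ^ S k * 1) x).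
  { apply E; [| exact Hx].
    intros t Ht; evar_last; [apply (is_derive_const (V := R_NormedModule)) | unfold zero; simpl; field; lra]. }
  apply (Rmult_eq_reg_l x); [| lra]; rewrite <- E'.
  rewrite fact_simpl, mult_INR; simpl pow; field.
  split; [apply pow_nonzero; lra | lra].
Qed.

(** * Transforms of powers times logarithms *)

Lemma harmonic_S (k : nat) : harmonic (S k) = harmonic k + / INR (S k).
Proof. unfold harmonic; rewrite sum_n_Sm by lia; reflexivity. Qed.

Lemma tempered_ln : tempered ln.
Proof.
assert (H := tempered_scal (-1) _ (tempered_subln _ subln_nlog)).
destruct H as [_ B]; split; [apply continuous_ln |].
destruct B as [D [m [HD B]]]; exists D, m; split; [exact HD |]; intros t Ht.
specialize (B t Ht); unfold nlog in B; replace (-1 * - ln t) with (ln t) in B by ring; exact B.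
Qed.

Lemma is_derive_ln_id (t : R) : 0 < t -> is_derive ln t (1 / t).
Proof. intros Ht; auto_derive; [exact Ht | field; lra]. Qed.

(** By the recursion with k = 0, y [laplace ln y] + ln y has derivative 0; its value at 1 is minus
    Euler's constant. *)
Lemma laplace_ln (x : R) :
  0 < x -> x * laplace ln x = - laplace (fun t => 1 * nlog t) 1 - ln x.
Proof.
intros Hx.
assert (E : forall y, 0 < y -> y * laplace ln y + ln y = 1 * laplace ln 1 + ln 1).
{ assert (D : forall y, 0 < y -> is_derive (fun y => y * laplace ln y + ln y) y 0).
  { intros y Hy.
    assert (E := laplace_pow_rec 0 ln (fun _ => 1) y tempered_ln tempered_1 is_derive_ln_id Hy). cbv beta in E.
    rewrite laplace_pow in E by exact Hy.
    rewrite (laplace_ext ln (fun t => t ^ 0 * ln t)) in E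
      by (try assumption; try apply tempered_ln; intros; simpl; ring).
    rewrite (laplace_ext (fun t => t * ln t) (fun t => t ^ 1 * ln t)) in E
      by (try assumption; try apply tempered_id_mult, tempered_ln; intros; simpl; ring).
    evar_last.
    - apply (is_derive_plus (V := R_NormedModule) (fun y => y * laplace ln y) ln).
      + apply (is_derive_mult (K := R_AbsRing) (fun y => y) (laplace ln));
          [apply is_derive_id | apply is_derive_laplace; [apply tempered_ln | exact Hy] | apply Rmult_comm].
      + apply is_derive_ln_id, Hy.
    - unfold plus, mult, one; simpl; simpl in E.
      replace (y * - laplace (fun t => t * ln t) y) with (- (y * laplace (fun t => t * ln t) y)) by ring.
      rewrite <- E; field; lra. }
  intros y Hy.
  destruct (Rtotal_order y 1) as [H | [-> | H]]; [| reflexivity | symmetry];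
    apply (eq_is_derive (V := R_NormedModule) (fun y => y * laplace ln y + ln y));
    try assumption; intros t Ht; apply D; lra. }
specialize (E x Hx); rewrite ln_1 in E.
assert (E1 : laplace (fun t => 1 * nlog t) 1 = - laplace ln 1).
{ transitivity (-1 * laplace ln 1); [| ring].
  rewrite <- laplace_scal by (try lra; apply tempered_ln).
  apply laplace_ext; [apply tempered_scal, tempered_ln | lra | intros; unfold nlog; ring]. }
rewrite E1; lra.
Qed.

(** After division by k! / x^(k+1), the transform of t^k, the recursion merely adds 1/(k+1) at each
    step. This is where the harmonic numbers come from. *)
Lemma laplace_pow_ln (k : nat) (x : R) :
  0 < x -> x ^ S k / INR (fact k) * laplace (fun t => t ^ k * ln t) x
  = harmonic k - laplace (fun t => 1 * nlog t) 1 - ln x.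
Proof.
intros Hx; induction k as [| k IH].
- rewrite (laplace_ext ln) by (try assumption; try apply tempered_ln; intros; simpl; ring).
  assert (E := laplace_ln x Hx); unfold harmonic; rewrite sum_n_m_zero by lia.
  unfold zero; simpl; lra.
- assert (E := laplace_pow_rec k ln (fun _ => 1) x tempered_ln tempered_1 is_derive_ln_id Hx). cbv beta in E.
  rewrite laplace_pow in E by exact Hx.
  rewrite harmonic_S.
  assert (Hf : INR (fact k) <> 0) by apply INR_fact_neq_0.
  assert (HS : INR (S k) <> 0) by (apply not_0_INR; lia).
  assert (Hp : x ^ k <> 0) by (apply pow_nonzero; lra).
  transitivity (x ^ S k / (INR (S k) * INR (fact k)) * (x * laplace (fun t => t ^ S k * ln t) x)).
  + rewrite fact_simpl, mult_INR; simpl (x ^ S (S k)); simpl (x ^ S k); field; auto.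
  + rewrite <- E.
    transitivity (x ^ S k / INR (fact k) * laplace (fun t => t ^ k * ln t) x + / INR (S k)).
    * simpl (x ^ S k); field; repeat split; try assumption; lra.
    * rewrite IH; ring.
Qed.

(** This is k! e^x Gamma(-k, x), and e^x E_1(x) for k = 0, as shown below. *)
Definition laplace_pow_over_1p (k : nat) (x : R) : R := laplace (fun t => t ^ k * / (1 + t)) x.

Lemma laplace_pow_over_1p_rec (k : nat) (x : R) :
  0 < x -> laplace_pow_over_1p k x + laplace_pow_over_1p (S k) x = INR (fact k) / x ^ S k.
Proof.
intros Hx; rewrite <- laplace_pow by exact Hx; unfold laplace_pow_over_1p.
assert (T := tempered_inv_1p).
rewrite <- laplace_plus by (try assumption; apply tempered_pow_mult, T).
symmetry; apply laplace_ext; [| exact Hx |].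
- apply tempered_plus; apply tempered_pow_mult, T.
- intros t Ht; simpl; field; lra.
Qed.

Lemma laplace_ln_1p_0 (x : R) : 0 < x -> x * laplace (fun t => ln (1 + t)) x = laplace_pow_over_1p 0 x.
Proof.
intros Hx; unfold laplace_pow_over_1p.
rewrite (laplace_ext (fun t => / (1 + t)) (fun t => t ^ 0 * / (1 + t)))
  by (try assumption; try apply tempered_inv_1p; intros; simpl; ring).
rewrite (laplace_derivative (fun t => ln (1 + t)) (fun t => / (1 + t)) 0); try assumption.
- ring.
- apply tempered_ln_1p.
- apply tempered_inv_1p.
- intros t Ht; auto_derive; [lra | field; lra].
- apply (filterlim_filter_le_1 (F := locally 0)); [apply filter_le_within |].
  assert (C : continuous (fun t => ln (1 + t)) 0).
  { apply (ex_derive_continuous (V := R_NormedModule)); auto_derive; lra. }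
  unfold continuous in C; rewrite Rplus_0_r, ln_1 in C; exact C.
Qed.

Lemma laplace_pow_ln_1p_S (k : nat) (x : R) :
  0 < x -> x ^ S (S k) / INR (fact (S k)) * laplace (fun t => t ^ S k * ln (1 + t)) x
  = x ^ S k / INR (fact k) * laplace (fun t => t ^ k * ln (1 + t)) x
    + x ^ S k / INR (fact (S k)) * laplace_pow_over_1p (S k) x.
Proof.
intros Hx.
assert (Ti := tempered_id_mult _ tempered_inv_1p).
assert (E := laplace_pow_rec k (fun t => ln (1 + t)) (fun t => t * / (1 + t)) x
  tempered_ln_1p Ti). cbv beta in E.
rewrite (laplace_ext (fun t => t ^ S k * / (1 + t)) (fun t => t ^ k * (t * / (1 + t)))) in E.
2: apply tempered_pow_mult, tempered_inv_1p.
2: exact Hx.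
2: { intros; simpl; ring. }
fold (laplace_pow_over_1p (S k) x) in E.
assert (E' : INR (S k) * laplace (fun t => t ^ k * ln (1 + t)) x + laplace_pow_over_1p (S k) x
  = x * laplace (fun t => t ^ S k * ln (1 + t)) x).
{ apply E; [| exact Hx]; intros t Ht; auto_derive; [lra | field; lra]. }
assert (Hf : INR (fact k) <> 0) by apply INR_fact_neq_0.
assert (HS : INR (S k) <> 0) by (apply not_0_INR; lia).
transitivity (x ^ S k / (INR (S k) * INR (fact k)) * (x * laplace (fun t => t ^ S k * ln (1 + t)) x)).
- rewrite fact_simpl, mult_INR; simpl (x ^ S (S k)); simpl (x ^ S k); field; auto.
- rewrite <- E', fact_simpl, mult_INR; field; auto.
Qed.

(** * Incomplete gamma functions as Laplace transforms *)

Lemma laplace_decay (f : R -> R) (m : nat) :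
  tempered f ->
  filterlim (fun x => x ^ m * exp (- x) * laplace f x) (Rbar_locally p_infty) (locally 0).
Proof.
intros Hf.
destruct (dominated_laplace f 1 Hf Rlt_0_1) as [_ [K HK]].
destruct (exp_poly_bound (S m) 1 Rlt_0_1) as [D [HD HB]].
apply filterlim_locally; intros eps; assert (He := cond_pos eps).
exists (Rmax 1 (D * Rabs K / eps)); intros x Hx.
assert (X1 := Rmax_l 1 (D * Rabs K / eps)); assert (X2 := Rmax_r 1 (D * Rabs K / eps)).
change (Rabs (x ^ m * exp (- x) * laplace f x - 0) < eps); rewrite Rminus_0_r.
(* For x >= 1 the domination at rate 1 applies, so the transform stays bounded and exp (-x) x^m
   decides. *)
assert (HL : Rabs (laplace f x) <= Rabs K).
{ apply (is_Iint_bound (fun t => exp (- (x * t)) * f t)); [| apply is_Iint_laplace; [exact Hf | lra]].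
  intros t Ht; apply Rle_trans with (Rabs (exp (- (1 * t)) * f t)).
  - rewrite !Rabs_mult, !(Rabs_pos_eq (exp _)) by apply Rlt_le, exp_pos.
    apply Rmult_le_compat_r; [apply Rabs_pos | apply exp_le; nra].
  - apply Rle_trans with (1 := HK t Ht), Rmult_le_compat_r; [apply Rlt_le, majorant_pos, Ht | apply Rle_abs]. }
assert (Hx0 : 0 <= x) by lra; specialize (HB x Hx0); rewrite Rmult_1_l in HB.
assert (Hp : 0 < x ^ m) by (apply pow_lt; lra); assert (Hexp := exp_pos (- x)).
rewrite !Rabs_mult, (Rabs_pos_eq (exp _)), (Rabs_pos_eq (x ^ m)) by lra.
assert (HE : x ^ m * exp (- x) * x <= D).
{ apply Rle_trans with (2 := HB).
  replace (x ^ m * exp (- x) * x) with (exp (- x) * x ^ S m) by (simpl; ring).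
  apply Rmult_le_compat_l; [lra | apply pow_incr; lra]. }
assert (HKp := Rabs_pos K).
apply Rmult_lt_reg_r with x; [lra |].
apply Rle_lt_trans with (D * Rabs K).
- replace (x ^ m * exp (- x) * Rabs (laplace f x) * x)
    with ((x ^ m * exp (- x) * x) * Rabs (laplace f x)) by ring.
  apply Rmult_le_compat; try assumption; [| apply Rabs_pos].
  repeat apply Rmult_le_pos; lra.
- assert (Hlt : D * Rabs K / eps < x) by lra.
  apply (Rmult_lt_compat_l eps) in Hlt; [| exact He].
  replace (eps * (D * Rabs K / eps)) with (D * Rabs K) in Hlt by (field; lra); exact Hlt.
Qed.

(** A primitive of -f that vanishes at infinity is the tail integral of f. The second function [g]
    allows the integrand to be given in another form, such as with [powerRZ]. *)
Lemma RInt_gen_tail (F f g : R -> R) (x : R) :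
  0 < x -> (forall t, 0 < t -> is_derive F t (- f t)) ->
  (forall t, 0 < t -> continuous f t) -> (forall t, 0 < t -> f t = g t) ->
  filterlim F (Rbar_locally p_infty) (locally 0) ->
  RInt_gen g (at_point x) (Rbar_locally p_infty) = F x.
Proof.
intros Hx HF Cf E L.
apply (is_RInt_gen_unique (V := R_CompleteNormedModule)).
apply (is_RInt_gen_ext (V := R_NormedModule) f).
- exists (fun a => a = x) (fun b => x < b); [reflexivity | apply p_infty_gt |].
  intros a b -> Hb t; simpl; rewrite Rmin_left by lra; intros Ht; apply E; lra.
- replace (F x) with (- 0 - (- F x)) by ring.
  apply (is_RInt_gen_primitive (at_point x) (Rbar_locally p_infty) (fun t => - F t)).
  + exact Hx.
  + apply p_infty_gt.
  + intros t Ht; replace (f t) with (- - f t) by ring.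
    apply (is_derive_opp (V := R_NormedModule)), HF, Ht.
  + exact Cf.
  + intros P HP; apply (locally_singleton _ _ HP).
  + apply filterlim_comp with (1 := L).
    apply (filterlim_opp (V := R_NormedModule) 0).
Qed.

(** Differentiating exp (-x) times the transform produces the sum of the transforms of index k and k
    + 1, up to sign and the exponential; the factor 1 + t cancels in that sum and only k! / x^(k+1)
    remains. *)
Lemma RInt_gen_tail_laplace_pow_over_1p (k : nat) (g : R -> R) (x : R) :
  0 < x -> (forall t, 0 < t -> / t ^ S k * exp (- t) = g t) ->
  RInt_gen g (at_point x) (Rbar_locally p_infty) = exp (- x) * laplace_pow_over_1p k x / INR (fact k).
Proof.
intros Hx Hg.
assert (Hf : INR (fact k) <> 0) by apply INR_fact_neq_0.
assert (T := tempered_pow_mult k _ tempered_inv_1p).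
apply (RInt_gen_tail (fun x => exp (- x) * laplace_pow_over_1p k x / INR (fact k))
  (fun t => / t ^ S k * exp (- t))); try exact Hx.
- intros t Ht.
  assert (HB := laplace_pow_over_1p_rec k t Ht).
  assert (D : is_derive (laplace_pow_over_1p k) t (- laplace_pow_over_1p (S k) t)).
  { replace (laplace_pow_over_1p (S k) t) with (laplace (fun u => u * (u ^ k * / (1 + u))) t).
    - apply is_derive_laplace; assumption.
    - symmetry; apply laplace_ext; [apply tempered_id_mult, T | exact Ht | intros; simpl; ring]. }
  apply (is_derive_ext (fun t => (/ INR (fact k)) * (exp (- t) * laplace_pow_over_1p k t))).
  { intros; simpl; field; exact Hf. }
  evar_last.
  + apply (is_derive_scal (fun t => exp (- t) * laplace_pow_over_1p k t)).
    apply (is_derive_mult (K := R_AbsRing) (fun t => exp (- t)) (laplace_pow_over_1p k));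
      [| exact D | apply Rmult_comm].
    auto_derive; [trivial | reflexivity].
  + unfold plus, mult; simpl plus; cbn [AbsRing.Ring Ring.AbelianMonoid].
    transitivity (- (/ INR (fact k) * exp (- t) * (laplace_pow_over_1p k t + laplace_pow_over_1p (S k) t))).
    * simpl; ring.
    * rewrite HB; field; split; [apply pow_nonzero; lra | exact Hf].
- intros t Ht; apply (ex_derive_continuous (V := R_NormedModule)); auto_derive.
  apply (pow_nonzero t (S k)); lra.
- exact Hg.
- apply (filterlim_ext (fun x => / INR (fact k) * (x ^ 0 * exp (- x) * laplace_pow_over_1p k x))).
  { intros; simpl; field; exact Hf. }
  rewrite <- (Rmult_0_r (/ INR (fact k))).
  apply filterlim_comp with (1 := laplace_decay _ 0 T).
  apply (filterlim_scal_r (V := R_NormedModule)).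
Qed.

Lemma upper_gamma_laplace_pow_over_1p (k : nat) (x : R) :
  0 < x -> upper_gamma (- Z.of_nat k) x = exp (- x) * laplace_pow_over_1p k x / INR (fact k).
Proof.
intros Hx; unfold upper_gamma; apply RInt_gen_tail_laplace_pow_over_1p; [exact Hx |]; intros t Ht.
replace (- Z.of_nat k - 1)%Z with (- Z.of_nat (S k))%Z by lia.
rewrite powerRZ_neg', <- pow_powerRZ; reflexivity.
Qed.

Lemma expint_E1_laplace_pow_over_1p (x : R) : 0 < x -> expint_E1 x = exp (- x) * laplace_pow_over_1p 0 x.
Proof.
intros Hx; unfold expint_E1; rewrite (RInt_gen_tail_laplace_pow_over_1p 0); [simpl; field | exact Hx |].
intros t Ht; simpl; field; lra.
Qed.

Lemma laplace_1p_pow_rec (n : nat) (x : R) :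
  0 < x -> INR (S n) * laplace (fun t => (1 + t) ^ n) x
  = x * laplace (fun t => (1 + t) ^ S n) x - 1.
Proof.
intros Hx.
assert (T : forall n, tempered (fun t => (1 + t) ^ n))
  by (intros; apply tempered_poly_growth, poly_growth_1p_pow).
rewrite <- laplace_scal by auto.
apply laplace_derivative; try exact Hx; try apply T.
- apply tempered_scal, T.
- intros t Ht; auto_derive; [trivial |]; rewrite S_INR; destruct n; simpl; ring.
- apply (filterlim_filter_le_1 (F := locally 0)); [apply filter_le_within |].
  assert (C : continuous (fun t => (1 + t) ^ S n) 0).
  { apply (ex_derive_continuous (V := R_NormedModule)); auto_derive; trivial. }
  unfold continuous in C; rewrite Rplus_0_r, pow1 in C; exact C.
Qed.

(** The identity amounts to the substitution s = x (1 + t) in Gamma(n+1, x). It is proved by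
    differentiating the right-hand side, which vanishes at infinity, using [laplace_1p_pow_rec]. *)
Lemma upper_gamma_laplace_1p_pow (n : nat) (x : R) :
  0 < x -> upper_gamma (1 + Z.of_nat n) x
  = x ^ S n * exp (- x) * laplace (fun t => (1 + t) ^ n) x.
Proof.
intros Hx; unfold upper_gamma.
assert (T : forall n, tempered (fun t => (1 + t) ^ n))
  by (intros; apply tempered_poly_growth, poly_growth_1p_pow).
apply (RInt_gen_tail (fun x => x ^ S n * exp (- x) * laplace (fun t => (1 + t) ^ n) x)
  (fun t => t ^ n * exp (- t))); try exact Hx.
- intros t Ht.
  assert (HR := laplace_1p_pow_rec n t Ht).
  assert (E : laplace (fun u => u * (1 + u) ^ n) t
    = laplace (fun u => (1 + u) ^ S n) t + -1 * laplace (fun u => (1 + u) ^ n) t).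
  { rewrite <- laplace_scal, <- laplace_plus by (try apply tempered_scal; auto).
    apply laplace_ext; [apply tempered_plus; [| apply tempered_scal]; apply T | exact Ht |].
    intros; simpl; ring. }
  assert (D : is_derive (laplace (fun u => (1 + u) ^ n)) t
    (laplace (fun u => (1 + u) ^ n) t - laplace (fun u => (1 + u) ^ S n) t)).
  { evar_last; [apply is_derive_laplace; auto | cbv beta; rewrite E; ring]. }
  evar_last.
  + apply (is_derive_mult (K := R_AbsRing) (fun t => t ^ S n * exp (- t))
      (laplace (fun u => (1 + u) ^ n)) t (INR (S n) * t ^ n * exp (- t) - t ^ S n * exp (- t)));
      [| exact D | apply Rmult_comm].
    auto_derive; [trivial | rewrite S_INR; destruct n; simpl; ring].
  + change ((INR (S n) * t ^ n * exp (- t) - t ^ S n * exp (- t)) * laplace (fun u => (1 + u) ^ n) t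
      + t ^ S n * exp (- t)
        * (laplace (fun u => (1 + u) ^ n) t - laplace (fun u => (1 + u) ^ S n) t)
      = - (t ^ n * exp (- t))).
    transitivity (t ^ n * exp (- t) * (INR (S n) * laplace (fun u => (1 + u) ^ n) t
      - t * laplace (fun u => (1 + u) ^ S n) t)); [simpl (t ^ S n); ring |].
    rewrite HR; ring.
- intros t Ht; apply (ex_derive_continuous (V := R_NormedModule)); auto_derive; trivial.
- intros t Ht; replace (1 + Z.of_nat n - 1)%Z with (Z.of_nat n) by lia.
  rewrite pow_powerRZ; reflexivity.
- apply laplace_decay, T.
Qed.

(** gamma(k+1, z) with a natural exponent, for z of either sign. *)
Definition neg_exp_moment (k : nat) (z : R) : R := RInt (fun t => t ^ k * exp (- t)) 0 z.

Lemma continuous_neg_exp_moment (k : nat) (t : R) : continuous (fun t => t ^ k * exp (- t)) t.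
Proof. apply (ex_derive_continuous (V := R_NormedModule)); auto_derive; trivial. Qed.

Lemma is_RInt_neg_exp_moment (k : nat) (z : R) :
  is_RInt (fun t => t ^ k * exp (- t)) 0 z (neg_exp_moment k z).
Proof.
apply (RInt_correct (V := R_CompleteNormedModule)), (ex_RInt_continuous (V := R_CompleteNormedModule)).
intros; apply continuous_neg_exp_moment.
Qed.

Lemma lower_gamma_neg_exp_moment (k : nat) (z : R) : lower_gamma (Z.of_nat (S k)) z = neg_exp_moment k z.
Proof.
unfold lower_gamma, neg_exp_moment; apply RInt_ext; intros t _.
replace (Z.of_nat (S k) - 1)%Z with (Z.of_nat k) by lia; rewrite <- pow_powerRZ; reflexivity.
Qed.

(** * Moments over bounded intervals and the inner binomial sum *)

Lemma neg_exp_moment_0 (z : R) : neg_exp_moment 0 z = 1 - exp (- z).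
Proof.
apply (is_RInt_unique (V := R_CompleteNormedModule)).
replace (1 - exp (- z)) with (minus (- exp (- z)) (- exp (- 0)))
  by (rewrite Ropp_0, exp_0; unfold minus, plus, opp; simpl; ring).
apply (is_RInt_derive (V := R_CompleteNormedModule) (fun t => - exp (- t))).
- intros t _; auto_derive; [trivial | simpl; ring].
- intros t _; apply continuous_neg_exp_moment.
Qed.

Lemma neg_exp_moment_S (k : nat) (z : R) :
  neg_exp_moment (S k) z = INR (S k) * neg_exp_moment k z - z ^ S k * exp (- z).
Proof.
set (f := fun t => INR (S k) * (t ^ k * exp (- t)) + -1 * (t ^ S k * exp (- t))).
assert (H : is_RInt f 0 z (INR (S k) * neg_exp_moment k z + -1 * neg_exp_moment (S k) z)).
{ apply (is_RInt_plus (V := R_NormedModule)); apply (is_RInt_scal (V := R_NormedModule));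
    apply is_RInt_neg_exp_moment. }
assert (H' : is_RInt f 0 z (minus (z ^ S k * exp (- z)) (0 ^ S k * exp (- 0)))).
{ apply (is_RInt_derive (V := R_CompleteNormedModule) (fun t => t ^ S k * exp (- t))).
  - intros t _; unfold f; auto_derive; [trivial | rewrite S_INR; destruct k; simpl; ring].
  - intros t _; apply (ex_derive_continuous (V := R_NormedModule)); unfold f; auto_derive; trivial. }
assert (E : INR (S k) * neg_exp_moment k z + -1 * neg_exp_moment (S k) z
  = minus (z ^ S k * exp (- z)) (0 ^ S k * exp (- 0))).
{ rewrite <- (is_RInt_unique (V := R_CompleteNormedModule) _ _ _ _ H).
  apply (is_RInt_unique (V := R_CompleteNormedModule)), H'. }
change (INR (S k) * neg_exp_moment k z + -1 * neg_exp_moment (S k) z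
  = z ^ S k * exp (- z) - 0 ^ S k * exp (- 0)) in E.
rewrite pow_i in E by lia; lra.
Qed.

(* The integral of [t^k exp t] over [0, x]. *)
Definition pos_exp_moment (k : nat) (x : R) : R := (-1) ^ (k + 1) * neg_exp_moment k (- x).

Lemma pos_exp_moment_0 (x : R) : pos_exp_moment 0 x = exp x - 1.
Proof. unfold pos_exp_moment; rewrite neg_exp_moment_0, Ropp_involutive; simpl; ring. Qed.

Lemma pos_exp_moment_S (k : nat) (x : R) : pos_exp_moment (S k) x = x ^ S k * exp x - INR (S k) * pos_exp_moment k x.
Proof.
unfold pos_exp_moment; rewrite neg_exp_moment_S, Ropp_involutive.
replace ((- x) ^ S k) with ((-1) ^ S k * x ^ S k) by (rewrite <- Rpow_mult_distr; f_equal; ring).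
rewrite !Nat.add_1_r.
assert (E : (-1) ^ S (S k) * (-1) ^ S k = - 1).
{ rewrite <- pow_add; replace (S (S k) + S k)%nat with (S (2 * S k)) by lia; apply pow_1_odd. }
transitivity (- (((-1) ^ S (S k) * (-1) ^ S k) * (x ^ S k * exp x))
  + (-1) ^ S (S k) * INR (S k) * neg_exp_moment k (- x)).
- ring.
- rewrite E; simpl pow; ring.
Qed.

(** Links two forms: expanding the power gives a binomial sum of lower gamma functions at x, while
    reflecting t to x - t gives the moment of exp t, hence a lower gamma function at -x. *)
Definition binomial_moment (k : nat) (x : R) : R := RInt (fun t => (1 - t / x) ^ k * exp (- t)) 0 x.

Lemma is_RInt_binomial_moment (k : nat) (x : R) :
  is_RInt (fun t => (1 - t / x) ^ k * exp (- t)) 0 x (binomial_moment k x).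
Proof.
apply (RInt_correct (V := R_CompleteNormedModule)), (ex_RInt_continuous (V := R_CompleteNormedModule)).
intros t _; apply (ex_derive_continuous (V := R_NormedModule)); auto_derive; trivial.
Qed.

Lemma binomial_moment_S (k : nat) (x : R) : 0 < x -> binomial_moment (S k) x = 1 - INR (S k) / x * binomial_moment k x.
Proof.
intros Hx.
set (f := fun t => (-1) * ((1 - t / x) ^ S k * exp (- t)) + (- (INR (S k) / x)) * ((1 - t / x) ^ k * exp (- t))).
assert (H : is_RInt f 0 x (-1 * binomial_moment (S k) x + - (INR (S k) / x) * binomial_moment k x)).
{ apply (is_RInt_plus (V := R_NormedModule)); apply (is_RInt_scal (V := R_NormedModule)); apply is_RInt_binomial_moment. }
assert (H' : is_RInt f 0 x (minus ((1 - x / x) ^ S k * exp (- x)) ((1 - 0 / x) ^ S k * exp (- 0)))).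
{ apply (is_RInt_derive (V := R_CompleteNormedModule) (fun t => (1 - t / x) ^ S k * exp (- t))).
  - intros t _; unfold f, Rdiv, Rminus; auto_derive; [trivial | rewrite S_INR; destruct k; simpl; ring].
  - intros t _; apply (ex_derive_continuous (V := R_NormedModule)); unfold f; auto_derive; trivial. }
assert (E : -1 * binomial_moment (S k) x + - (INR (S k) / x) * binomial_moment k x
  = minus ((1 - x / x) ^ S k * exp (- x)) ((1 - 0 / x) ^ S k * exp (- 0))).
{ rewrite <- (is_RInt_unique (V := R_CompleteNormedModule) _ _ _ _ H).
  apply (is_RInt_unique (V := R_CompleteNormedModule)), H'. }
change (-1 * binomial_moment (S k) x + - (INR (S k) / x) * binomial_moment k x
  = (1 - x / x) ^ S k * exp (- x) - (1 - 0 / x) ^ S k * exp (- 0)) in E.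
replace (1 - x / x) with 0 in E by (field; lra); replace (1 - 0 / x) with 1 in E by (field; lra).
rewrite pow_i, pow1, Ropp_0, exp_0 in E by lia; lra.
Qed.

(** The reflection of t to x - t, obtained by comparing the recursions in k of the two sides. *)
Lemma binomial_moment_pos_exp_moment (k : nat) (x : R) : 0 < x -> binomial_moment k x = exp (- x) * pos_exp_moment k x / x ^ k.
Proof.
intros Hx; assert (Ee : exp (- x) * exp x = 1) by (rewrite <- exp_plus, Rplus_opp_l; apply exp_0).
induction k as [| k IH].
- transitivity (neg_exp_moment 0 x); [unfold binomial_moment, neg_exp_moment; apply RInt_ext; intros; simpl; ring |].
  rewrite neg_exp_moment_0, pos_exp_moment_0; simpl; field_simplify; lra.
- rewrite binomial_moment_S, IH, pos_exp_moment_S by exact Hx.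
  assert (Hp : x ^ k <> 0) by (apply pow_nonzero; lra).
  transitivity (exp (- x) * exp x - INR (S k) * exp (- x) * pos_exp_moment k x / x ^ S k).
  + rewrite Ee; simpl (x ^ S k); field; split; [exact Hp | lra].
  + simpl (x ^ S k); field; split; [exact Hp | lra].
Qed.

Lemma is_RInt_sum (f : nat -> R -> R) (c I : nat -> R) (a b : R) (n : nat) :
  (forall k, is_RInt (f k) a b (I k)) ->
  is_RInt (fun t => sum_f_R0 (fun k => c k * f k t) n) a b (sum_f_R0 (fun k => c k * I k) n).
Proof.
intros H; induction n as [| n IH]; simpl.
- apply (is_RInt_scal (V := R_NormedModule)), H.
- apply (is_RInt_plus (V := R_NormedModule)); [exact IH | apply (is_RInt_scal (V := R_NormedModule)), H].
Qed.

(** The left-hand side is, up to sign of the prefactor 1/x, the binomial expansion of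
    [binomial_moment]; the exponent [S j] is the one in which the increment of the inner sum appears
    after Pascal's rule. *)
Lemma binomial_neg_exp_moment (k : nat) (x : R) : 0 < x ->
  sum_f_R0 (fun j => Binomial.C k j * / (- x) ^ S j * neg_exp_moment j x) k
  = - (exp (- x) * pos_exp_moment k x / x ^ S k).
Proof.
intros Hx.
assert (Hn : - x <> 0) by lra.
transitivity (/ (- x) * binomial_moment k x).
- symmetry.
  transitivity (sum_f_R0 (fun j => (Binomial.C k j * / (- x) ^ j) * neg_exp_moment j x) k * / (- x)).
  + rewrite Rmult_comm; f_equal.
    apply (is_RInt_unique (V := R_CompleteNormedModule)).
    apply (is_RInt_ext (V := R_NormedModule)
      (fun t => sum_f_R0 (fun j => (Binomial.C k j * / (- x) ^ j) * (t ^ j * exp (- t))) k)).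
    * intros t _; replace (1 - t / x) with (t / - x + 1) by (field; lra).
      rewrite binomial, Rmult_comm, scal_sum; apply sum_eq; intros j _.
      rewrite pow1; unfold Rdiv; rewrite Rpow_mult_distr, pow_inv; ring.
    * apply is_RInt_sum; intros j; apply is_RInt_neg_exp_moment.
  + rewrite Rmult_comm, scal_sum; apply sum_eq; intros j _; simpl pow.
    field; split; [apply pow_nonzero |]; lra.
- rewrite binomial_moment_pos_exp_moment by exact Hx; simpl (x ^ S k); field.
  split; [apply pow_nonzero; lra | lra].
Qed.

(** Pascal's rule, with the lower neighbour reindexed by j = l - 1. *)
Lemma sum_binomial_S (z : nat -> R) (k : nat) :
  sum_n_m (fun l => Binomial.C (S k) l * z l) 1 (S k)
  = sum_n_m (fun l => Binomial.C k l * z l) 1 k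
    + sum_f_R0 (fun j => Binomial.C k j * z (S j)) k.
Proof.
assert (Cnn : forall m, Binomial.C m m = 1).
{ intros m; unfold Binomial.C; rewrite Nat.sub_diag; simpl; field; apply INR_fact_neq_0. }
assert (E : forall a m, sum_n_m a 1 (S m) = sum_f_R0 (fun j => a (S j)) m).
{ intros a m; rewrite <- sum_n_m_S, <- sum_n_Reals; reflexivity. }
rewrite E; destruct k as [| m].
- rewrite sum_n_m_zero by lia; unfold zero; simpl; rewrite !Cnn; ring.
(* The top term is split off before Pascal's rule is used: with truncated subtraction
   [Binomial.C k (S k)] is not 0. *)
- rewrite E, !tech5, !Cnn, <- Rplus_assoc, <- plus_sum; f_equal.
  apply sum_eq; intros j Hj; rewrite <- pascal by lia; ring.
Qed.

Definition inner_sum (k : nat) (x : R) : R :=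
  sum_n_m (fun l : nat =>
    Binomial.C k l * powerRZ (- x) (- Z.of_nat l) * lower_gamma (Z.of_nat l) x) 1 k.

Lemma inner_sum_S (k : nat) (x : R) : 0 < x ->
  inner_sum (S k) x = inner_sum k x - exp (- x) * pos_exp_moment k x / x ^ S k.
Proof.
intros Hx; unfold inner_sum.
set (z := fun l => powerRZ (- x) (- Z.of_nat l) * lower_gamma (Z.of_nat l) x).
assert (E : forall c m, sum_n_m (fun l : nat =>
    Binomial.C c l * powerRZ (- x) (- Z.of_nat l) * lower_gamma (Z.of_nat l) x) 1 m
  = sum_n_m (fun l => Binomial.C c l * z l) 1 m).
{ intros c m; apply sum_n_m_ext; intros l; apply Rmult_assoc. }
rewrite !E, sum_binomial_S.
replace (sum_f_R0 _ k) with (- (exp (- x) * pos_exp_moment k x / x ^ S k)); [ring |].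
rewrite <- binomial_neg_exp_moment by exact Hx; apply sum_eq; intros j _; unfold z.
rewrite lower_gamma_neg_exp_moment, powerRZ_neg', <- pow_powerRZ; ring.
Qed.

(** Induction on k. By the recursions of Gamma(-k, x), of the moment of exp t and of the inner sum,
    all terms containing the moment of index k cancel in the increment. What remains is Gamma(-k-1,
    x) x^(k+1) e^x, the increment found in [laplace_pow_ln_1p_S]. At k = 0 the claim rests on E_1(x)
    = Gamma(0, x). *)
Lemma laplace_pow_ln_1p (k : nat) (x : R) :
  0 < x -> x ^ S k / INR (fact k) * laplace (fun t => t ^ k * ln (1 + t)) x
  = expint_E1 x + upper_gamma (- Z.of_nat k) x * pos_exp_moment k x - inner_sum k x.
Proof.
intros Hx; assert (Ee : exp (- x) * exp x = 1) by (rewrite <- exp_plus, Rplus_opp_l; apply exp_0).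
rewrite expint_E1_laplace_pow_over_1p by exact Hx.
induction k as [| k IH].
- rewrite (laplace_ext (fun t => ln (1 + t)))
    by (try assumption; try apply tempered_ln_1p; intros; simpl; ring).
  rewrite upper_gamma_laplace_pow_over_1p, pos_exp_moment_0 by exact Hx.
  unfold inner_sum; rewrite sum_n_m_zero by lia; unfold zero; simpl.
  transitivity (x * laplace (fun t => ln (1 + t)) x); [field |].
  rewrite laplace_ln_1p_0 by exact Hx.
  transitivity ((exp (- x) * exp x) * laplace_pow_over_1p 0 x); [rewrite Ee; ring | field].
- rewrite laplace_pow_ln_1p_S, IH, inner_sum_S, !upper_gamma_laplace_pow_over_1p, pos_exp_moment_S by exact Hx.
  assert (HB := laplace_pow_over_1p_rec k x Hx).
  assert (HB' : laplace_pow_over_1p k x = INR (fact k) / x ^ S k - laplace_pow_over_1p (S k) x) by lra.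
  rewrite HB', fact_simpl, mult_INR.
  assert (Hf : INR (fact k) <> 0) by apply INR_fact_neq_0.
  assert (HS : INR (S k) <> 0) by (apply not_0_INR; lia).
  assert (Hp : x ^ S k <> 0) by (apply pow_nonzero; lra).
  set (P := x ^ S k) in *; set (Bs := laplace_pow_over_1p (S k) x); set (B0 := laplace_pow_over_1p 0 x).
  set (g := pos_exp_moment k x); set (F := INR (fact k)) in *; set (N := INR (S k)) in *.
  set (S0 := inner_sum k x).
  transitivity (exp (- x) * B0 + exp (- x) * (F / P - Bs) / F * g - S0
    + (exp (- x) * exp x) * (P / (N * F) * Bs)).
  + rewrite Ee; ring.
  + field; auto.
Qed.

Definition bracket (k : nat) (x : R) : R :=
  (-1) ^ (k + 1) * upper_gamma (- Z.of_nat k) x * lower_gamma (Z.of_nat k + 1) (- x)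
  - harmonic k - inner_sum k x.

(** Difference of the formulas for ln (1+t) and ln t. Euler's constant appears with the same
    coefficient 1 for every k, so after the binomial summation it multiplies exactly the transform
    of (1+t)^n. *)
Lemma laplace_pow_rho (k : nat) (x : R) :
  0 < x -> x ^ S k / INR (fact k) * laplace (fun t => t ^ k * rho t) x
  = expint_E1 x + ln x + laplace (fun t => 1 * nlog t) 1 + bracket k x.
Proof.
intros Hx.
assert (T1 := tempered_pow_mult k _ tempered_ln_1p); assert (T2 := tempered_pow_mult k _ tempered_ln).
assert (T3 := tempered_scal (-1) _ T2).
rewrite (laplace_ext (fun t => t ^ k * ln (1 + t) + -1 * (t ^ k * ln t))
  (fun t => t ^ k * rho t) x).
- rewrite laplace_plus, laplace_scal, Rmult_plus_distr_l, laplace_pow_ln_1p by assumption.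
  assert (E := laplace_pow_ln k x Hx).
  unfold bracket; replace (Z.of_nat k + 1)%Z with (Z.of_nat (S k)) by lia.
  rewrite lower_gamma_neg_exp_moment; unfold pos_exp_moment; lra.
- apply tempered_plus; assumption.
- exact Hx.
- intros; unfold rho; ring.
Qed.

(** * Binomial summation and the final formula *)

Lemma laplace_sum (f : nat -> R -> R) (c : nat -> R) (x : R) (n : nat) :
  (forall k, tempered (f k)) -> 0 < x ->
  tempered (fun t => sum_f_R0 (fun k => c k * f k t) n) /\
  laplace (fun t => sum_f_R0 (fun k => c k * f k t) n) x
  = sum_f_R0 (fun k => c k * laplace (f k) x) n.
Proof.
intros Hf Hx; induction n as [| n [T IH]]; simpl.
- split; [apply tempered_scal, Hf | apply laplace_scal; auto].
- split; [apply tempered_plus; [exact T | apply tempered_scal, Hf] |].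
  rewrite laplace_plus, laplace_scal, IH; auto; apply tempered_scal, Hf.
Qed.

Lemma laplace_binomial (n : nat) (h : R -> R) (x : R) :
  tempered h -> 0 < x ->
  laplace (fun t => (1 + t) ^ n * h t) x
  = sum_f_R0 (fun k => Binomial.C n k * laplace (fun t => t ^ k * h t) x) n.
Proof.
intros Hh Hx.
destruct (laplace_sum (fun k t => t ^ k * h t) (Binomial.C n) x n) as [T E];
  [intros; apply tempered_pow_mult, Hh | exact Hx |].
rewrite <- E; apply laplace_ext; [exact T | exact Hx |].
intros t _; rewrite (Rplus_comm 1 t), binomial, Rmult_comm, scal_sum.
apply sum_eq; intros k _; rewrite pow1; ring.
Qed.

Lemma laplace_1p_pow_rho (n : nat) (x : R) : 0 < x ->
  laplace (fun t => (1 + t) ^ n * rho t) x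
    - laplace (fun t => 1 * nlog t) 1 * laplace (fun t => (1 + t) ^ n) x
  = (expint_E1 x + ln x) * laplace (fun t => (1 + t) ^ n) x
    + INR (fact n) / x * sum_n_m (fun k : nat =>
        powerRZ x (- Z.of_nat k) / INR (fact (n - k)) * bracket k x) 0 n.
Proof.
intros Hx.
assert (E1 : laplace (fun t => (1 + t) ^ n) x = laplace (fun t => (1 + t) ^ n * 1) x).
{ symmetry; apply laplace_ext; [apply tempered_poly_growth, poly_growth_1p_pow | exact Hx |].
  intros; ring. }
rewrite E1, !laplace_binomial by (try assumption; try apply tempered_1; apply tempered_subln, subln_rho).
change (sum_n_m (fun k : nat => powerRZ x (- Z.of_nat k) / INR (fact (n - k)) * bracket k x) 0 n)
  with (sum_n (fun k : nat => powerRZ x (- Z.of_nat k) / INR (fact (n - k)) * bracket k x) n).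
rewrite sum_n_Reals.
set (g := laplace (fun t => 1 * nlog t) 1); set (A := expint_E1 x + ln x).
(* With the multiple of Euler's constant moved to the right-hand side, the identity holds for each k
   separately. *)
apply (Rplus_eq_reg_r (g * sum_f_R0 (fun k => Binomial.C n k * laplace (fun t => t ^ k * 1) x) n)).
match goal with |- ?a - ?b + ?b = ?c + ?d + ?b => transitivity (c + b + d); [| ring]; transitivity a; [ring |] end.
rewrite <- Rmult_plus_distr_r, !scal_sum, <- plus_sum.
apply sum_eq; intros k Hk.
assert (E := laplace_pow_rho k x Hx); fold g in E.
assert (Hf : INR (fact k) <> 0) by apply INR_fact_neq_0.
assert (Hf' : INR (fact (n - k)) <> 0) by apply INR_fact_neq_0.
assert (Hp : x ^ k <> 0) by (apply pow_nonzero; lra).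
rewrite laplace_pow, powerRZ_neg', <- pow_powerRZ by exact Hx.
(* The k! in the binomial coefficient cancels the one in the normalisation x^(k+1) / k!, which
   leaves n! / ((n-k)! x^(k+1)). *)
transitivity (INR (fact n) / (INR (fact (n - k)) * x ^ S k)
  * (x ^ S k / INR (fact k) * laplace (fun t => t ^ k * rho t) x)).
- unfold Binomial.C; simpl (x ^ S k); field; repeat split; try assumption; lra.
- rewrite E; unfold A, Binomial.C; simpl (x ^ S k); field; repeat split; try assumption; lra.
Qed.

Theorem theorem18 (n : nat) (x : R) (hx : 0 < x) (s : R) (hs : s = 1 \/ s = -1) :
  is_derive (K := C_AbsRing) (V := C_NormedModule)
    (fun kappa : C => whittakerW kappa (RtoC (s * (INR n + 1) / 2)) x)
    (RtoC (INR n / 2))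
    (RtoC
      (Rpower x (- (INR n / 2)) * exp (x / 2)
         * upper_gamma (1 + Z.of_nat n) x * (expint_E1 x + ln x)
       + INR (fact n) * Rpower x (INR n / 2) * exp (- x / 2)
         * sum_n_m (fun k : nat =>
             powerRZ x (- Z.of_nat k) / INR (fact (n - k))
             * ((-1) ^ (k + 1) * upper_gamma (- Z.of_nat k) x
                  * lower_gamma (Z.of_nat k + 1) (- x)
                - harmonic k
                - sum_n_m (fun l : nat =>
                    Binomial.C k l * powerRZ (- x) (- Z.of_nat l)
                      * lower_gamma (Z.of_nat l) x) 1 k)) 0 n)).
Proof.
assert (H := is_derive_whittakerW n x s hx hs).
rewrite laplace_1p_pow_rho in H by exact hx.
match type of H with is_derive _ _ (RtoC ?a) => match goal with |- is_derive _ _ (RtoC ?b) =>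
  replace b with a; [exact H |] end end.
change (fun k : nat =>
   powerRZ x (- Z.of_nat k) / INR (fact (n - k))
   * ((-1) ^ (k + 1) * upper_gamma (- Z.of_nat k) x * lower_gamma (Z.of_nat k + 1) (- x)
      - harmonic k
      - sum_n_m (fun l : nat =>
          Binomial.C k l * powerRZ (- x) (- Z.of_nat l) * lower_gamma (Z.of_nat l) x) 1 k))
  with (fun k : nat => powerRZ x (- Z.of_nat k) / INR (fact (n - k)) * bracket k x).
rewrite upper_gamma_laplace_1p_pow by exact hx; unfold Rpower.
set (T := sum_n_m _ 0 n); set (L := laplace _ x); set (A := expint_E1 x + ln x).
(* The common prefactor e^(-x/2) x^(n/2+1) is rewritten twice: for the first term it absorbs the
   x^(n+1) e^(-x) of Gamma(n+1, x), for the second it yields a factor x against the 1/x in front of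
   the sum. *)
assert (E1 : exp (- (INR n / 2) * ln x) * exp (x / 2) * (x ^ S n * exp (- x))
  = exp (- x / 2) * exp ((INR n / 2 + 1) * ln x)).
{ rewrite <- (exp_ln (x ^ S n)) by (apply pow_lt, hx).
  rewrite ln_pow, <- !exp_plus, S_INR by exact hx; f_equal; field. }
assert (E2 : exp (- x / 2) * exp ((INR n / 2 + 1) * ln x)
  = exp (INR n / 2 * ln x) * exp (- x / 2) * x).
{ rewrite <- (exp_ln x) at 5 by exact hx; rewrite <- !exp_plus; f_equal; field. }
rewrite Rmult_plus_distr_l; f_equal.
- rewrite <- E1; ring.
- rewrite E2; field; lra.
Qed.
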